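(* Let $\Omega\subset\mathbb{R}^n$ be a nonempty open set, $M=(M_p)_{p\in\mathbb{Z}_+}$ a weight sequence as in the context, and let $f,g\in\mathcal{G}(\Omega)$ be such that for all $x\in\Omega$, $$(x,0)\notin WF_{\mathcal{A}}^{M}(f)+WF_{\mathcal{A}}^{M}(g).$$ Then $$WF_{\mathcal{A}}^{M}(fg)\subseteq\left(WF_{\mathcal{A}}^{M}(f)+WF_{\mathcal{A}}^{M}(g)\right)\cup WF_{\mathcal{A}}^{M}(f)\cup WF_{\mathcal{A}}^{M}(g).$$ Here $WF_{\mathcal{A}}^{M}(f)+WF_{\mathcal{A}}^{M}(g)=\{(x,\xi+\eta):(x,\xi)\in WF_{\mathcal{A}}^{M}(f),\ (x,\eta)\in WF_{\mathcal{A}}^{M}(g)\}$.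
   Context: $\mathbb{Z}_+=\{0,1,2,\dots\}$, $\mathcal{F}$ is the Fourier transform. Colombeau algebra: $\mathcal{X}(\Omega)$ is the set of families $(u_\varepsilon)_\varepsilon\in C^\infty(\Omega)^{]0,1]}$ such that for every compact $K\subset\Omega$ and every $\alpha\in\mathbb{Z}_+^n$ there are $m\in\mathbb{Z}_+$, $C>0$, $\eta\in\,]0,1]$ with $\sup_{K}|\partial^\alpha u_\varepsilon|\le C\varepsilon^{-m}$ for all $\varepsilon\in\,]0,\eta]$. $\mathcal{N}(\Omega)$ is the set of $(u_\varepsilon)_\varepsilon\in\mathcal{X}(\Omega)$ such that for every compact $K\subset\Omega$, every $\alpha$ and every $m\in\mathbb{Z}_+$ there are $C>0$, $\eta\in\,]0,1]$ with $\sup_{K}|\partial^\alpha u_\varepsilon|\le C\varepsilon^{m}$ for all $\varepsilon\in\,]0,\eta]$. $\mathcal{G}(\Omega)=\mathcal{X}(\Omega)/\mathcal{N}(\Omega)$. $\mathcal{G}_C(\Omega)$ is the subalgebra of those $f\in\mathcal{G}(\Omega)$ having a representative $(f_\varepsilon)_\varepsilon$ and a compact $K\subset\Omega$ with $\mathrm{supp}f_\varepsilon\subset K$ for all $\varepsilon$; such a representative is called compactly supported. Weight sequence: positive numbers $(M_p)_{p\in\mathbb{Z}_+}$ with $M_0=1$, (H1) $M_p^2\le M_{p-1}M_{p+1}$ for $p\ge1$, (H2) there are $A,H>0$ with $M_p\le AH^pM_qM_{p-q}$ for all $p\ge q$, (H3)$'$ $\sum_{p\ge1}M_{p-1}/M_p<\infty$.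 Associated function: $\widetilde M(t)=\sup_p\ln(t^p/M_p)$ for $t>0$, $\widetilde M(0)=0$. $\mathcal{D}^M(\Omega)$ is the space of compactly supported $\phi\in C^\infty(\Omega)$ such that for every compact $K\subset\Omega$ there is $c>0$ with $\sup_K|\partial^\alpha\phi|\le c^{|\alpha|+1}M_{|\alpha|}$ for all $\alpha\in\mathbb{Z}_+^n$. For $f\in\mathcal{G}_C(\Omega)$, $\sum_{\mathcal{A}}^{M}(f)\subset\mathbb{R}^n\setminus\{0\}$ is the complement of the set of points having an open conic neighborhood $\Gamma$ for which there are a compactly supported representative $(f_\varepsilon)_\varepsilon$ of $f$ and constants $a,b\ge0$, $C,k>0$, $\varepsilon_0\in\,]0,1]$ with $|\mathcal{F}(f_\varepsilon)(\xi)|\le C\varepsilon^{-b}\exp(-\widetilde M(k\varepsilon^a|\xi|))$ for all $\varepsilon\le\varepsilon_0$, $\xi\in\Gamma$. For $f\in\mathcal{G}(\Omega)$, the affine wave front set $WF_{\mathcal{A}}^{M}(f)\subset\Omega\times(\mathbb{R}^n\setminus\{0\})$ is defined by: $(x_0,\xi_0)\notin WF_{\mathcal{A}}^{M}(f)$ iff there is $\phi\in\mathcal{D}^M(\Omega)$, $\phi\equiv1$ on a neighborhood of $x_0$, with $\xi_0\notin\sum_{\mathcal{A}}^{M}(\phi f)$, i.e. there are an open conic neighborhood $\Gamma$ of $\xi_0$, a compactly supported representative $(h_\varepsilon)_\varepsilon$ of $\phi f$ and constants $a,b\ge0$, $C,k>0$, $\varepsilon_0\in\,]0,1]$ with $|\mathcal{F}(h_\varepsilon)(\xi)|\le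 C\varepsilon^{-b}\exp(-\widetilde M(k\varepsilon^a|\xi|))$ for all $\varepsilon\le\varepsilon_0$, $\xi\in\Gamma$. *)

(* Defs.v *)
From HB Require Import structures.
From mathcomp Require Import all_boot all_order all_algebra.
From mathcomp Require Import all_classical all_reals all_analysis.
From mathcomp Require Import complex.

Set Implicit Arguments.
Unset Strict Implicit.
Unset Printing Implicit Defensive.

Import Order.TTheory GRing.Theory Num.Theory.
Import numFieldNormedType.Exports.
Import ComplexField.Normc.

Local Open Scope classical_set_scope.
Local Open Scope ring_scope.
Local Open Scope complex_scope.

(** Complex-valued functions are differentiated and integrated through their
    real and imaginary parts. *)

Definition dotp (R : realType) (n : nat) (x y : 'rV[R]_n) : R :=
  \sum_(i < n) x ord0 i * y ord0 i.

(** Euclidean norm; the library norm on ['rV[R]_n] is the sup norm. *)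
Definition enorm (R : realType) (n : nat) (x : 'rV[R]_n) : R :=
  Num.sqrt (dotp x x).

Definition cfun (R : realType) (n : nat) : Type := 'rV[R]_n -> R[i].

Definition pderiv (R : realType) (n : nat) (i : 'I_n) (u : cfun R n) :
    cfun R n :=
  fun x => ('D_(delta_mx ord0 i) (fun y => complex.Re (u y)) x)
       +i* ('D_(delta_mx ord0 i) (fun y => complex.Im (u y)) x).

Definition multi_index (n : nat) : Type := {ffun 'I_n -> nat}.

Definition mi_size (n : nat) (al : multi_index n) : nat :=
  (\sum_(i < n) al i)%N.

(** [mderiv al u] is d_0^(al 0) ... d_(n-1)^(al (n-1)) u; the order is
    immaterial for the smooth functions it is applied to. *)
Definition mderiv (R : realType) (n : nat) (al : multi_index n)
    (u : cfun R n) : cfun R n :=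
  foldr (fun i v => iter (al i) (pderiv i) v) u (enum 'I_n).

Definition partials_at (R : realType) (n : nat) (u : cfun R n) (x : 'rV[R]_n) :
    Prop :=
  [/\ {for x, continuous (fun y => complex.Re (u y))},
      {for x, continuous (fun y => complex.Im (u y))} &
      forall i : 'I_n,
        derivable (fun y => complex.Re (u y)) x (delta_mx ord0 i) /\
        derivable (fun y => complex.Im (u y)) x (delta_mx ord0 i)].

(** C^oo(Om): a function on the open set [Om] is encoded by its extension by
    zero to R^n.  Smoothness, at the points of [Om] only, means that all
    iterated partial derivatives, in any order, exist and are continuous. *)
Definition Csmooth (R : realType) (n : nat) (Om : set 'rV[R]_n) :
    set (cfun R n) :=
  [set u | (forall x, ~ Om x -> u x = 0) /\
           (forall (s : seq 'I_n) x, Om x -> partials_at (foldr (@pderiv R n) u s) x)].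

Definition supp (R : realType) (n : nat) (u : cfun R n) : set 'rV[R]_n :=
  closure [set x | u x != 0].

(** A family is indexed by all of [R] but only its members with index in
    ]0, 1] are ever constrained or used. *)
Definition family_of (R : realType) (n : nat) : Type := R -> cfun R n.

Definition moderate (R : realType) (n : nat) (Om : set 'rV[R]_n) :
    set (family_of R n) :=
  [set u | (forall e : R, 0 < e <= 1 -> Csmooth Om (u e)) /\
    forall K : set 'rV[R]_n, compact K -> K `<=` Om ->
    forall al : multi_index n,
    exists (m : nat) (C eta : R), [/\ 0 < C, 0 < eta <= 1 &
      forall e : R, 0 < e <= eta -> forall x, K x ->
        normc (mderiv al (u e) x) <= C * e ^- m]].

Definition negligible_family (R : realType) (n : nat) (Om : set 'rV[R]_n) :
    set (family_of R n) :=
  [set u | moderate Om u /\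
    forall K : set 'rV[R]_n, compact K -> K `<=` Om ->
    forall (al : multi_index n) (m : nat),
    exists C eta : R, [/\ 0 < C, 0 < eta <= 1 &
      forall e : R, 0 < e <= eta -> forall x, K x ->
        normc (mderiv al (u e) x) <= C * e ^+ m]].

Definition gclass (R : realType) (n : nat) (Om : set 'rV[R]_n)
    (u : family_of R n) : set (family_of R n) :=
  [set v | moderate Om v /\
           negligible_family Om (fun e x => v e x - u e x)].

(** The quotient of the moderate by the negligible families, as a set of
    cosets: [f u] reads "[u] is a representative of [f]". *)
Definition colombeau (R : realType) (n : nat) (Om : set 'rV[R]_n) :
    set (set (family_of R n)) :=
  [set gclass Om u | u in moderate Om].

Definition gmul (R : realType) (n : nat) (Om : set 'rV[R]_n)
    (f g : set (family_of R n)) : set (family_of R n) :=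
  [set w | exists u v, [/\ f u, g v &
             gclass Om (fun e x => u e x * v e x) w]].

(** Image in the Colombeau algebra of a function in C^oo(Om). *)
Definition gconst (R : realType) (n : nat) (Om : set 'rV[R]_n)
    (phi : cfun R n) : set (family_of R n) :=
  gclass Om (fun _ : R => phi).

Definition compact_repr (R : realType) (n : nat) (Om : set 'rV[R]_n)
    (f : set (family_of R n)) (h : family_of R n) : Prop :=
  f h /\ exists K : set 'rV[R]_n, [/\ compact K, K `<=` Om &
           forall e : R, 0 < e <= 1 -> supp (h e) `<=` K].

(** Integral over R^n, as an iterated one-dimensional Lebesgue integral; it is
    only applied to compactly supported continuous functions, for which the
    order of integration is immaterial by Fubini's theorem. *)
Fixpoint iter_integral (R : realType) (n : nat) : ('rV[R]_n -> R) -> R :=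
  match n return ('rV[R]_n -> R) -> R with
  | 0%N => fun f => f 0
  | m.+1 => fun f =>
      \int[@lebesgue_measure R]_(t in setT)
        iter_integral (fun y : 'rV[R]_m =>
                         f (row_mx (const_mx t : 'rV[R]_1) y))
  end.

(** Fourier transform with kernel exp(-i x.xi). Other normalisations rescale
    [xi] or the value by a positive constant. *)
Definition fourier (R : realType) (n : nat) (u : cfun R n) : cfun R n :=
  fun xi =>
    let g x := u x * (cos (dotp x xi) -i* sin (dotp x xi)) in
    iter_integral (fun x => complex.Re (g x))
      +i* iter_integral (fun x => complex.Im (g x)).

Definition weight_sequence (R : realType) (M : nat -> R) : Prop :=
  [/\ (forall p, 0 < M p) /\ M 0%N = 1,
      forall p, (1 <= p)%N -> M p ^+ 2 <= M p.-1 * M p.+1,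
      exists A H : R, [/\ 0 < A, 0 < H &
        forall p q, (q <= p)%N -> M p <= A * H ^+ p * M q * M (p - q)%N] &
      cvgn (series (fun p => M p / M p.+1))].

(** For a weight sequence the supremum is over a nonempty bounded set, so the
    real-valued [sup] is the true one. *)
Definition assoc_fun (R : realType) (M : nat -> R) (t : R) : R :=
  if 0 < t then sup (range (fun p : nat => ln (t ^+ p / M p))) else 0.

Definition test_fun (R : realType) (n : nat) (Om : set 'rV[R]_n)
    (M : nat -> R) : set (cfun R n) :=
  [set phi | [/\ Csmooth Om phi,
    compact (supp phi) /\ supp phi `<=` Om &
    forall K : set 'rV[R]_n, compact K -> K `<=` Om ->
      exists c : R, 0 < c /\ forall x, K x -> forall al : multi_index n,
        normc (mderiv al phi x) <= c ^+ (mi_size al).+1 * M (mi_size al)]].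

Definition open_cone (R : realType) (n : nat) (G : set 'rV[R]_n) : Prop :=
  [/\ open G, ~ G 0 &
      forall (t : R) xi, 0 < t -> G xi -> G (t *: xi)].

Definition affine_decay (R : realType) (n : nat) (M : nat -> R)
    (h : family_of R n) (G : set 'rV[R]_n) : Prop :=
  exists a b C k e0 : R,
    [/\ 0 <= a /\ 0 <= b, 0 < C /\ 0 < k, 0 < e0 <= 1 &
      forall (e : R) (xi : 'rV[R]_n), 0 < e <= e0 -> G xi ->
        normc (fourier (h e) xi) <=
          C * e `^ (- b) * expR (- assoc_fun M (k * e `^ a * enorm xi))].

Definition Sigma_A (R : realType) (n : nat) (Om : set 'rV[R]_n)
    (M : nat -> R) (f : set (family_of R n)) : set 'rV[R]_n :=
  [set xi0 | xi0 != 0 /\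
    ~ exists G h, [/\ open_cone G, G xi0, compact_repr Om f h &
                      affine_decay M h G]].

Definition WF_A (R : realType) (n : nat) (Om : set 'rV[R]_n)
    (M : nat -> R) (f : set (family_of R n)) :
    set ('rV[R]_n * 'rV[R]_n) :=
  [set z | [/\ Om z.1, z.2 != 0 &
    ~ exists phi, [/\ test_fun Om M phi, \forall y \near z.1, phi y = 1 &
                      ~ Sigma_A Om M (gmul Om (gconst Om phi) f) z.2]]].

Definition fiber_sum (R : realType) (n : nat)
    (A B : set ('rV[R]_n * 'rV[R]_n)) : set ('rV[R]_n * 'rV[R]_n) :=
  [set z | exists xi eta, [/\ A (z.1, xi), B (z.1, eta) & z.2 = xi + eta]].

(* Main.v *)
Require Import Defs.
From mathcomp Require Import all_boot all_order all_algebra.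
From mathcomp Require Import all_classical all_reals all_analysis.
From mathcomp Require Import complex.
From mathcomp Require Import ring lra zify.
Import Order.TTheory GRing.Theory Num.Theory.
Import numFieldNormedType.Exports.
Import ComplexField.Normc.
Local Open Scope classical_set_scope.
Local Open Scope ring_scope.
Set Implicit Arguments.
Unset Strict Implicit.
Unset Printing Implicit Defensive.

(** Fix a point [x0] and a direction [xi0]. If neither [xi0] nor [0] is the sum of
    two singular directions of [f] and [g] at [x0], and [xi0] is singular for
    neither factor, then every pair [(z, eta) != 0] with [z + eta] on the closed
    half-line of [xi0] has [z] regular for [f] or [eta] regular for [g]. Locally the
    Fourier transform of [f * g] at [xi] is the convolution of the transforms of
    local representatives, an integral over pairs with [z + eta = xi]; at each
    pair one factor has the decay [exp (- assoc_fun M)] and the other is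
    absolutely summable. By compactness of the unit sphere of pairs the decay is
    uniform for [xi] in a cone around [xi0], at the scale of [z + eta]
    ([uniform_pair_decay], [symbol_product]).

    Three points need care.

    - Convolution. The representatives are supported in a box, so each is, on
      this box, the sum of its Fourier series over a lattice of frequencies
      ([fourier_series_inversion]), and the transform of a product is a discrete
      convolution ([usum_fourierM]). This rests on elementary properties of the
      iterated integral only: it is linear, monotone and translation invariant
      on continuous functions supported in a box ([iter_integral_linearP],
      [iter_integral_translate]). Inversion is Fejer's theorem
      ([fejer_inversion]); the required summability comes from integrations by
      parts ([iter_integral_derive], [fourier_weight_bound]).

    - Different representatives. Regularity of [f] at [(x0, z)] is witnessed by a
      cutoff and a representative that depend on [z], and two representatives
      differ by a negligible family whose transform need not have the required
      decay. Two of them are merged frequency by frequency: the trigonometric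
      series of the difference, restricted to the frequencies where the second
      has the smaller coefficient, is subtracted from the first. This series is
      negligible, all its derivatives being controlled by those of the
      difference, and what remains has at each frequency the smaller of the two
      coefficients ([combine_decays]). After compactness on the sphere of pairs,
      one representative of each factor is enough ([local_repr_combine],
      [notin_WF_mul]).

    - Cutoffs. Multiplication by a test function of class [M] preserves decay
      ([test_fun_decays], [decays_cutoff]), and by logarithmic convexity of [M]
      products of test functions are test functions ([test_funM]). Products of
      the cutoffs given by the hypotheses therefore serve as cutoffs for the
      merged representatives and for the product. *)

(** * Vectors, boxes and continuous functions supported in a box *)

Section Rows.
Context {R : realType}.

Definition in_box n (B : R) (x : 'rV[R]_n) := forall i, `|x ord0 i| <= B.

Lemma row_entry_le_norm n (x : 'rV[R]_n) i : `|x ord0 i| <= `|x|.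
Proof.
rewrite [leRHS]/Num.norm /= mx_normrE; apply/bigmax_geP; right.
by exists (ord0, i).
Qed.

Lemma row_norm_lt n (x : 'rV[R]_n) (d : R) :
  0 < d -> (forall i, `|x ord0 i| < d) -> `|x| < d.
Proof.
move=> d0 h; rewrite [ltLHS]/Num.norm /= mx_normrE; apply/bigmax_ltP; split=> //.
by move=> [i j] _ /=; rewrite ord1; exact: h.
Qed.

Lemma row_norm_le n (x : 'rV[R]_n) (d : R) :
  0 <= d -> (forall i, `|x ord0 i| <= d) -> `|x| <= d.
Proof.
move=> d0 h; rewrite [leLHS]/Num.norm /= mx_normrE; apply/bigmax_leP; split=> //.
by move=> [i j] _ /=; rewrite ord1; exact: h.
Qed.

Lemma compact_in_box n (B : R) : compact [set x : 'rV[R]_n | in_box B x].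
Proof.
have := @rV_compact R n (fun=> `[(- B), B]%classic)
  (fun=> @segment_compact R (- B) B).
congr compact; apply/seteqP; split=> x h i.
  by have := h i; rewrite /= in_itv /= -ler_norml.
by rewrite /= in_itv /= -ler_norml; exact: h.
Qed.

Lemma continuous_epsP (V W : normedModType R) (f : V -> W) (x : V) :
  {for x, continuous f} <-> forall e, 0 < e -> exists2 d, 0 < d &
    forall y, `|x - y| < d -> `|f x - f y| < e.
Proof.
split=> [cf e e0|h].
  have /cvgrPdist_lt/(_ _ e0)/nbhs_ballP[d /= d0 hd] := cf.
  by exists d => // y xy; apply: hd; rewrite -ball_normE.
apply/cvgrPdist_lt => e /h[d d0 hd]; apply/nbhs_ballP; exists d => //= y.
by rewrite -ball_normE; exact: hd.
Qed.

(** The second point is not confined to [K]: a continuous function with compact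
    support is then uniformly continuous on the whole space. *)
Lemma compact_unif_cont (V : normedModType R) (K : set V) (f : V -> R) :
  compact K -> continuous f -> forall e, 0 < e ->
  exists2 d, 0 < d & forall x y, K x -> `|x - y| < d -> `|f x - f y| < e.
Proof.
move=> /compact_near_coveringP cK cf e e0.
have h : \forall d \near 0^'+, K `<=`
    (fun x => forall y, `|x - y| < d -> `|f x - f y| < e).
  apply: cK => x Kx.
  have e20 : 0 < e / 2 by rewrite divr_gt0.
  have /cvgrPdist_lt/(_ _ e20)/nbhs_ballP[d /= d0 hd] := cf x.
  exists (ball x (d / 2), [set t | 0 < t < d / 2]) => /=.
    split; first by apply: nbhsx_ballx; rewrite divr_gt0.
    near=> t; apply/andP; split; near: t; first exact: nbhs_right_gt.
    by apply: nbhs_right_lt; rewrite divr_gt0.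
  move=> [x' t] /= [bx /andP[t0 td]] y x'y.
  rewrite [e]splitr; apply: le_lt_trans (ler_distD (f x) _ _) _.
  apply: ltrD; first rewrite distrC.
    by apply: hd; apply: le_ball bx; rewrite ler_pdivrMr// ler_pMr// ler1n.
  apply: hd; rewrite -ball_normE /= in bx *.
  rewrite [d]splitr; apply: le_lt_trans (ler_distD x' _ _) _.
  by apply: ltrD => //; exact: lt_trans td.
have : \forall d \near 0^'+, 0 < d /\ K `<=`
    (fun x => forall y, `|x - y| < d -> `|f x - f y| < e).
  near=> d; split; first by near: d; exact: nbhs_right_gt.
  by near: d.
by move=> /filter_ex[d [d0 hd]]; exists d => // x y Kx; exact: hd.
Unshelve. all: by end_near. Qed.

Definition boxed_cont n (B : R) (f : 'rV[R]_n -> R) :=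
  continuous f /\ forall x, ~ in_box B x -> f x = 0.

Lemma in_boxW n (B B' : R) (x : 'rV[R]_n) : B <= B' -> in_box B x -> in_box B' x.
Proof. by move=> BB' h i; apply: le_trans (h i) BB'. Qed.

Lemma boxed_contW n (B B' : R) (f : 'rV[R]_n -> R) :
  B <= B' -> boxed_cont B f -> boxed_cont B' f.
Proof.
move=> BB' [cf hf]; split=> // x nx; apply: hf => h; apply: nx.
exact: in_boxW h.
Qed.

Lemma boxed_cont_unif n (B : R) (f : 'rV[R]_n -> R) : boxed_cont B f ->
  forall e, 0 < e ->
  exists2 d, 0 < d & forall x y, `|x - y| < d -> `|f x - f y| < e.
Proof.
move=> [cf hf] e e0.
have [d d0 hd] := compact_unif_cont (@compact_in_box n B) cf e0.
exists d => // x y xy.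
(* If only one of the two points is in the box, the estimate is applied from
   that point. *)
have [bx|nbx] := pselect (in_box B x); first exact: hd.
have [by'|nby] := pselect (in_box B y).
  by rewrite distrC; apply: hd => //; rewrite distrC.
by rewrite !hf// subrr normr0.
Qed.

Lemma boxed_cont_bounded n (B : R) (f : 'rV[R]_n -> R) : boxed_cont B f ->
  exists2 M, 0 <= M & forall x, `|f x| <= M.
Proof.
move=> [cf hf].
have cK : compact [set x : 'rV[R]_n | in_box B x] := @compact_in_box n B.
have := continuous_compact (continuous_subspaceT cf) cK.
move=> /compact_bounded [M [_ hM]].
exists (`|M| + 1) => [|x]; first by rewrite addr_ge0.
have [bx|nbx] := pselect (in_box B x); last first.
  by rewrite hf// normr0 addr_ge0.
apply: (hM (`|M| + 1)); last by exists x.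
by rewrite (le_lt_trans (ler_norm M))// ltrDl.
Qed.

Lemma boxed_contD n (B : R) (f g : 'rV[R]_n -> R) :
  boxed_cont B f -> boxed_cont B g -> boxed_cont B (fun x => f x + g x).
Proof.
move=> [cf hf] [cg hg]; split=> [x|x nx]; last by rewrite hf// hg// addr0.
exact: continuousD (cf x) (cg x).
Qed.

Lemma boxed_contMr n (B : R) (f g : 'rV[R]_n -> R) :
  boxed_cont B f -> continuous g -> boxed_cont B (fun x => f x * g x).
Proof.
move=> [cf hf] cg; split=> [x|x nx]; last by rewrite hf// mul0r.
exact: continuousM (cf x) (cg x).
Qed.

Lemma boxed_contZ n (B : R) (c : R) (f : 'rV[R]_n -> R) :
  boxed_cont B f -> boxed_cont B (fun x => c * f x).
Proof.
move=> hf; under eq_fun do rewrite mulrC.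
by apply: boxed_contMr => // x; exact: cst_continuous.
Qed.

Definition cons_row n (t : R) (y : 'rV[R]_n) : 'rV[R]_n.+1 :=
  row_mx (const_mx t : 'rV[R]_1) y.

Lemma cons_row0 n t (y : 'rV[R]_n) : cons_row t y ord0 ord0 = t.
Proof.
rewrite /cons_row.
have -> : ord0 = lshift n (ord0 : 'I_1) by exact: val_inj.
by rewrite (@row_mxEl R 1 1 n) mxE.
Qed.

Lemma cons_rowS n t (y : 'rV[R]_n) i : cons_row t y ord0 (lift ord0 i) = y ord0 i.
Proof.
rewrite /cons_row.
have -> : lift ord0 i = rshift 1 i by exact: val_inj.
by rewrite (@row_mxEr R 1 1 n).
Qed.

Lemma cons_rowP n (P : 'I_n.+1 -> R -> Prop) t (y : 'rV[R]_n) :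
  (forall i, P i (cons_row t y ord0 i)) <->
  P ord0 t /\ forall i, P (lift ord0 i) (y ord0 i).
Proof.
split=> [h|[h0 h] i].
  split; first by have := h ord0; rewrite cons_row0.
  by move=> i; have := h (lift ord0 i); rewrite cons_rowS.
case: (unliftP ord0 i) => [j ->|->]; first by rewrite cons_rowS.
by rewrite cons_row0.
Qed.

Lemma cons_row_dist n (t t' : R) (y y' : 'rV[R]_n) d :
  0 < d -> `|t - t'| < d -> `|y - y'| < d ->
  `|cons_row t y - cons_row t' y'| < d.
Proof.
move=> d0 tt yy; apply: row_norm_lt => // i.
rewrite mxE [X in _ + X]mxE; case: (unliftP ord0 i) => [j ->|->].
  rewrite !cons_rowS; apply: le_lt_trans yy.
  by apply: le_trans (row_entry_le_norm _ j); rewrite !mxE.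
by rewrite !cons_row0.
Qed.

Lemma cons_row_in_box n B t (y : 'rV[R]_n) :
  in_box B (cons_row t y) <-> `|t| <= B /\ in_box B y.
Proof. exact: (@cons_rowP n (fun _ z => `|z| <= B)). Qed.

Lemma boxed_cont_slice n B (f : 'rV[R]_n.+1 -> R) t :
  boxed_cont B f -> boxed_cont B (fun y => f (cons_row t y)).
Proof.
move=> cf; split=> [y|y ny]; last first.
  by apply: cf.2 => /cons_row_in_box[].
apply/continuous_epsP => e e0.
have [d d0 hd] := boxed_cont_unif cf e0.
exists d => // z yz.
by apply: hd; apply: cons_row_dist => //; rewrite subrr normr0.
Qed.

End Rows.

(** * The iterated integral *)

Section Line.
Context {R : realType}.
Notation mu := (@lebesgue_measure R).

Definition boxed_cont1 (B : R) (g : R -> R) :=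
  continuous g /\ forall t, B < `|t| -> g t = 0.

Lemma boxed_cont1_restrict B (g : R -> R) : boxed_cont1 B g ->
  g \_ `[(- B), B] = g.
Proof.
move=> [_ hg]; apply/funext => t; rewrite patchE; case: ifPn => //.
rewrite notin_setE /= in_itv /= -ler_norml => /negP; rewrite -ltNge => h.
by rewrite hg.
Qed.

Lemma boxed_cont1_int B (g : R -> R) : boxed_cont1 B g ->
  \int[mu]_(t in setT) g t = \int[mu]_(t in `[(- B), B]) g t.
Proof. by move=> bg; rewrite [RHS]Rintegral_mkcond boxed_cont1_restrict. Qed.

Lemma boxed_cont1_integrable B (g : R -> R) : boxed_cont1 B g ->
  mu.-integrable setT (EFin \o g).
Proof.
move=> bg.
have : mu.-integrable `[(- B), B] (EFin \o g).
  apply: continuous_compact_integrable; first exact: segment_compact.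
  exact: continuous_subspaceT bg.1.
rewrite integrable_mkcond//= => h; apply: eq_integrable h => // t _.
by rewrite restrict_EFin boxed_cont1_restrict.
Qed.

Lemma boxed_cont1_bound B M (g : R -> R) : 0 <= B -> boxed_cont1 B g ->
  (forall t, `|g t| <= M) -> `|\int[mu]_(t in setT) g t| <= M * (2 * B).
Proof.
move=> B0 bg gM; rewrite (boxed_cont1_int bg).
have ig : mu.-integrable `[(- B), B] (EFin \o g).
  by apply: integrableS (boxed_cont1_integrable bg).
apply: le_trans (le_normr_Rintegral _ ig) _ => //.
have -> : M * (2 * B) = \int[mu]_(t in `[(- B), B]) (fun=> M) t.
  rewrite Rintegral_cst//; congr (M * _).
  have := @lebesgue_measure_itv R `[(- B), B]; rewrite /= lte_fin => ->.
  by case: ltP => h /=; [ring | lra].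
apply: le_Rintegral => //.
- by apply: integrable_norm => //.
- apply: continuous_compact_integrable; first exact: segment_compact.
  by apply: continuous_subspaceT => x; exact: cst_continuous.
Qed.

(** The substitution rule holds on segments, whence the passage to a segment
    that contains the supports of both [g] and its translate. *)
Lemma boxed_cont1_shift B (g : R -> R) (s : R) : boxed_cont1 B g ->
  \int[mu]_(t in setT) g (t + s) = \int[mu]_(t in setT) g t.
Proof.
move=> bg.
have bgs : boxed_cont1 (B + `|s|) (fun t => g (t + s)).
  split=> [t|t Bt]; last first.
    rewrite bg.2//; have := ler_normD (t + s) (- s).
    by rewrite addrK normrN; lra.
  apply: (@continuous_comp _ _ _ (fun t => t + s) g); last exact: bg.1.
  by apply: continuousD; [exact: cvg_id|exact: cst_continuous].
set W := `|B| + 2 * `|s| + 1.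
have WB : B <= W by rewrite /W; have := ler_norm B; have := normr_ge0 s; lra.
have bW (C : R) (h : R -> R) (a b : R) : boxed_cont1 C h -> C <= b -> a <= - C ->
    \int[mu]_(t in setT) h t = \int[mu]_(t in `[a, b]) h t.
  move=> bh Cb aC; rewrite [RHS]Rintegral_mkcond; congr Rintegral.
  apply/funext => t; rewrite patchE; case: ifPn => //.
  rewrite notin_setE /= in_itv /= => /negP; rewrite negb_and -!ltNge => h'.
  apply: bh.2; case/orP: h' => h'.
    by rewrite -normrN; apply: lt_le_trans (ler_norm _); lra.
  by apply: lt_le_trans (ler_norm _); lra.
rewrite (bW _ _ (- W) W bg) //; last by lra.
rewrite (bW _ _ (- W - s) (W - s) bgs); last 2 first.
- by rewrite /W; have := ler_norm B; have := normr_ge0 s; have := ler_norm s; lra.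
- rewrite /W; have := ler_norm B; have := normr_ge0 s; have := ler_norm (- s).
  by rewrite normrN; lra.
rewrite /Rintegral; congr fine.
have d1 x : is_derive x (1 : R) (fun t : R => t + s) (1 + 0) by apply: is_deriveD.
have d1' : derive1 (fun t : R => t + s) = cst 1.
  by apply/funext => x; rewrite derive1E (@derive_val _ _ _ _ _ _ _ (d1 x)) addr0.
have := @integration_by_substitution_increasing R (fun t => t + s) g
  (- W - s) (W - s).
rewrite !subrK => -> //.
- by apply: eq_integral => t _; rewrite d1' /= mulr1.
- by rewrite /W; have := normr_ge0 B; have := normr_ge0 s; lra.
- by move=> x y _ _ xy; rewrite ltrD2r.
- by rewrite d1' => x _; exact: cst_continuous.
- by rewrite d1'; exact: is_cvg_cst.
- by rewrite d1'; exact: is_cvg_cst.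
- split.
  + by move=> x _; exact: (@ex_derive _ _ _ _ _ _ _ (d1 x)).
  + apply: cvg_at_right_filter.
    by apply: (@cvgD _ R^o); [exact: cvg_id|exact: cvg_cst].
  + apply: cvg_at_left_filter.
    by apply: (@cvgD _ R^o); [exact: cvg_id|exact: cvg_cst].
- by apply: continuous_subspaceT; exact: bg.1.
Qed.

End Line.

Section IterIntegral.
Context {R : realType}.
Notation mu := (@lebesgue_measure R).

Lemma iter_integralS n (f : 'rV[R]_n.+1 -> R) :
  iter_integral f =
  \int[mu]_(t in setT) iter_integral (fun y => f (cons_row t y)).
Proof. by []. Qed.

(** Linearity, the sup-norm bound and monotonicity are bundled because they
    have to be proved together, by induction on [n]: linearity and monotonicity
    in dimension [n.+1] need the inner integral to be integrable, which holds
    because it is continuous in the outermost variable, and this follows from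
    linearity and the bound in dimension [n]. *)
Definition iter_integral_linear n :=
  [/\ forall (B : R) (f g : 'rV[R]_n -> R), boxed_cont B f -> boxed_cont B g ->
       iter_integral (fun x => f x + g x) = iter_integral f + iter_integral g,
    forall (B c : R) (f : 'rV[R]_n -> R), boxed_cont B f ->
       iter_integral (fun x => c * f x) = c * iter_integral f,
    forall (B M : R) (f : 'rV[R]_n -> R), 0 <= B -> boxed_cont B f ->
       (forall x, `|f x| <= M) -> `|iter_integral f| <= M * (2 * B) ^+ n &
    forall (B : R) (f g : 'rV[R]_n -> R), boxed_cont B f -> boxed_cont B g ->
       (forall x, f x <= g x) -> iter_integral f <= iter_integral g].

(** By uniform continuity nearby slices are uniformly close, and the sup-norm
    bound turns this into continuity of the integral. *)
Lemma slice_boxed_cont1 n (B : R) (f : 'rV[R]_n.+1 -> R) :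
  iter_integral_linear n -> boxed_cont B f ->
  boxed_cont1 B (fun t => iter_integral (fun y => f (cons_row t y))).
Proof.
move=> [ID IZ IB _] bf; split=> [t|t Bt]; last first.
  have -> : (fun y => f (cons_row t y)) = (fun y => 0 * f (cons_row t y)).
    apply/funext => y; rewrite mul0r; apply: bf.2 => /cons_row_in_box[].
    by rewrite leNgt Bt.
  by rewrite (IZ B) ?mul0r//; exact: boxed_cont_slice.
apply/continuous_epsP => e e0.
(* The sup-norm bound requires a nonnegative half-width, hence [`|B|]; the 1
   makes [C] positive. *)
pose C := (2 * `|B|) ^+ n + 1.
have C0 : 0 < C by rewrite ltr_wpDl// exprn_ge0// mulr_ge0.
have eC : 0 < e / C by rewrite divr_gt0.
have [d d0 hd] := boxed_cont_unif bf eC.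
exists d => // t' tt'.
have bW : boxed_cont `|B| f by apply: boxed_contW bf; exact: ler_norm.
have bs u : boxed_cont `|B| (fun y => f (cons_row u y)).
  exact: boxed_cont_slice.
have <- : iter_integral
    (fun y => f (cons_row t y) + (-1) * f (cons_row t' y)) =
    iter_integral (fun y => f (cons_row t y)) -
    iter_integral (fun y => f (cons_row t' y)).
  rewrite (ID `|B|)//; last by apply: boxed_contZ.
  by rewrite (IZ `|B|)// mulN1r.
apply: le_lt_trans (IB `|B| (e / C) _ _ _ _) _ => //.
- by apply: boxed_contD => //; exact: boxed_contZ.
- move=> y; rewrite mulN1r; apply/ltW/hd; apply: cons_row_dist => //.
  by rewrite subrr normr0.
by rewrite -mulrAC ltr_pdivrMr// ltr_pM2l// ltrDl.
Qed.

Lemma iter_integral_linearP n : iter_integral_linear n.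
Proof.
elim: n => [|n Pn].
  by split=> //= B M f _ _ h; rewrite expr0 mulr1.
have slice B f bf := @slice_boxed_cont1 n B f Pn bf.
have [ID IZ IB IM] := Pn; split.
- move=> B f g bf bg; rewrite !iter_integralS.
  rewrite -RintegralD//; last 2 first.
  + exact: boxed_cont1_integrable (slice _ _ bf).
  + exact: boxed_cont1_integrable (slice _ _ bg).
  by congr Rintegral; apply/funext => t; rewrite (ID B)//; exact: boxed_cont_slice.
- move=> B c f bf; rewrite !iter_integralS -RintegralZl//; last first.
    exact: boxed_cont1_integrable (slice _ _ bf).
  by congr Rintegral; apply/funext => t; rewrite (IZ B)//; exact: boxed_cont_slice.
- move=> B M f B0 bf hM; rewrite iter_integralS exprSr mulrA.
  apply: boxed_cont1_bound => //; first exact: slice.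
  by move=> t; apply: IB => //; exact: boxed_cont_slice.
- move=> B f g bf bg fg; rewrite !iter_integralS.
  apply: le_Rintegral => //.
  + exact: boxed_cont1_integrable (slice _ _ bf).
  + exact: boxed_cont1_integrable (slice _ _ bg).
  by move=> t _; apply: (IM B) => //; exact: boxed_cont_slice.
Qed.

Lemma iter_integralD n (B : R) (f g : 'rV[R]_n -> R) :
  boxed_cont B f -> boxed_cont B g ->
  iter_integral (fun x => f x + g x) = iter_integral f + iter_integral g.
Proof. by have [h _ _ _] := iter_integral_linearP n; exact: h. Qed.

Lemma iter_integralZ n (B c : R) (f : 'rV[R]_n -> R) : boxed_cont B f ->
  iter_integral (fun x => c * f x) = c * iter_integral f.
Proof. by have [_ h _ _] := iter_integral_linearP n; exact: h. Qed.

Lemma iter_integral_bound n (B M : R) (f : 'rV[R]_n -> R) :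
  0 <= B -> boxed_cont B f -> (forall x, `|f x| <= M) ->
  `|iter_integral f| <= M * (2 * B) ^+ n.
Proof. by have [_ _ h _] := iter_integral_linearP n; exact: h. Qed.

Lemma le_iter_integral n (B : R) (f g : 'rV[R]_n -> R) :
  boxed_cont B f -> boxed_cont B g -> (forall x, f x <= g x) ->
  iter_integral f <= iter_integral g.
Proof. by have [_ _ _ h] := iter_integral_linearP n; exact: h. Qed.

Lemma iter_integral0 n : iter_integral (fun _ : 'rV[R]_n => 0 : R) = 0.
Proof.
have b0 : boxed_cont 0 (fun _ : 'rV[R]_n => 0 : R).
  by split=> // x; exact: cst_continuous.
rewrite -[RHS](mul0r (iter_integral (fun _ : 'rV[R]_n => 0 : R))).
by rewrite -(iter_integralZ _ b0) mul0r.
Qed.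

Lemma boxed_cont_translate n (B : R) (f : 'rV[R]_n -> R) (v : 'rV[R]_n) :
  boxed_cont B f -> boxed_cont (B + `|v|) (fun x => f (x + v)).
Proof.
move=> [cf hf]; split=> [x|x nx].
  have cs : {for x, continuous (fun x : 'rV[R]_n => x + v)}.
    by apply: (@continuousD R); [exact: cvg_id|exact: cst_continuous].
  exact: (continuous_comp cs (cf _)).
apply: hf => h; apply: nx => i.
have -> : x ord0 i = (x + v) ord0 i - v ord0 i by rewrite mxE addrK.
apply: le_trans (ler_normB _ _) _; apply: lerD; first exact: h.
exact: row_entry_le_norm.
Qed.

Lemma iter_integral_translate n (B : R) (f : 'rV[R]_n -> R) (v : 'rV[R]_n) :
  boxed_cont B f -> iter_integral (fun x => f (x + v)) = iter_integral f.
Proof.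
elim: n f v => [|n IH] f v bf; first by rewrite /=; congr f; apply/rowP => -[].
rewrite !iter_integralS.
pose w : 'rV[R]_n := \row_i v ord0 (lift ord0 i).
have -> : (fun t => iter_integral (fun y => f (cons_row t y + v))) =
    (fun t => (fun u => iter_integral (fun y => f (cons_row u y))) (t + v ord0 ord0)).
  apply/funext => t /=.
  rewrite -(IH (fun y => f (cons_row (t + v ord0 ord0) y)) w); last first.
    exact: boxed_cont_slice.
  congr iter_integral; apply/funext => y; congr f; apply/rowP => i.
  rewrite mxE; case: (unliftP ord0 i) => [j ->|->].
    by rewrite !cons_rowS !mxE.
  by rewrite !cons_row0.
exact: boxed_cont1_shift (slice_boxed_cont1 (@iter_integral_linearP n) bf).
Qed.

Lemma boxed_cont_prod n (B : R) (a : 'I_n -> R -> R) :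
  (forall i, boxed_cont1 B (a i)) ->
  boxed_cont B (fun x : 'rV[R]_n => \prod_i a i (x ord0 i)).
Proof.
move=> ba; split=> [x|x /existsNP[i /negP]]; last first.
  by rewrite -ltNge => h; rewrite (bigD1 i)//= (ba i).2// mul0r.
have ci i : {for x, continuous (fun x : 'rV[R]_n => a i (x ord0 i))}.
  exact: (continuous_comp (@coord_continuous _ _ _ _ _ x) ((ba i).1 _)).
elim: (index_enum _) => [|j r IH].
  by under eq_fun do rewrite big_nil; exact: cst_continuous.
under eq_fun do rewrite big_cons.
exact: (continuousM (ci j) IH).
Qed.

Lemma iter_integral_prod n (B : R) (a : 'I_n -> R -> R) :
  (forall i, boxed_cont1 B (a i)) ->
  iter_integral (fun x : 'rV[R]_n => \prod_i a i (x ord0 i)) =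
  \prod_i \int[mu]_(t in setT) a i t.
Proof.
elim: n a => [|n IH] a ba; first by rewrite /= !big_ord0.
rewrite iter_integralS big_ord_recl -IH//.
have ba' : boxed_cont B (fun x : 'rV[R]_n => \prod_i a (lift ord0 i) (x ord0 i)).
  exact: (@boxed_cont_prod n B (fun i => a (lift ord0 i)) (fun i => ba _)).
rewrite -RintegralZr//; last exact: boxed_cont1_integrable (ba ord0).
congr Rintegral; apply/funext => t; rewrite -(iter_integralZ _ ba').
congr iter_integral; apply/funext => y.
rewrite big_ord_recl cons_row0; congr (_ * _).
by apply: eq_bigr => i _; rewrite cons_rowS.
Qed.

End IterIntegral.

(** * Complex numbers and the Fourier transform *)

Section Cplx.
Local Open Scope complex_scope.
Context {R : realType}.
Implicit Types (z w : R[i]).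

Lemma normc_ge0 z : 0 <= normc z.
Proof. by case: z => a b /=; exact: sqrtr_ge0. Qed.

Lemma normc_le_ReIm z : normc z <= `|complex.Re z| + `|complex.Im z|.
Proof.
case: z => a b /=.
rewrite -[leRHS]ger0_norm ?addr_ge0// -sqrtr_sqr ler_wsqrtr//.
rewrite sqrrD !real_normK ?num_real// -addrA lerD2l lerDr.
by rewrite mulrn_wge0// mulr_ge0.
Qed.

Lemma Re_le_normc z : `|complex.Re z| <= normc z.
Proof.
by case: z => a b /=; rewrite -sqrtr_sqr ler_wsqrtr// lerDl sqr_ge0.
Qed.

Lemma Im_le_normc z : `|complex.Im z| <= normc z.
Proof.
by case: z => a b /=; rewrite -sqrtr_sqr ler_wsqrtr// lerDr sqr_ge0.
Qed.

Lemma normc_eq0 z : (normc z == 0) = (z == 0).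
Proof.
by apply/eqP/eqP => [/eq0_normc//|->]; rewrite normc0.
Qed.

Lemma normcZ (r : R) : normc r%:C = `|r|.
Proof. by rewrite /= expr0n addr0 sqrtr_sqr. Qed.

Lemma normc_i : normc ('i : R[i]) = 1.
Proof. by rewrite /= expr0n expr1n add0r sqrtr1. Qed.

Lemma normc_sum (I : Type) (r : seq I) (P : pred I) (F : I -> R[i]) :
  normc (\sum_(i <- r | P i) F i) <= \sum_(i <- r | P i) normc (F i).
Proof.
elim/big_ind2: _ => [|x1 x2 y1 y2 h1 h2|//]; first by rewrite normc0.
exact: le_trans (le_normcD _ _) (lerD h1 h2).
Qed.

Lemma normc_prod (I : Type) (r : seq I) (P : pred I) (F : I -> R[i]) :
  normc (\prod_(i <- r | P i) F i) = \prod_(i <- r | P i) normc (F i).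
Proof.
elim/big_ind2: _ => [|x1 x2 y1 y2 <- <-|//]; first by rewrite normc1.
by rewrite normcM.
Qed.

Lemma normc_distC z w : normc (z - w) = normc (w - z).
Proof. by rewrite -normcN opprB. Qed.

Lemma normcX z k : normc (z ^+ k) = normc z ^+ k.
Proof. by elim: k => [|k IH]; rewrite ?expr0 ?normc1// !exprS normcM IH. Qed.

Lemma ReD z w : complex.Re (z + w) = complex.Re z + complex.Re w.
Proof. by case: z w => ? ? []. Qed.

Lemma ImD z w : complex.Im (z + w) = complex.Im z + complex.Im w.
Proof. by case: z w => ? ? []. Qed.

Lemma ReN z : complex.Re (- z) = - complex.Re z.
Proof. by case: z. Qed.

Lemma ImN z : complex.Im (- z) = - complex.Im z.
Proof. by case: z. Qed.

Lemma ReM z w :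
  complex.Re (z * w) = complex.Re z * complex.Re w - complex.Im z * complex.Im w.
Proof. by case: z w => ? ? []. Qed.

Lemma ImM z w :
  complex.Im (z * w) = complex.Re z * complex.Im w + complex.Im z * complex.Re w.
Proof. by case: z w => ? ? []. Qed.

Lemma complex_ext z w :
  complex.Re z = complex.Re w -> complex.Im z = complex.Im w -> z = w.
Proof. by case: z w => ? ? [? ?] /= -> ->. Qed.

Lemma Re_sum (I : Type) (r : seq I) (F : I -> R[i]) :
  complex.Re (\sum_(i <- r) F i) = \sum_(i <- r) complex.Re (F i).
Proof. by elim/big_rec2: _ => // i x y _ <-; rewrite ReD. Qed.

Lemma Im_sum (I : Type) (r : seq I) (F : I -> R[i]) :
  complex.Im (\sum_(i <- r) F i) = \sum_(i <- r) complex.Im (F i).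
Proof. by elim/big_rec2: _ => // i x y _ <-; rewrite ImD. Qed.

Definition expi (t : R) : R[i] := cos t +i* sin t.

Lemma expiD s t : expi (s + t) = expi s * expi t.
Proof.
rewrite /expi cosD sinD; apply: complex_ext => //=.
by rewrite addrC.
Qed.

Lemma expi0 : expi 0 = 1.
Proof. by rewrite /expi cos0 sin0. Qed.

Lemma normc_expi t : normc (expi t) = 1.
Proof. by rewrite /= cos2Dsin2 sqrtr1. Qed.

Lemma expi_muln t k : expi (k%:R * t) = expi t ^+ k.
Proof.
elim: k => [|k IH]; first by rewrite mul0r expi0 expr0.
by rewrite -natr1 mulrDl mul1r expiD IH exprSr.
Qed.

Lemma expiN t : expi (- t) = (expi t)^*%C.
Proof. by rewrite /expi cosN sinN. Qed.

Let mvt (f df : R -> R) (x : R) : (forall t, is_derive t (1 : R) f (df t)) ->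
  exists2 c, `|c| <= `|x| & f x - f 0 = df c * x.
Proof.
move=> fd.
have cf : continuous f.
  move=> t; apply/differentiable_continuous/derivable1_diffP.
  exact: (@ex_derive _ _ _ _ _ _ _ (fd t)).
have [x0|x0|->] := ltgtP x 0; last by exists 0; rewrite // subrr mulr0.
- have [c] := @MVT_segment R f df x 0 (ltW x0) (fun t _ => fd t)
    (continuous_subspaceT cf).
  rewrite in_itv /= => /andP[xc c0] h; exists c.
    by rewrite !ler0_norm ?lerN2// ltW.
  by rewrite -opprB h sub0r mulrN opprK.
- have [c] := @MVT_segment R f df 0 x (ltW x0) (fun t _ => fd t)
    (continuous_subspaceT cf).
  rewrite in_itv /= => /andP[xc c0] h; exists c.
    by rewrite !ger0_norm// ltW.
  by rewrite h subr0.
Qed.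

Lemma sin_le_norm (t : R) : `|sin t| <= `|t|.
Proof.
have [c _] := @mvt sin cos t (fun t => is_derive_sin t).
by rewrite sin0 subr0 => ->; rewrite normrM ler_piMl// cos_max.
Qed.

Lemma oneBcos_le (t : R) : `|cos t - 1| <= t ^+ 2.
Proof.
have [c ct] := @mvt cos (fun t => - sin t) t (fun t => is_derive_cos t).
rewrite cos0 => ->; rewrite normrM normrN -[t ^+ 2]real_normK ?num_real// expr2.
by rewrite ler_wpM2r// (le_trans (sin_le_norm _)).
Qed.

Lemma oneBcos_le1 (t : R) : `|cos t - 1| <= `|t|.
Proof.
have [c ct] := @mvt cos (fun t => - sin t) t (fun t => is_derive_cos t).
by rewrite cos0 => ->; rewrite normrM normrN ler_piMl// sin_max.
Qed.

Lemma sinB_le (t : R) : `|sin t - t| <= t ^+ 2.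
Proof.
have [c ct] := @mvt (fun t => sin t - t) (fun t => cos t - 1) t
  (fun t => is_deriveB (is_derive_sin t) (is_derive_id t 1)).
rewrite sin0 !subr0 => ->; rewrite normrM -[t ^+ 2]real_normK ?num_real// expr2.
by rewrite ler_wpM2r// (le_trans (oneBcos_le1 _)).
Qed.

Lemma expi_taylor (t : R) : normc (expi t - 1 - 'i * t%:C) <= 2 * t ^+ 2.
Proof.
apply: le_trans (normc_le_ReIm _) _.
rewrite !(ReD, ImD, ReN, ImN, ReM, ImM) /= !(mul0r, mulr0, mul1r, subr0, oppr0, addr0, add0r).
by rewrite mulr2n mulrDl mul1r lerD// ?oneBcos_le// sinB_le.
Qed.

Lemma expi_lip (s t : R) : normc (expi s - expi t) <= 2 * `|s - t|.
Proof.
have -> : expi s - expi t = expi t * (expi (s - t) - 1).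
  by rewrite mulrBr -expiD [t + _]addrC subrK mulr1.
rewrite normcM normc_expi mul1r; apply: le_trans (normc_le_ReIm _) _.
rewrite !(ReD, ImD, ReN, ImN) /= oppr0 addr0 mulr2n mulrDl mul1r.
by rewrite lerD// ?oneBcos_le1// sin_le_norm.
Qed.

End Cplx.

Section ComplexIntegral.
Local Open Scope complex_scope.
Context {R : realType}.

Lemma dotpDr n (x y z : 'rV[R]_n) : dotp x (y + z) = dotp x y + dotp x z.
Proof. by rewrite /dotp -big_split; apply: eq_bigr => i _; rewrite mxE mulrDr. Qed.

Lemma dotpC n (x y : 'rV[R]_n) : dotp x y = dotp y x.
Proof. by apply: eq_bigr => i _; rewrite mulrC. Qed.

Lemma dotpDl n (x y z : 'rV[R]_n) : dotp (x + y) z = dotp x z + dotp y z.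
Proof. by rewrite dotpC dotpDr !(dotpC z). Qed.

Lemma dotpZl n a (x y : 'rV[R]_n) : dotp (a *: x) y = a * dotp x y.
Proof. by rewrite /dotp mulr_sumr; apply: eq_bigr => i _; rewrite mxE mulrA. Qed.

Lemma dotpZr n a (x y : 'rV[R]_n) : dotp x (a *: y) = a * dotp x y.
Proof. by rewrite dotpC dotpZl dotpC. Qed.

Lemma dotpNl n (x y : 'rV[R]_n) : dotp (- x) y = - dotp x y.
Proof. by rewrite -scaleN1r dotpZl mulN1r. Qed.

Lemma dotpNr n (x y : 'rV[R]_n) : dotp x (- y) = - dotp x y.
Proof. by rewrite dotpC dotpNl dotpC. Qed.

Lemma dotp_delta n (xi : 'rV[R]_n) i : dotp (delta_mx ord0 i) xi = xi ord0 i.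
Proof.
rewrite /dotp (bigD1 i)//= mxE !eqxx mul1r big1 ?addr0// => j ji.
by rewrite mxE eqxx (negbTE ji) mul0r.
Qed.

Lemma continuous_sum_seq (V : normedModType R) (I : Type) (r : seq I)
    (F : I -> V -> R) : (forall i, continuous (F i)) ->
  continuous (fun x => \sum_(i <- r) F i x).
Proof.
move=> cF x; elim: r => [|i r IH].
  by under eq_fun do rewrite big_nil; exact: cst_continuous.
under eq_fun do rewrite big_cons.
exact: (continuousD (cF i x) IH).
Qed.

Lemma continuous_dotp n (y : 'rV[R]_n) : continuous (fun x => dotp x y).
Proof.
apply: continuous_sum_seq => i x.
apply: continuousM; last exact: cst_continuous.
exact: coord_continuous.
Qed.

Definition ccont n (u : cfun R n) :=
  continuous (fun x => complex.Re (u x)) /\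
  continuous (fun x => complex.Im (u x)).

Lemma ccontM n (u v : cfun R n) : ccont u -> ccont v -> ccont (fun x => u x * v x).
Proof.
move=> [ru iu] [rv iv]; split=> x.
  under eq_fun do rewrite ReM.
  exact: (continuousB (continuousM (ru x) (rv x)) (continuousM (iu x) (iv x))).
under eq_fun do rewrite ImM.
exact: (continuousD (continuousM (ru x) (iv x)) (continuousM (iu x) (rv x))).
Qed.

Lemma ccontD n (u v : cfun R n) : ccont u -> ccont v -> ccont (fun x => u x + v x).
Proof.
move=> [ru iu] [rv iv]; split=> x.
  by under eq_fun do rewrite ReD; exact: (continuousD (ru x) (rv x)).
by under eq_fun do rewrite ImD; exact: (continuousD (iu x) (iv x)).
Qed.

Lemma ccont_cst n (c : R[i]) : ccont (fun _ : 'rV[R]_n => c).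
Proof. by split=> x; exact: cst_continuous. Qed.

Lemma ccont_sum n (I : Type) (r : seq I) (F : I -> cfun R n) :
  (forall i, ccont (F i)) -> ccont (fun x => \sum_(i <- r) F i x).
Proof.
move=> h; elim: r => [|i r IH].
  by under eq_fun do rewrite big_nil; exact: ccont_cst.
by under eq_fun do rewrite big_cons; exact: ccontD.
Qed.

Lemma ccont_expi n (f : 'rV[R]_n -> R) : continuous f -> ccont (fun x => expi (f x)).
Proof.
move=> cf; split=> x.
  exact: (@continuous_comp _ _ _ f (@cos R) x (cf x) (@continuous_cos R _)).
exact: (@continuous_comp _ _ _ f (@sin R) x (cf x) (@continuous_sin R _)).
Qed.

Definition boxed n (B : R) (u : cfun R n) := forall x, ~ in_box B x -> u x = 0.

Definition cboxed n (B : R) (u : cfun R n) := ccont u /\ boxed B u.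

Lemma cboxed_Re n B (u : cfun R n) : cboxed B u ->
  boxed_cont B (fun x => complex.Re (u x)).
Proof. by move=> [[ru iu] hu]; split=> // x /hu ->. Qed.

Lemma cboxed_Im n B (u : cfun R n) : cboxed B u ->
  boxed_cont B (fun x => complex.Im (u x)).
Proof. by move=> [[ru iu] hu]; split=> // x /hu ->. Qed.

Lemma cboxedW n B B' (u : cfun R n) : B <= B' -> cboxed B u -> cboxed B' u.
Proof.
move=> BB' [cu hu]; split=> // x nx; apply: hu => h; apply: nx.
exact: in_boxW h.
Qed.

Lemma cboxedD n B (u v : cfun R n) : cboxed B u -> cboxed B v ->
  cboxed B (fun x => u x + v x).
Proof.
move=> [cu hu] [cv hv]; split; first exact: ccontD.
by move=> x nx; rewrite hu// hv// addr0.
Qed.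

Lemma cboxedMr n B (u v : cfun R n) : cboxed B u -> ccont v ->
  cboxed B (fun x => u x * v x).
Proof.
move=> [cu hu] cv; split; first exact: ccontM.
by move=> x nx; rewrite hu// mul0r.
Qed.

Lemma cboxedZ n B c (u : cfun R n) : cboxed B u -> cboxed B (fun x => c * u x).
Proof.
move=> hu; under eq_fun do rewrite mulrC.
by apply: cboxedMr => //; exact: ccont_cst.
Qed.

Lemma cboxed_sum n B (I : Type) (r : seq I) (F : I -> cfun R n) :
  (forall i, cboxed B (F i)) -> cboxed B (fun x => \sum_(i <- r) F i x).
Proof.
move=> h; split; first by apply: ccont_sum => i; exact: (h i).1.
by move=> x nx; rewrite big1// => i _; exact: (h i).2.
Qed.

Lemma cboxed_bounded n B (u : cfun R n) : cboxed B u ->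
  exists2 M, 0 <= M & forall x, normc (u x) <= M.
Proof.
move=> bu.
have [M1 M10 h1] := boxed_cont_bounded (cboxed_Re bu).
have [M2 M20 h2] := boxed_cont_bounded (cboxed_Im bu).
exists (M1 + M2); first exact: addr_ge0.
by move=> x; apply: le_trans (normc_le_ReIm _) (lerD _ _).
Qed.

Definition cint n (u : cfun R n) : R[i] :=
  iter_integral (fun x => complex.Re (u x)) +i*
  iter_integral (fun x => complex.Im (u x)).

Lemma cintD n B (u v : cfun R n) : cboxed B u -> cboxed B v ->
  cint (fun x => u x + v x) = cint u + cint v.
Proof.
move=> bu bv; rewrite /cint.
under eq_fun do rewrite ReD.
under [X in _ +i* iter_integral X]eq_fun do rewrite ImD.
rewrite (iter_integralD (cboxed_Re bu) (cboxed_Re bv)).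
by rewrite (iter_integralD (cboxed_Im bu) (cboxed_Im bv)).
Qed.

Lemma cintZ n B (c : R[i]) (u : cfun R n) : cboxed B u ->
  cint (fun x => c * u x) = c * cint u.
Proof.
move=> bu; have br := cboxed_Re bu; have bi := cboxed_Im bu.
apply: complex_ext; rewrite /= ?ReM ?ImM /=.
  under eq_fun do rewrite ReM -mulNr.
  rewrite (@iter_integralD _ _ B); [|exact: boxed_contZ|exact: boxed_contZ].
  by rewrite !(@iter_integralZ _ _ B)// mulNr.
under eq_fun do rewrite ImM.
rewrite (@iter_integralD _ _ B); [|exact: boxed_contZ|exact: boxed_contZ].
by rewrite !(@iter_integralZ _ _ B).
Qed.

Lemma cint_sum n B (I : Type) (r : seq I) (F : I -> cfun R n) :
  (forall i, cboxed B (F i)) ->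
  cint (fun x => \sum_(i <- r) F i x) = \sum_(i <- r) cint (F i).
Proof.
move=> h; elim: r => [|i r IH].
  under eq_fun do rewrite big_nil.
  by rewrite big_nil /cint /= iter_integral0.
under eq_fun do rewrite big_cons.
by rewrite big_cons (cintD (h i) (cboxed_sum _ h)) IH.
Qed.

Lemma cint_bound n (B M : R) (u : cfun R n) : 0 <= B -> cboxed B u ->
  (forall x, normc (u x) <= M) -> normc (cint u) <= M * (2 * (2 * B) ^+ n).
Proof.
move=> B0 bu uM; apply: le_trans (normc_le_ReIm _) _ => /=.
rewrite mulrCA mulr2n mulrDl mul1r; apply: lerD.
  apply: iter_integral_bound => //; first exact: cboxed_Re.
  by move=> x; exact: le_trans (Re_le_normc _) (uM x).
apply: iter_integral_bound => //; first exact: cboxed_Im.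
by move=> x; exact: le_trans (Im_le_normc _) (uM x).
Qed.

Lemma cint_translate n B (u : cfun R n) v : cboxed B u ->
  cint (fun x => u (x + v)) = cint u.
Proof.
move=> bu; rewrite /cint (iter_integral_translate v (cboxed_Re bu)).
by rewrite (iter_integral_translate v (cboxed_Im bu)).
Qed.

Lemma fourierE n (u : cfun R n) (xi : 'rV[R]_n) :
  fourier u xi = cint (fun x => u x * expi (- dotp x xi)).
Proof.
rewrite /fourier /cint; under eq_fun do rewrite -sinN -cosN.
by under [X in _ +i* iter_integral X]eq_fun do rewrite -sinN -cosN.
Qed.

Lemma ccont_kernel n (xi : 'rV[R]_n) : ccont (fun x => expi (- dotp x xi)).
Proof.
under eq_fun do rewrite -dotpNr.
by apply: ccont_expi; exact: continuous_dotp.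
Qed.

Lemma cboxed_kernel n B (u : cfun R n) (xi : 'rV[R]_n) : cboxed B u ->
  cboxed B (fun x => u x * expi (- dotp x xi)).
Proof. by move=> bu; apply: cboxedMr => //; exact: ccont_kernel. Qed.

Lemma fourier_bound n (B M : R) (u : cfun R n) xi : 0 <= B -> cboxed B u ->
  (forall x, normc (u x) <= M) ->
  normc (fourier u xi) <= M * (2 * (2 * B) ^+ n).
Proof.
move=> B0 bu uM; rewrite fourierE; apply: cint_bound => //.
  exact: cboxed_kernel.
by move=> x; rewrite normcM normc_expi mulr1.
Qed.

Lemma line_derive n (f : 'rV[R]_n -> R) (x v : 'rV[R]_n) (t : R) :
  derivable f (x + t *: v) v ->
  is_derive t (1 : R) (fun s : R => f (x + s *: v)) ('D_v f (x + t *: v)).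
Proof.
move=> df.
have e : (fun h : R => h^-1 *: (f (h *: v + (x + t *: v)) - f (x + t *: v))) =
  (fun h : R => h^-1 *: ((fun s : R => f (x + s *: v)) (h *: (1 : R) + t) -
     (fun s : R => f (x + s *: v)) t)).
  apply/funext => h /=; congr (_ *: (f _ - _)).
  by rewrite [h *: 1]mulr1 scalerDl addrCA.
by split; [rewrite /derivable -e | rewrite /derive -e].
Qed.

Lemma mvt_line n (f : 'rV[R]_n -> R) (v x : 'rV[R]_n) (h : R) : 0 < h ->
  (forall y, derivable f y v) ->
  exists2 t, 0 <= t <= h & f (x + h *: v) - f x = h * 'D_v f (x + t *: v).
Proof.
move=> h0 df.
have fd t : is_derive t (1 : R) (fun s : R => f (x + s *: v)) ('D_v f (x + t *: v)).
  exact: line_derive.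
have cf : continuous (fun s : R => f (x + s *: v)).
  move=> t; apply/differentiable_continuous/derivable1_diffP.
  exact: (@ex_derive _ _ _ _ _ _ _ (fd t)).
have [t] := @MVT_segment R (fun s : R => f (x + s *: v)) _ 0 h (ltW h0)
  (fun t _ => fd t) (continuous_subspaceT cf).
rewrite in_itv /= scale0r addr0 subr0 => th ->.
by exists t => //; rewrite mulrC.
Qed.

Lemma not_in_box_nbhs n B (x : 'rV[R]_n) :
  ~ in_box B x -> \forall y \near x, ~ in_box B y.
Proof.
move=> /existsNP[i /negP]; rewrite -ltNge => Bi.
apply/nbhs_ballP; exists (`|x ord0 i| - B) => /=; first by rewrite subr_gt0.
move=> y; rewrite -ball_normE /= => xy hy.
have h1 : `|x ord0 i - y ord0 i| <= `|x - y|.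
  by apply: le_trans (row_entry_le_norm _ i); rewrite !mxE.
have := hy i.
have := ler_normD (x ord0 i - y ord0 i) (y ord0 i); rewrite subrK; lra.
Qed.

(** The integral is invariant under translations, so it vanishes on difference
    quotients, which tend uniformly to the derivative. *)
Lemma iter_integral_derive n B (f : 'rV[R]_n -> R) (i : 'I_n) : 0 <= B ->
  boxed_cont B f -> (forall x, derivable f x (delta_mx ord0 i)) ->
  continuous (fun x => 'D_(delta_mx ord0 i) f x) ->
  iter_integral (fun x => 'D_(delta_mx ord0 i) f x) = 0.
Proof.
move=> B0 bf df cD; set v : 'rV[R]_n := delta_mx ord0 i.
have v1 : `|v| <= 1.
  apply: row_norm_le => // j; rewrite mxE eqxx /=.
  by case: (j == i); rewrite ?normr1 ?normr0.
have bD : boxed_cont B (fun x => 'D_v f x).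
  split=> // x /not_in_box_nbhs nx.
  rewrite -[RHS](@derive_cst R _ _ (0 : R) x v); apply: near_eq_derive.
  by apply: filterS nx => y /bf.2.
apply/eqP; rewrite -normr_eq0 eq_le normr_ge0 andbT.
apply/ler_addgt0Pl => e e0; rewrite addr0.
pose C := (2 * (B + 1)) ^+ n.
have C0 : 0 < C by rewrite exprn_gt0// mulr_gt0// ltr_wpDl.
have eC : 0 < e / C by rewrite divr_gt0.
have [d d0 hd] := boxed_cont_unif bD eC.
(* The step is at most 1, so that all the supports lie in the box of size
   [B + 1]. *)
pose h := Num.min (d / 2) 1.
have h0 : 0 < h by rewrite lt_min divr_gt0//=.
have h1 : h <= 1 by rewrite ge_min lexx orbT.
have hd2 : h < d.
  by rewrite gt_min ltr_pdivrMr// ltr_pMr// ltr1n.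
have BB : B <= B + 1 by rewrite lerDl.
have bD1 := boxed_contW BB bD.
have bf1 := boxed_contW BB bf.
have hv : `|h *: v| <= 1.
  by rewrite normrZ (ger0_norm (ltW h0)) mulr_ile1// ltW.
have bt : boxed_cont (B + 1) (fun x => f (x + h *: v)).
  by apply: boxed_contW (boxed_cont_translate (h *: v) bf); rewrite lerD2l.
pose q x := h^-1 * (f (x + h *: v) + (-1) * f x).
have bq : boxed_cont (B + 1) q.
  by apply: boxed_contZ; apply: boxed_contD => //; exact: boxed_contZ.
have Iq : iter_integral q = 0.
  rewrite (@iter_integralZ _ _ (B + 1)); last first.
    by apply: boxed_contD => //; exact: boxed_contZ.
  rewrite (@iter_integralD _ _ (B + 1))//; last exact: boxed_contZ.
  rewrite (@iter_integralZ _ _ (B + 1))// (iter_integral_translate _ bf1).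
  by rewrite mulN1r subrr mulr0.
have -> : iter_integral (fun x => 'D_v f x) =
    iter_integral (fun x => 'D_v f x + (-1) * q x).
  rewrite (@iter_integralD _ _ (B + 1))//; last exact: boxed_contZ.
  by rewrite (@iter_integralZ _ _ (B + 1))// Iq mulr0 addr0.
have -> : e = (e / C) * C by rewrite divfK// gt_eqF.
apply: iter_integral_bound => //; first by rewrite addr_ge0.
  by apply: boxed_contD => //; exact: boxed_contZ.
move=> x; rewrite mulN1r /q mulN1r.
have [t /andP[t0 th] ->] := mvt_line x h0 df.
rewrite mulrA mulVf ?gt_eqF// mul1r ltW//.
apply: hd; rewrite opprD addNKr normrN normrZ ger0_norm//.
apply: le_lt_trans hd2; apply: le_trans th.
by rewrite ler_piMr.
Qed.

End ComplexIntegral.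

(** * Smooth functions *)

Section Smooth.
Local Open Scope complex_scope.
Context {R : realType} {n : nat}.
Implicit Types (u v : cfun R n) (x : 'rV[R]_n) (U : set 'rV[R]_n).

Notation basis i := (delta_mx ord0 i : 'rV[R]_n).

Definition iter_pderiv (s : seq 'I_n) u : cfun R n := foldr (@pderiv R n) u s.

Definition smooth_on U u := forall s x, U x -> partials_at (iter_pderiv s u) x.

Definition is_pderiv u x i (z : R[i]) :=
  is_derive x (basis i) (fun y => complex.Re (u y)) (complex.Re z) /\
  is_derive x (basis i) (fun y => complex.Im (u y)) (complex.Im z).

Lemma is_pderiv_val u x i z : is_pderiv u x i z -> pderiv i u x = z.
Proof.
move=> [h1 h2]; apply: complex_ext => /=.
  exact: (@derive_val _ _ _ _ _ _ _ h1).
exact: (@derive_val _ _ _ _ _ _ _ h2).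
Qed.

Lemma partials_is_pderiv u x i : partials_at u x -> is_pderiv u x i (pderiv i u x).
Proof. by move=> [_ _ /(_ i)[h1 h2]]; split; exact: derivableP. Qed.

Lemma is_pderivD u v x i z w : is_pderiv u x i z -> is_pderiv v x i w ->
  is_pderiv (fun y => u y + v y) x i (z + w).
Proof.
move=> [ru iu] [rv iv]; split.
  by under eq_fun do rewrite ReD; rewrite ReD; exact: (is_deriveD ru rv).
by under eq_fun do rewrite ImD; rewrite ImD; exact: (is_deriveD iu iv).
Qed.

Lemma is_pderivM u v x i z w : is_pderiv u x i z -> is_pderiv v x i w ->
  is_pderiv (fun y => u y * v y) x i (z * v x + u x * w).
Proof.
move=> [ru iu] [rv iv]; split.
  under eq_fun do rewrite ReM.
  apply: (is_derive_eq (is_deriveB (is_deriveM ru rv) (is_deriveM iu iv))).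
  by rewrite ReD !ReM /GRing.scale /=; ring.
under eq_fun do rewrite ImM.
apply: (is_derive_eq (is_deriveD (is_deriveM ru iv) (is_deriveM iu rv))).
by rewrite ImD !ImM /GRing.scale /=; ring.
Qed.

Lemma is_pderiv_cst c x i : is_pderiv (fun=> c) x i 0.
Proof. by split; exact: is_derive_cst. Qed.

Lemma partials_of u x (d : 'I_n -> R[i]) :
  {for x, continuous (fun y => complex.Re (u y))} ->
  {for x, continuous (fun y => complex.Im (u y))} ->
  (forall i, is_pderiv u x i (d i)) -> partials_at u x.
Proof.
move=> c1 c2 h; split=> // i; have [h1 h2] := h i.
by split; [exact: (@ex_derive _ _ _ _ _ _ _ h1)|exact: (@ex_derive _ _ _ _ _ _ _ h2)].
Qed.

Lemma partialsD u v x : partials_at u x -> partials_at v x ->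
  partials_at (fun y => u y + v y) x.
Proof.
move=> pu pv; have [ru iu _] := pu; have [rv iv _] := pv.
apply: (@partials_of _ _ (fun i => pderiv i u x + pderiv i v x)).
- rewrite (_ : (fun y => _) = (fun y => complex.Re (u y) + complex.Re (v y))).
    exact: (continuousD ru rv).
  by apply/funext => y; rewrite ReD.
- rewrite (_ : (fun y => _) = (fun y => complex.Im (u y) + complex.Im (v y))).
    exact: (continuousD iu iv).
  by apply/funext => y; rewrite ImD.
- by move=> i; apply: is_pderivD; exact: partials_is_pderiv.
Qed.

Lemma partialsM u v x : partials_at u x -> partials_at v x ->
  partials_at (fun y => u y * v y) x.
Proof.
move=> pu pv; have [ru iu _] := pu; have [rv iv _] := pv.
apply: (@partials_of _ _ (fun i => pderiv i u x * v x + u x * pderiv i v x)).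
- rewrite (_ : (fun y => _) = (fun y => complex.Re (u y) * complex.Re (v y) -
                                        complex.Im (u y) * complex.Im (v y))).
    exact: (continuousB (continuousM ru rv) (continuousM iu iv)).
  by apply/funext => y; rewrite ReM.
- rewrite (_ : (fun y => _) = (fun y => complex.Re (u y) * complex.Im (v y) +
                                        complex.Im (u y) * complex.Re (v y))).
    exact: (continuousD (continuousM ru iv) (continuousM iu rv)).
  by apply/funext => y; rewrite ImM.
- by move=> i; apply: is_pderivM; exact: partials_is_pderiv.
Qed.

Lemma partials_cst c x : partials_at (fun=> c) x.
Proof.
apply: (@partials_of _ _ (fun=> 0)) => [||i]; last exact: is_pderiv_cst.
  exact: cst_continuous.
exact: cst_continuous.
Qed.

Lemma partials_sum (I : Type) (r : seq I) (F : I -> cfun R n) x :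
  (forall i, partials_at (F i) x) ->
  partials_at (fun y => \sum_(i <- r) F i y) x.
Proof.
move=> h; elim: r => [|i r IH].
  rewrite (_ : (fun y => _) = (fun=> 0)); first exact: partials_cst.
  by apply/funext => y; rewrite big_nil.
rewrite (_ : (fun y => _) = (fun y => F i y + \sum_(j <- r) F j y)).
  exact: partialsD.
by apply/funext => y; rewrite big_cons.
Qed.

Lemma near_continuous (f g : 'rV[R]_n -> R) x : {near x, f =1 g} ->
  {for x, continuous f} -> {for x, continuous g}.
Proof.
move=> fg cf; have fgx : f x = g x := nbhs_singleton fg.
suff : g @ x --> f x by rewrite fgx.
by apply: cvg_trans cf; exact: near_eq_cvg fg.
Qed.

Lemma near_partials u v x : {near x, u =1 v} -> partials_at u x -> partials_at v x.
Proof.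
move=> uv [cr ci d].
have r : {near x, (fun y => complex.Re (u y)) =1 (fun y => complex.Re (v y))}.
  by apply: filterS uv => y ->.
have i : {near x, (fun y => complex.Im (u y)) =1 (fun y => complex.Im (v y))}.
  by apply: filterS uv => y ->.
split; [exact: near_continuous cr|exact: near_continuous ci|].
move=> j; have [dr di] := d j.
by split; [exact: near_eq_derivable dr|exact: near_eq_derivable di].
Qed.

Lemma near_pderiv u v x i : {near x, u =1 v} -> pderiv i u x = pderiv i v x.
Proof.
move=> uv; apply: complex_ext => /=; apply: near_eq_derive.
  by apply: filterS uv => y ->.
by apply: filterS uv => y ->.
Qed.

Lemma open_near U x (P : 'rV[R]_n -> Prop) : open U -> U x ->
  (forall y, U y -> P y) -> \forall y \near x, P y.
Proof. by move=> oU Ux h; apply: filterS h _; exact: open_nbhs_nbhs. Qed.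

Lemma iter_pderiv_ext U u v s : open U -> (forall x, U x -> u x = v x) ->
  forall x, U x -> iter_pderiv s u x = iter_pderiv s v x.
Proof.
move=> oU uv; elim: s => [|i s IH] //= x Ux.
exact: (near_pderiv i (open_near oU Ux IH)).
Qed.

Lemma smooth_on_ext U u v : open U -> (forall x, U x -> u x = v x) ->
  smooth_on U u -> smooth_on U v.
Proof.
move=> oU uv su s x Ux; apply: near_partials (su s x Ux).
exact: (open_near oU Ux (iter_pderiv_ext s oU uv)).
Qed.

Lemma smooth_on_pderiv U u s : smooth_on U u -> smooth_on U (iter_pderiv s u).
Proof. by move=> su s' x Ux; rewrite /iter_pderiv -foldr_cat; exact: su. Qed.

Lemma iter_pderivD U u v s : open U -> smooth_on U u -> smooth_on U v ->
  forall x, U x ->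
  iter_pderiv s (fun y => u y + v y) x = iter_pderiv s u x + iter_pderiv s v x.
Proof.
move=> oU su sv; elim: s => [|i s IH] //= x Ux.
rewrite (near_pderiv _ (open_near oU Ux IH)).
apply: is_pderiv_val; apply: is_pderivD; apply: partials_is_pderiv.
  exact: su.
exact: sv.
Qed.

Lemma smooth_onD U u v : open U -> smooth_on U u -> smooth_on U v ->
  smooth_on U (fun y => u y + v y).
Proof.
move=> oU su sv s x Ux.
apply: (@near_partials (fun y => iter_pderiv s u y + iter_pderiv s v y)).
  apply: (open_near oU Ux) => y Uy.
  by rewrite (iter_pderivD s oU su sv).
by apply: partialsD; [exact: su|exact: sv].
Qed.

(** The terms of the Leibniz formula are indexed by pairs of subsequences
    rather than by pairs of multi-indices with binomial coefficients. This way
    derivatives never have to be permuted, and a subsequence of the sorted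
    sequence of a multi-index is again sorted, hence comes from a multi-index. *)
Fixpoint leibniz_splits (s : seq 'I_n) : seq (seq 'I_n * seq 'I_n) :=
  if s is i :: s' then
    [seq (i :: p.1, p.2) | p <- leibniz_splits s'] ++
    [seq (p.1, i :: p.2) | p <- leibniz_splits s']
  else [:: ([::], [::])].

Lemma size_leibniz_splits s : size (leibniz_splits s) = (2 ^ size s)%N.
Proof.
elim: s => [|i s IH] //=; rewrite size_cat !size_map IH.
by rewrite expnS mul2n addnn.
Qed.

Lemma leibniz_splitsP s p : p \in leibniz_splits s ->
  [/\ subseq p.1 s, subseq p.2 s & (size p.1 + size p.2 = size s)%N].
Proof.
elim: s p => [|i s IH] p /=; first by rewrite inE => /eqP ->.
rewrite mem_cat => /orP[] /mapP[q /IH[h1 h2 h3]] -> /=; split=> //.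
- by rewrite eqxx.
- exact: subseq_trans h2 (subseq_cons _ _).
- by rewrite addSn h3.
- exact: subseq_trans h1 (subseq_cons _ _).
- by rewrite eqxx.
- by rewrite addnS h3.
Qed.

Lemma is_pderiv_sum (I : Type) (r : seq I) (F : I -> cfun R n) (d : I -> R[i]) x i :
  (forall j, is_pderiv (F j) x i (d j)) ->
  is_pderiv (fun y => \sum_(j <- r) F j y) x i (\sum_(j <- r) d j).
Proof.
move=> h; elim: r => [|j r IH].
  rewrite big_nil (_ : (fun y => _) = (fun=> 0)); first exact: is_pderiv_cst.
  by apply/funext => y; rewrite big_nil.
rewrite big_cons (_ : (fun y => _) = (fun y => F j y + \sum_(k <- r) F k y)).
  exact: is_pderivD.
by apply/funext => y; rewrite big_cons.
Qed.

Lemma iter_pderivM U u v s : open U -> smooth_on U u -> smooth_on U v ->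
  forall x, U x -> iter_pderiv s (fun y => u y * v y) x =
    \sum_(p <- leibniz_splits s) iter_pderiv p.1 u x * iter_pderiv p.2 v x.
Proof.
move=> oU su sv; elim: s => [|i s IH] /= x Ux; first by rewrite big_seq1.
rewrite (near_pderiv _ (open_near oU Ux IH)).
rewrite big_cat !big_map /= -big_split /=.
apply: is_pderiv_val; apply: is_pderiv_sum => p.
by apply: is_pderivM; apply: partials_is_pderiv; [exact: su|exact: sv].
Qed.

Lemma smooth_onM U u v : open U -> smooth_on U u -> smooth_on U v ->
  smooth_on U (fun y => u y * v y).
Proof.
move=> oU su sv s x Ux.
apply: (@near_partials (fun y => \sum_(p <- leibniz_splits s)
    iter_pderiv p.1 u y * iter_pderiv p.2 v y)).
  by apply: (open_near oU Ux) => y Uy; rewrite (iter_pderivM s oU su sv).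
apply: partials_sum => p; apply: partialsM; [exact: su|exact: sv].
Qed.

(** An explicit formula for the iterated derivatives of [u] is replaced by a
    class of functions in which they all stay. *)
Lemma smooth_of_stable (S : set (cfun R n)) u :
  (forall v x, S v -> partials_at v x) -> (forall v i, S v -> S (pderiv i v)) ->
  S u -> smooth_on setT u.
Proof.
move=> h1 h2 Su s x _; apply: h1.
by elim: s => [|i s IH] //=; exact: h2.
Qed.

Lemma smooth_cst c : smooth_on setT (fun=> c).
Proof.
apply: (@smooth_of_stable [set v | exists c, v = fun=> c]); last by exists c.
  by move=> v x [d ->]; exact: partials_cst.
move=> v i [d ->]; exists 0; apply/funext => x.
by apply: is_pderiv_val; exact: is_pderiv_cst.
Qed.

Lemma smooth_onS U V u : U `<=` V -> smooth_on V u -> smooth_on U u.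
Proof. by move=> UV su s x /UV; exact: su. Qed.

Lemma iter_pderivZ U c u s : open U -> smooth_on U u -> forall x, U x ->
  iter_pderiv s (fun y => c * u y) x = c * iter_pderiv s u x.
Proof.
move=> oU su; elim: s => [|i s IH] //= x Ux.
rewrite (near_pderiv _ (open_near oU Ux IH)).
rewrite -[RHS]add0r -(mul0r (iter_pderiv s u x)).
apply: is_pderiv_val; apply: is_pderivM; first exact: is_pderiv_cst.
by apply: partials_is_pderiv; exact: su.
Qed.

Lemma smooth_onZ U c u : open U -> smooth_on U u -> smooth_on U (fun y => c * u y).
Proof.
move=> oU su; apply: smooth_onM => //.
exact: smooth_onS (@subsetT _ _) (smooth_cst c).
Qed.

Lemma iter_pderivB U u v s : open U -> smooth_on U u -> smooth_on U v ->
  forall x, U x ->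
  iter_pderiv s (fun y => u y - v y) x = iter_pderiv s u x - iter_pderiv s v x.
Proof.
move=> oU su sv x Ux.
have -> : (fun y => u y - v y) = (fun y => u y + (-1) * v y).
  by apply/funext => y; rewrite mulN1r.
rewrite (iter_pderivD s oU)//; last exact: smooth_onZ.
by rewrite (iter_pderivZ _ s oU)// mulN1r.
Qed.

Lemma smooth_onB U u v : open U -> smooth_on U u -> smooth_on U v ->
  smooth_on U (fun y => u y - v y).
Proof.
move=> oU su sv.
have -> : (fun y => u y - v y) = (fun y => u y + (-1) * v y).
  by apply/funext => y; rewrite mulN1r.
by apply: smooth_onD => //; exact: smooth_onZ.
Qed.

Lemma smooth_ccont u s : smooth_on setT u -> ccont (iter_pderiv s u).
Proof. by move=> su; split=> x; have [] := su s x I. Qed.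

(** On [V] the function agrees with 0, which is smooth; smoothness is a local
    property. *)
Lemma smooth_zero_off (U V : set 'rV[R]_n) u : open U -> open V ->
  U `|` V = setT -> (forall x, V x -> u x = 0) -> smooth_on U u ->
  smooth_on setT u /\ forall s x, V x -> iter_pderiv s u x = 0.
Proof.
move=> oU oV UV uV su.
have sc : smooth_on V (fun=> 0) := smooth_onS (@subsetT _ _) (smooth_cst 0).
have sV : smooth_on V u by apply: smooth_on_ext sc => // x /uV.
split=> [s x _|s x Vx].
  have : (U `|` V) x by rewrite UV.
  by move=> [|]; [exact: su|exact: sV].
rewrite (iter_pderiv_ext s oV uV Vx).
have h : forall y, iter_pderiv s (fun=> 0) y = 0.
  elim: s => [|i s IH] //= y.
  rewrite (near_pderiv i (@nearW _ (nbhs y) _ _ (fun z => IH z))).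
  by apply: is_pderiv_val; exact: is_pderiv_cst.
exact: h.
Qed.

Lemma open_not_in_box B : open [set x : 'rV[R]_n | ~ in_box B x].
Proof. by rewrite openE => x /not_in_box_nbhs. Qed.

Lemma boxed_iter_pderiv B u s : smooth_on setT u -> boxed B u ->
  boxed B (iter_pderiv s u).
Proof.
move=> su bu.
have [_ h] := smooth_zero_off openT (@open_not_in_box B) (setTU _) bu su.
exact: h.
Qed.

Lemma cboxed_iter_pderiv B u s : smooth_on setT u -> boxed B u ->
  cboxed B (iter_pderiv s u).
Proof.
by move=> su bu; split; [exact: smooth_ccont|exact: boxed_iter_pderiv].
Qed.

(** This is integration by parts, in the form needed for the Fourier transform
    of a derivative. *)
Lemma cint_pderiv B u i : 0 <= B -> smooth_on setT u -> boxed B u ->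
  cint (pderiv i u) = 0.
Proof.
move=> B0 su bu.
have b := cboxed_iter_pderiv [::] su bu.
have [c1 c2] := @smooth_ccont u [:: i] su.
apply: complex_ext => /=.
  apply: (@iter_integral_derive _ _ B) => //; first exact: cboxed_Re.
  by move=> x; have [_ _ /(_ i)[]] := su [::] x I.
apply: (@iter_integral_derive _ _ B) => //; first exact: cboxed_Im.
by move=> x; have [_ _ /(_ i)[]] := su [::] x I.
Qed.

Lemma is_derive_of_line (f : 'rV[R]_n -> R) (x v : 'rV[R]_n) d :
  is_derive (0 : R) (1 : R) (fun t : R => f (x + t *: v)) d -> is_derive x v f d.
Proof.
move=> [df <-].
have e : (fun h : R => h^-1 *: (f (h *: v + x) - f x)) =
  (fun h : R => h^-1 *: ((fun s : R => f (x + s *: v)) (h *: (1 : R) + 0) -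
     (fun s : R => f (x + s *: v)) 0)).
  apply/funext => h /=; congr (_ *: (f _ - f _)).
    by rewrite [h *: 1]mulr1 addr0 addrC.
  by rewrite scale0r addr0.
by split; [rewrite /derivable e | rewrite /derive e].
Qed.

Lemma pderiv_expi_dotp (xi x : 'rV[R]_n) i :
  is_pderiv (fun y => expi (dotp y xi)) x i
    ('i * (xi ord0 i)%:C * expi (dotp x xi)).
Proof.
have d0 (b a : R) : is_derive (0 : R) (1 : R) (fun t => b + t * a) a.
  apply: (is_derive_eq (is_deriveD (is_derive_cst b _ _)
    (is_deriveM (is_derive_id _ _) (is_derive_cst a _ _)))).
  by rewrite /GRing.scale /=; ring.
split; apply: is_derive_of_line.
  under eq_fun do rewrite dotpDl dotpZl dotp_delta.
  have := @is_derive1_comp R (@cos R) _ 0 _ _ (is_derive_cos _)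
     (d0 (dotp x xi) (xi ord0 i)).
  move=> h; apply: (is_derive_eq h).
  by rewrite /= mul0r addr0 /GRing.scale /=; ring.
under eq_fun do rewrite dotpDl dotpZl dotp_delta.
have := @is_derive1_comp R (@sin R) _ 0 _ _ (is_derive_sin _)
   (d0 (dotp x xi) (xi ord0 i)).
move=> h; apply: (is_derive_eq h).
by rewrite /= mul0r addr0 /GRing.scale /=; ring.
Qed.

Lemma smooth_expi_dotp xi : smooth_on setT (fun y => expi (dotp y xi)).
Proof.
apply: (@smooth_of_stable [set v | exists c, v = fun y => c * expi (dotp y xi)]).
- move=> v x [c ->]; apply: partialsM; first exact: partials_cst.
  have [c1 c2] := ccont_expi (@continuous_dotp R n xi).
  exact: (partials_of (c1 x) (c2 x) (fun i => pderiv_expi_dotp xi x i)).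
- move=> v i [c ->]; exists (c * ('i * (xi ord0 i)%:C)); apply/funext => x.
  rewrite -mulrA -[RHS]add0r -(mul0r (expi (dotp x xi))).
  apply: is_pderiv_val; apply: is_pderivM; first exact: is_pderiv_cst.
  exact: pderiv_expi_dotp.
- by exists 1; apply/funext => x; rewrite mul1r.
Qed.

Lemma fourier_pderiv B u i xi : 0 <= B -> smooth_on setT u -> boxed B u ->
  fourier (pderiv i u) xi = 'i * (xi ord0 i)%:C * fourier u xi.
Proof.
move=> B0 su bu; rewrite !fourierE.
under eq_fun do rewrite -dotpNr.
under [X in _ = _ * cint X]eq_fun do rewrite -dotpNr.
set e := fun x => expi (dotp x (- xi)).
have se : smooth_on setT e := smooth_expi_dotp _.
have sue : smooth_on setT (fun x => u x * e x) by apply: smooth_onM => //; exact: openT.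
have bue : boxed B (fun x => u x * e x) by move=> x /bu ->; rewrite mul0r.
have cu : cboxed B u := cboxed_iter_pderiv [::] su bu.
have cdu : cboxed B (pderiv i u) := cboxed_iter_pderiv [:: i] su bu.
have ce : ccont e := @smooth_ccont e [::] se.
have := cint_pderiv i B0 sue bue.
have -> : pderiv i (fun x => u x * e x) =
    (fun x => pderiv i u x * e x + - ('i * (xi ord0 i)%:C) * (u x * e x)).
  apply/funext => x.
  have h := is_pderivM (partials_is_pderiv i (su [::] x I)) (pderiv_expi_dotp (- xi) x i).
  rewrite (is_pderiv_val h) /= mxE; congr (_ + _).
  rewrite (_ : (- xi ord0 i)%:C = - (xi ord0 i)%:C); last exact: (rmorphN (real_complex R)).
  by rewrite /e; ring.
rewrite (@cintD _ _ B); last 2 first.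
- exact: cboxedMr.
- by apply: cboxedZ; exact: cboxedMr.
rewrite (@cintZ _ _ B); last exact: cboxedMr.
by rewrite mulNr => /eqP; rewrite subr_eq0 => /eqP.
Qed.

Lemma fourier_iter_pderiv B u s xi : 0 <= B -> smooth_on setT u -> boxed B u ->
  fourier (iter_pderiv s u) xi = (\prod_(i <- s) ('i * (xi ord0 i)%:C)) * fourier u xi.
Proof.
move=> B0 su bu; elim: s => [|i s IH]; first by rewrite big_nil mul1r.
rewrite /= big_cons -mulrA -IH; apply: (@fourier_pderiv B) => //.
  exact: smooth_on_pderiv.
exact: boxed_iter_pderiv.
Qed.

End Smooth.

(** * The Fejer kernel on the line *)

Section FejerLine.
Local Open Scope complex_scope.
Context {R : realType}.
Notation mu := (@lebesgue_measure R).

Lemma integrable_addf (D : set (measurableTypeR R)) (f g : R -> R) : measurable D ->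
  mu.-integrable D (EFin \o f) -> mu.-integrable D (EFin \o g) ->
  mu.-integrable D (EFin \o (fun t => f t + g t)).
Proof. move=> mD hf hg; have := integrableD mD hf hg.
by apply: eq_integrable => //. Qed.

Lemma boxed_cont1M (B : R) f g : boxed_cont1 B f -> continuous g ->
  boxed_cont1 B (fun t => f t * g t).
Proof.
move=> [cf hf] cg; split=> [t|t /hf ->]; last by rewrite mul0r.
exact: (continuousM (cf t) (cg t)).
Qed.

Lemma continuous_lin (c : R) : continuous (fun t : R => c * t).
Proof.
move=> t; apply: continuousM; [exact: cst_continuous|exact: cvg_id].
Qed.

Lemma continuous_cos_lin (c : R) : continuous (fun t : R => cos (c * t)).
Proof.
move=> t.
exact: (@continuous_comp _ _ _ (fun t => c * t) (@cos R) t (@continuous_lin c t)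
  (@continuous_cos R _)).
Qed.

Lemma integrable_cos (W c k : R) :
  mu.-integrable `[(- W), W] (EFin \o (fun t => k * cos (c * t))).
Proof.
apply: continuous_compact_integrable; first exact: segment_compact.
apply: continuous_subspaceT => t.
by apply: (continuousM (@cst_continuous _ _ k t)); exact: continuous_cos_lin.
Qed.

Lemma int_cos_period (W c : R) : 0 < W -> c != 0 -> sin (c * W) = 0 ->
  \int[mu]_(t in `[(- W), W]) cos (c * t) = 0.
Proof.
move=> W0 c0 sW.
have dF (t : R) : is_derive t (1 : R) (fun t => c^-1 * sin (c * t)) (cos (c * t)).
  have d1 : is_derive t (1 : R) (fun t : R => c * t) c.
    apply: (is_derive_eq (is_deriveM (is_derive_cst c _ _) (is_derive_id t 1))).
    by rewrite /GRing.scale /=; ring.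
  have d2 := @is_derive1_comp R (@sin R) _ t _ _ (is_derive_sin _) d1.
  apply: (is_derive_eq (is_deriveM (is_derive_cst c^-1 _ _) d2)).
  by rewrite /GRing.scale /=; field.
have cF : continuous (fun t => c^-1 * sin (c * t)).
  move=> t; apply/differentiable_continuous/derivable1_diffP.
  exact: (@ex_derive _ _ _ _ _ _ _ (dF t)).
rewrite /Rintegral (@continuous_FTC2 _ _ (fun t => c^-1 * sin (c * t))).
- by rewrite mulrN sinN sW oppr0 mulr0 subee.
- by rewrite gtrN.
- exact/continuous_subspaceT/continuous_cos_lin.
- split; [by move=> t _; exact: (@ex_derive _ _ _ _ _ _ _ (dF t)) | |].
    by apply: cvg_at_right_filter; exact: cF.
  by apply: cvg_at_left_filter; exact: cF.
- by move=> t _; rewrite derive1E (@derive_val _ _ _ _ _ _ _ (dF t)).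
Qed.

Definition clamp (W t : R) := Num.min (Num.max t (- W)) W.

(** The Hann window: a bump of half-width [W] whose translates by multiples of
    [W] add up to 1. Integrating a trigonometric polynomial of period [W]
    against it amounts to integrating over one period, but the integrand is
    continuous with compact support on the line, unlike the restriction of the
    polynomial to a period. *)
Definition hann (W t : R) := (1 + cos (pi / W * clamp W t)) / 2.

Lemma clamp_in W t : 0 <= W -> `|t| <= W -> clamp W t = t.
Proof.
move=> W0; rewrite ler_norml => /andP[h1 h2].
by rewrite /clamp max_l// min_l.
Qed.

Lemma clamp_out W t : 0 < W -> W <= `|t| -> `|clamp W t| = W.
Proof.
move=> W0; rewrite ler_normr /clamp => /orP[h|h].
  have -> : Num.min (Num.max t (- W)) W = W by apply: min_r; rewrite le_max h.
  exact/ger0_norm/ltW.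
rewrite max_r; last by rewrite lerNr.
by rewrite min_l ?normrN; [exact/ger0_norm/ltW|rewrite ltW// gtrN].
Qed.

Lemma hann_out W t : 0 < W -> W <= `|t| -> hann W t = 0.
Proof.
move=> W0 h; rewrite /hann -cos_norm normrM clamp_out//.
rewrite ger0_norm ?divr_ge0 ?pi_ge0 ?ltW// divfK ?gt_eqF//.
by rewrite cospi subrr mul0r.
Qed.

Lemma hann0 W : 0 < W -> hann W 0 = 1.
Proof.
move=> W0; rewrite /hann (clamp_in (ltW W0)) ?normr0 ?(ltW W0)// mulr0 cos0.
by rewrite divff// (_ : 1 + 1 = 2%:R :> R) // pnatr_eq0.
Qed.

Lemma hann_ge0 W t : 0 <= hann W t.
Proof. by rewrite divr_ge0// -lerBlDl sub0r cos_geN1. Qed.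

Lemma hann_half W t : 0 < W -> `|t| <= W / 2 -> 2^-1 <= hann W t.
Proof.
move=> W0 h; rewrite /hann (clamp_in (ltW W0)); last first.
  by apply: le_trans h _; rewrite ler_pdivrMr// ler_pMr// ler1n.
rewrite -[leLHS]mul1r ler_pM2r ?invr_gt0// lerDl; apply: cos_ge0_pihalf.
rewrite -ler_norml normrM ger0_norm ?(divr_ge0 (pi_ge0 R) (ltW W0))//.
by rewrite -ler_pdivlMl ?divr_gt0 ?pi_gt0// invf_div mulrA divfK// gt_eqF// pi_gt0.
Qed.

Lemma boxed_cont1_hann W : 0 < W -> boxed_cont1 W (hann W).
Proof.
move=> W0; split=> [|t /ltW h]; last exact: hann_out.
have cc : continuous (clamp W).
  move=> t.
  have cm : {for t, continuous ((id : R -> R^o) \max (fun=> - W))}.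
    by apply: continuous_max; [exact: cvg_id|exact: cst_continuous].
  have := continuous_min cm (@cst_continuous _ R^o W t).
  by congr (_ @ _ --> _).
have -> : hann W = (fun t => (1 + cos (pi / W * clamp W t)) / 2) by [].
move=> t; apply: (continuousM _ (@cst_continuous _ _ (2^-1 : R) t)).
apply: (continuousD (@cst_continuous _ _ (1 : R) t)).
exact: (@continuous_comp _ _ _ (clamp W) (fun s => cos (pi / W * s)) t (cc t)
  (@continuous_cos_lin (pi / W) _)).
Qed.

(** On [[- W, W]] the window is [(1 + cos (pi * t / W)) / 2], so the integrand
    is a combination of cosines of frequencies [c], [c + pi / W] and
    [c - pi / W]. Their integrals over this segment vanish, with the exception
    of the first one when [c = 0]; the other two frequencies are nonzero
    because [cos (c * W) = 1] while [cos pi = -1]. *)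
Lemma int_hann_cos (W c : R) : 0 < W -> cos (c * W) = 1 ->
  \int[mu]_(t in setT) (hann W t * cos (c * t)) = if c == 0 then W else 0.
Proof.
move=> W0 cW.
have sW : sin (c * W) = 0 by apply: cos1sin0; rewrite cW normr1.
pose b := pi / W.
have bW : b * W = pi by rewrite /b divfK// gt_eqF.
have b0 : b != 0 by rewrite gt_eqF// divr_gt0// pi_gt0.
have cb : cos (pi : R) = -1 := cospi R.
have n11 : (1 : R) != -1 by rewrite gt_eqF// gtrN.
have cb1 : c + b != 0.
  apply: contraNneq n11 => h; rewrite -[X in X == _]cW -cb -bW -[X in _ == X]cosN -mulNr.
  by have -> : c = - b by apply/eqP; rewrite -subr_eq0 opprK h.
have cb2 : c - b != 0.
  apply: contraNneq n11 => h; rewrite -[X in X == _]cW -cb -bW.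
  by have -> : c = b by apply/eqP; rewrite -subr_eq0 h.
have bh := boxed_cont1M (boxed_cont1_hann W0) (@continuous_cos_lin c).
rewrite (boxed_cont1_int bh).
have -> : \int[mu]_(t in `[(- W), W]) (hann W t * cos (c * t)) =
  \int[mu]_(t in `[(- W), W]) (2^-1 * cos (c * t) +
    (4^-1 * cos ((c + b) * t) + 4^-1 * cos ((c - b) * t))).
  apply: eq_Rintegral => t; rewrite inE /= in_itv /= -ler_norml => tW.
  rewrite /hann (clamp_in (ltW W0))// -/b [(c + b) * t]mulrDl mulrBl cosB cosD.
  by field.
rewrite RintegralD//; [|exact: integrable_cos|]; last first.
  by apply: integrable_addf => //; exact: integrable_cos.
rewrite RintegralD//; [|exact: integrable_cos|exact: integrable_cos].
have Z k a : \int[mu]_(t in `[(- W), W]) (k * cos (a * t)) =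
    k * \int[mu]_(t in `[(- W), W]) cos (a * t).
  rewrite RintegralZl//.
  have := integrable_cos W a 1; congr (mu.-integrable _ (_ \o _)).
  by apply/funext => t; rewrite mul1r.
rewrite !Z (int_cos_period W0 cb1); last by rewrite mulrDl bW sinDpi sW oppr0.
rewrite (int_cos_period W0 cb2); last first.
  by rewrite mulrBl bW sinB sW sinpi mul0r mulr0 subrr.
rewrite !mulr0 !addr0; case: eqP => [->|/eqP c0]; last first.
  by rewrite int_cos_period// mulr0.
rewrite (_ : (fun t => _) = cst 1); last first.
  by apply/funext => t; rewrite mul0r cos0.
have := @Rintegral_cst _ _ _ mu `[(- W), W] _ 1 => -> //.
have := @lebesgue_measure_itv R `[(- W), W]; rewrite /= lte_fin => ->.
by rewrite gtrN//=; field.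
Qed.

(** The squared modulus of a Dirichlet sum, normalised so as to have mean value
    1. *)
Definition fejer (N : nat) (y : R) : R :=
  normc (\sum_(p < N) expi (p%:R * y)) ^+ 2 / N%:R.

Lemma fejer_ge0 N y : 0 <= fejer N y.
Proof. by rewrite divr_ge0// exprn_ge0// normc_ge0. Qed.

Lemma normc_sqr (z : R[i]) : normc z ^+ 2 = complex.Re z ^+ 2 + complex.Im z ^+ 2.
Proof. by case: z => a b /=; rewrite sqr_sqrtr// addr_ge0// sqr_ge0. Qed.

(** [2 * (1 - cos y)] is the squared modulus of [expi y - 1], which times the
    geometric sum gives [expi y ^+ N - 1], of modulus at most 2. *)
Lemma fejer_cos_le N y : (0 < N)%N -> (1 - cos y) * fejer N y <= 2 / N%:R.
Proof.
move=> N0; rewrite /fejer mulrA ler_pM2r ?invr_gt0 ?ltr0n//.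
have -> : \sum_(p < N) expi (p%:R * y) = \sum_(p < N) expi y ^+ p.
  by apply: eq_bigr => p _; rewrite expi_muln.
have h : normc (expi y ^+ N - 1) <= 2.
  apply: le_trans (le_normcD _ _) _.
  by rewrite normcN normcX normc_expi expr1n normc1.
have : normc (expi y ^+ N - 1) ^+ 2 <= 2 ^+ 2.
  by rewrite lerXn2r// nnegrE ?normc_ge0.
rewrite subrX1 normcM exprMn (normc_sqr (expi y - 1)).
rewrite (ReD (expi y)) (ImD (expi y)) ReN ImN /=.
have := cos2Dsin2 y.
have -> : (cos y - 1) ^+ 2 + (sin y - 0) ^+ 2 =
  cos y ^+ 2 + sin y ^+ 2 + 1 - 2 * cos y by ring.
move=> ->; lra.
Qed.

Lemma fejerE N y : fejer N y =
  N%:R^-1 * \sum_(p < N) \sum_(q < N) cos ((p%:R - q%:R) * y).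
Proof.
rewrite /fejer mulrC normc_sqr Re_sum Im_sum !expr2 /=; congr (_ * _).
rewrite !mulr_suml -big_split /=; apply: eq_bigr => p _.
rewrite !mulr_sumr -big_split /=; apply: eq_bigr => q _.
by rewrite mulrBl cosB.
Qed.

Lemma continuous_fejer N (c : R) : continuous (fun y => fejer N (c * y)).
Proof.
under eq_fun do rewrite fejerE.
move=> x; apply: (continuousM (@cst_continuous _ _ _ x)).
have -> : (fun y : R => \sum_(p < N) \sum_(q < N) cos ((p%:R - q%:R) * (c * y))) =
   (fun y : R => \sum_(p < N) \sum_(q < N) cos (((p%:R - q%:R) * c) * y)).
  by apply/funext => y; apply: eq_bigr => p _; apply: eq_bigr => q _; rewrite mulrA.
apply: (@continuous_sum_seq _ R^o) => p {}x.
by apply: (@continuous_sum_seq _ R^o) => q {}x; exact: continuous_cos_lin.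
Qed.

(** Of the cosines that make up the kernel, only the [N] constant ones
    contribute. *)
Lemma int_hann_fejer N (theta W : R) (r : nat) : (0 < N)%N -> 0 < theta -> 0 < W ->
  theta * W = r%:R * (pi *+ 2) ->
  \int[mu]_(t in setT) (hann W t * fejer N (theta * t)) = W.
Proof.
move=> N0 t0 W0 tW.
have bc (c k : R) : boxed_cont1 W (fun t => k * (hann W t * cos (c * t))).
  have := boxed_cont1M (boxed_cont1M (boxed_cont1_hann W0) (@continuous_cos_lin c))
    (@cst_continuous _ _ k).
  by congr boxed_cont1; apply/funext => t; rewrite mulrC.
have ic (c k : R) := boxed_cont1_integrable (bc c k).
have isum (I : Type) (s : seq I) (f : I -> R -> R) :
    (forall i, mu.-integrable setT (EFin \o f i)) ->
    mu.-integrable setT (EFin \o (fun t => \sum_(i <- s) f i t)) /\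
    \int[mu]_(t in setT) (\sum_(i <- s) f i t) =
    \sum_(i <- s) \int[mu]_(t in setT) f i t.
  move=> hf; elim: s => [|i s [h1 h2]].
    rewrite big_nil (_ : (fun t => _) = (fun=> 0)); last first.
      by apply/funext => t; rewrite big_nil.
    by split; [exact: integrable0 | rewrite Rintegral_cst// mul0r].
  rewrite big_cons (_ : (fun t => _) = (fun t => f i t + \sum_(j <- s) f j t)).
    split; first exact: (integrable_addf measurableT (hf i) h1).
    by rewrite RintegralD// h2.
  by apply/funext => t; rewrite big_cons.
have -> : (fun t => hann W t * fejer N (theta * t)) =
  (fun t => \sum_(p < N) \sum_(q < N)
     N%:R^-1 * (hann W t * cos ((p%:R - q%:R) * theta * t))).
  apply/funext => t; rewrite fejerE mulrCA mulr_sumr.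
  rewrite mulr_sumr; apply: eq_bigr => p _.
  rewrite mulr_sumr mulr_sumr; apply: eq_bigr => q _.
  by rewrite -[(_ * theta) * t]mulrA.
have h1 (p : 'I_N) := isum _ (index_enum 'I_N) _
  (fun q : 'I_N => ic ((p%:R - q%:R) * theta) N%:R^-1).
rewrite (isum _ _ _ (fun p => (h1 p).1)).2.
have -> : \sum_(p < N) \int[mu]_(t in setT) (\sum_(q < N)
    N%:R^-1 * (hann W t * cos ((p%:R - q%:R) * theta * t))) =
   \sum_(p < N) (N%:R^-1 * W).
  apply: eq_bigr => p _; rewrite (h1 p).2.
  have e (q : 'I_N) : \int[mu]_(t in setT)
       (N%:R^-1 * (hann W t * cos ((p%:R - q%:R) * theta * t))) =
      if q == p then N%:R^-1 * W else 0.
    rewrite RintegralZl//; last first.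
      by have := boxed_cont1M (boxed_cont1_hann W0) (@continuous_cos_lin
        ((p%:R - q%:R) * theta)) => /boxed_cont1_integrable.
    rewrite int_hann_cos//; last first.
      rewrite -mulrA tW.
      have e1 (m : nat) : expi (m%:R * (r%:R * (pi *+ 2))) = 1 :> R[i].
        by rewrite !expi_muln /expi cos2pi sin2pi !expr1n.
      have : expi ((p%:R - q%:R) * (r%:R * (pi *+ 2))) = 1 :> R[i].
        by rewrite mulrBl expiD expiN !e1 conjc1 mulr1.
      by move=> /(congr1 (@complex.Re R)).
    rewrite mulf_eq0 (gt_eqF t0) orbF subr_eq0 eqr_nat eq_sym.
    by rewrite -val_eqE /=; case: eqP => // _; rewrite mulr0.
  under eq_bigr do rewrite e.
  by rewrite -big_mkcond /= big_pred1_eq.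
rewrite sumr_const card_ord -[(_ * W) *+ N]mulr_natl mulrA divff ?mul1r//.
by rewrite pnatr_eq0 -lt0n.
Qed.

(** The kernel concentrates at the points where [cos (theta * t) = 1]. *)
Lemma int_hann_fejer_cos N (theta W : R) : (0 < N)%N -> 0 < W ->
  `|\int[mu]_(t in setT) (hann W t * ((1 - cos (theta * t)) * fejer N (theta * t)))|
  <= (4 * W) / N%:R.
Proof.
move=> N0 W0.
have b : boxed_cont1 W
    (fun t => hann W t * ((1 - cos (theta * t)) * fejer N (theta * t))).
  apply: boxed_cont1M; first exact: boxed_cont1_hann.
  move=> t; apply: (continuousM _ (@continuous_fejer N theta t)).
  exact: (continuousB (@cst_continuous _ _ (1 : R) t) (@continuous_cos_lin theta t)).
apply: le_trans (boxed_cont1_bound (M := 2 / N%:R) (ltW W0) b _) _; last first.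
  by rewrite le_eqVlt; apply/orP; left; apply/eqP; ring.
move=> t; have h : 0 <= 1 - cos (theta * t) by rewrite subr_ge0 cos_le1.
rewrite ger0_norm; last first.
  by apply: mulr_ge0; [exact: hann_ge0|rewrite mulr_ge0// fejer_ge0].
apply: le_trans _ (fejer_cos_le (theta * t) N0); rewrite ler_piMl//.
  by rewrite mulr_ge0// fejer_ge0.
by rewrite ler_pdivrMr// mul1r -lerBrDl (_ : 2 - 1 = 1 :> R) ?cos_le1//; ring.
Qed.

Lemma cos_eq1_2pi (y : R) : cos y = 1 -> `|y| <= pi *+ 2 ->
  y = 0 \/ `|y| = pi *+ 2.
Proof.
move=> cy; rewrite le_eqVlt => /predU1P[->|ylt]; first by right.
have [->|y0] := eqVneq y 0; first by left.
exfalso; have : cos ((`|y| / 2) *+ 2) = 1.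
  by rewrite -mulr_natr divfK ?pnatr_eq0// cos_norm.
rewrite cos_mulr2n.
have : 0 < sin (`|y| / 2).
  apply: sin_gt0_pi; rewrite divr_gt0 ?normr_gt0//= ltr_pdivrMr//.
  by rewrite mulr_natr.
move=> /(exprn_gt0 2); rewrite sin2cos2 mulr2n; lra.
Qed.

End FejerLine.

(** * Fejer's theorem in several variables *)

Section Fejer.
Local Open Scope complex_scope.
Context {R : realType} {n : nat}.
Notation mu := (@lebesgue_measure R).

Definition freq (theta : R) (k : {ffun 'I_n -> int}) : 'rV[R]_n :=
  \row_j (theta * (k j)%:~R).

Definition index_diff N (p q : {ffun 'I_n -> 'I_N}) : {ffun 'I_n -> int} :=
  [ffun j => (q j : nat)%:Z - (p j : nat)%:Z].

Definition fejer_kernel N (theta : R) (z : 'rV[R]_n) : R :=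
  \prod_j fejer N (theta * z ord0 j).

Lemma expi_sum (I : Type) (r : seq I) (F : I -> R) :
  expi (\sum_(i <- r) F i) = \prod_(i <- r) expi (F i).
Proof.
elim: r => [|i r IH]; first by rewrite !big_nil expi0.
by rewrite !big_cons expiD IH.
Qed.

Lemma normc_sqrJ (z : R[i]) : (normc z ^+ 2)%:C = z * z^*%C.
Proof.
rewrite normc_sqr; case: z => a b; apply: complex_ext; rewrite ?ReM ?ImM /=; ring.
Qed.

Lemma fejer_kernelE N theta z : (fejer_kernel N theta z)%:C =
  (N%:R^-1 ^+ n)%:C * \sum_p \sum_q expi (- dotp z (freq theta (@index_diff N p q))).
Proof.
rewrite /fejer_kernel /fejer rmorph_prod /=.
pose A (j : 'I_n) (p : 'I_N) : R[i] := expi (p%:R * (theta * z ord0 j)).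
have -> : \prod_j ((normc (\sum_(p < N) expi (p%:R * (theta * z ord0 j))) ^+ 2 / N%:R)%:C : R[i]) =
    \prod_(j < n) ((N%:R^-1)%:C * ((\sum_(p < N) A j p) * (\sum_(q < N) (A j q)^*%C))).
  apply: eq_bigr => j _; rewrite rmorphM /= normc_sqrJ mulrC; congr (_ * (_ * _)).
  by rewrite rmorph_sum.
rewrite big_split /= prodr_const card_ord rmorphXn /=; congr (_ * _).
rewrite big_split /= !bigA_distr_bigA big_distrlr /=.
apply: eq_bigr => p _; apply: eq_bigr => q _.
rewrite -big_split /= /dotp -sumrN expi_sum; apply: eq_bigr => j _.
have hc y : cos y -i* sin y = expi (- y) :> R[i] by rewrite /expi cosN sinN.
rewrite /A hc -expiD; congr expi; rewrite !mxE ffunE rmorphB /= -!pmulrn; ring.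
Qed.

Lemma continuous_cos_coord (theta : R) (j : 'I_n) :
  continuous (fun z : 'rV[R]_n => 1 - cos (theta * z ord0 j)).
Proof.
move=> z; apply: (continuousB (@cst_continuous _ _ (1 : R) z)).
exact: (continuous_comp (@coord_continuous _ _ _ ord0 j z)
  (@continuous_cos_lin R theta _)).
Qed.

Lemma eventually_div_le (b d : R) : 0 < d ->
  exists N0, forall N, (N0 <= N)%N -> (0 < N)%N -> b / N%:R <= d.
Proof.
move=> d0; exists (Num.truncn (b / d)).+1 => N NN N0.
rewrite ler_pdivrMr ?ltr0n// -ler_pdivrMl// mulrC.
apply: ltW; apply: lt_le_trans (truncnS_gt _) _.
by rewrite ler_nat.
Qed.

(** By compactness of the box: near a point where the sum vanishes, [v] is
    below [e] by continuity, and near any other point the sum is bounded below,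
    so that a large [C] wins. *)
Lemma dominated_by_cos (v : 'rV[R]_n -> R) (theta L : R) :
  continuous v -> (exists M, forall z, v z <= M) ->
  (forall z, in_box L z -> (forall j, cos (theta * z ord0 j) = 1) -> v z <= 0) ->
  forall e, 0 < e -> exists2 C, 0 <= C & forall z, in_box L z ->
    v z <= e + C * \sum_j (1 - cos (theta * z ord0 j)).
Proof.
move=> cv [M vM] v0 e e0.
pose S (z : 'rV[R]_n) := \sum_j (1 - cos (theta * z ord0 j)).
have S0 z : 0 <= S z by apply: sumr_ge0 => j _; rewrite subr_ge0 cos_le1.
have cS : continuous S.
  by apply: continuous_sum_seq => j; exact: continuous_cos_coord.
have : \forall C \near +oo, [set z : 'rV[R]_n | in_box L z] `<=`
    (fun z => 0 <= C /\ v z <= e + C * S z).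
  have /compact_near_coveringP := @compact_in_box R n L; apply => z Lz.
  have [Sz0|Sz0] := eqVneq (S z) 0.
    have vz : v z < e.
      apply: le_lt_trans (v0 z Lz _) e0 => j.
      have nn i : true -> 0 <= 1 - cos (theta * z ord0 i).
        by rewrite subr_ge0 cos_le1.
      by apply/eqP; rewrite eq_sym -subr_eq0 (psumr_eq0P nn Sz0).
    exists ([set z | v z < e], [set C : R | 0 <= C]) => /=.
      split; first exact: (cvgr_lt _ (cv z) _ vz).
      by apply: nbhs_pinfty_ge; rewrite ?num_real.
    move=> [z' C] /= [h1 h2]; split=> //; apply: le_trans (ltW h1) _.
    by rewrite lerDl mulr_ge0.
  have Szp : 0 < S z / 2 by rewrite divr_gt0// lt_neqAle eq_sym Sz0 S0.
  exists ([set z' | S z / 2 < S z'], [set C | `|M| / (S z / 2) <= C]) => /=.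
    split; last by apply: nbhs_pinfty_ge; rewrite ?num_real.
    apply: (cvgr_gt _ (cS z)).
    by rewrite ltr_pdivrMr// ltr_pMr ?ltr1n// lt_neqAle eq_sym Sz0 S0.
  move=> [z' C] /= [h1 h2].
  have C0 : 0 <= C by apply: le_trans h2; rewrite divr_ge0// ltW.
  split=> //; apply: le_trans (vM _) _; apply: le_trans (ler_norm _) _.
  apply: ler_wpDl; first exact: ltW.
  by rewrite -ler_pdivrMr//; [apply: le_trans h2; rewrite ler_wpM2l// lef_pV2// ?posrE ?(lt_trans Szp)// ltW|exact: lt_trans h1].
move=> h; have [C hC] : exists C : R, [set z : 'rV[R]_n | in_box L z] `<=`
    (fun z => 0 <= C /\ v z <= e + C * S z).
  by have /filter_ex := h.
have [C0|C0] := leP 0 C; first by exists C => // z /hC[].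
exists 0 => // z /hC[]; by rewrite leNgt C0.
Qed.

Lemma continuous_fejer_kernel N theta : continuous (@fejer_kernel N theta).
Proof.
move=> x; rewrite /fejer_kernel; elim: (index_enum _) => [|j r IH].
  by under eq_fun do rewrite big_nil; exact: cst_continuous.
under eq_fun do rewrite big_cons; apply: (continuousM _ IH).
exact: (continuous_comp (@coord_continuous _ _ _ ord0 j x)
  (@continuous_fejer R N theta _)).
Qed.

Lemma fejer_kernel_ge0 N theta z : 0 <= fejer_kernel N theta z.
Proof. by apply: prodr_ge0 => j _; exact: fejer_ge0. Qed.

Definition hann_prod (W : R) (z : 'rV[R]_n) := \prod_j hann W (z ord0 j).

Lemma hann_prod_ge0 W z : 0 <= hann_prod W z.
Proof. by apply: prodr_ge0 => j _; exact: hann_ge0. Qed.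

Lemma boxed_cont_hann_prod W : 0 < W -> boxed_cont W (hann_prod W).
Proof.
move=> W0.
exact: (@boxed_cont_prod _ _ W (fun=> hann W) (fun=> boxed_cont1_hann W0)).
Qed.

Lemma boxed_cont1_hann_fejer N (W theta : R) : 0 < W ->
  boxed_cont1 W (fun t => hann W t * fejer N (theta * t)).
Proof.
move=> W0; exact: boxed_cont1M (boxed_cont1_hann W0) (@continuous_fejer R N theta).
Qed.

Lemma int_hann_prod_fejer N (theta W : R) (r : nat) : (0 < N)%N -> 0 < theta -> 0 < W ->
  theta * W = r%:R * (pi *+ 2) ->
  iter_integral (fun z => hann_prod W z * fejer_kernel N theta z) = W ^+ n.
Proof.
move=> N0 t0 W0 tW.
have -> : (fun z => hann_prod W z * fejer_kernel N theta z) =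
    (fun z => \prod_(j < n) (hann W (z ord0 j) * fejer N (theta * z ord0 j))).
  by apply/funext => z; rewrite big_split.
rewrite (@iter_integral_prod _ _ W (fun=> fun t => hann W t * fejer N (theta * t))).
  by rewrite (int_hann_fejer N0 t0 W0 tW) prodr_const card_ord.
by move=> j; exact: boxed_cont1_hann_fejer.
Qed.

Lemma int_hann_prod_fejer_cos N (theta W : R) (r : nat) j : (0 < N)%N -> 0 < theta -> 0 < W ->
  theta * W = r%:R * (pi *+ 2) ->
  iter_integral (fun z => hann_prod W z * fejer_kernel N theta z *
    (1 - cos (theta * z ord0 j))) <= (4 * W * W ^+ n.-1) / N%:R.
Proof.
move=> N0 t0 W0 tW.
pose g (t : R) := hann W t * ((1 - cos (theta * t)) * fejer N (theta * t)).
pose a (i : 'I_n) := if i == j then g else (fun t => hann W t * fejer N (theta * t)).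
have bg : boxed_cont1 W g.
  apply: boxed_cont1M; first exact: boxed_cont1_hann.
  move=> t; apply: (continuousM _ (@continuous_fejer _ N theta t)).
  exact: (continuousB (@cst_continuous _ _ (1 : R) t) (@continuous_cos_lin _ theta t)).
have -> : (fun z => hann_prod W z * fejer_kernel N theta z *
    (1 - cos (theta * z ord0 j))) = (fun z => \prod_(i < n) a i (z ord0 i)).
  apply/funext => z; rewrite /hann_prod /fejer_kernel -big_split /=.
  rewrite (bigD1 j)//= [RHS](bigD1 j)//= /a eqxx /g.
  have e (x y c P P' : R) : P = P' -> x * y * P * c = x * (c * y) * P'.
    by move=> ->; ring.
  by apply: e; apply: eq_bigr => i /negbTE ->.
rewrite (@iter_integral_prod _ _ W a); last first.
  by move=> i; rewrite /a; case: ifP => // _; exact: boxed_cont1_hann_fejer.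
rewrite (bigD1 j)//= {1}/a eqxx.
have -> : \prod_(i < n | i != j) \int[mu]_(t in setT) a i t = W ^+ n.-1.
  transitivity (\prod_(i < n | i != j) W).
    by apply: eq_bigr => i /negbTE ij; rewrite /a ij (int_hann_fejer N0 t0 W0 tW).
  rewrite prodr_const; congr (_ ^+ _).
  by have := cardC1 j; rewrite card_ord.
rewrite mulrAC ler_pM2r ?exprn_gt0//.
apply: le_trans (ler_norm _) _; exact: int_hann_fejer_cos.
Qed.

(** The factor 2 is the price for treating real and imaginary parts separately. *)
Lemma normc_cint_le (B : R) (u : cfun R n) (G : 'rV[R]_n -> R) :
  cboxed B u -> boxed_cont B G -> (forall z, normc (u z) <= G z) ->
  normc (cint u) <= 2 * iter_integral G.
Proof.
move=> bu bG uG; apply: le_trans (normc_le_ReIm _) _ => /=.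
have h f : boxed_cont B f -> (forall z, `|f z| <= G z) ->
    `|iter_integral f| <= iter_integral G.
  move=> bf fG; rewrite ler_norml; apply/andP; split.
    rewrite -mulN1r -(iter_integralZ _ bG); apply: (@le_iter_integral _ _ B) => //.
      exact: boxed_contZ.
    by move=> z; rewrite mulN1r; have := fG z; rewrite ler_norml => /andP[].
  apply: (@le_iter_integral _ _ B) => // z.
  exact: le_trans (ler_norm _) (fG z).
rewrite mulr2n mulrDl mul1r; apply: lerD; apply: h.
- exact: cboxed_Re.
- by move=> z; exact: le_trans (Re_le_normc _) (uG z).
- exact: cboxed_Im.
- by move=> z; exact: le_trans (Im_le_normc _) (uG z).
Qed.

Lemma continuous_normc (u : cfun R n) : ccont u -> continuous (fun z => normc (u z)).
Proof.
move=> [cr ci] z; apply/continuous_epsP => e e0.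
have e2 : 0 < e / 2 by rewrite divr_gt0.
have [d1 d10 h1] := (continuous_epsP _ _).1 (cr z) _ e2.
have [d2 d20 h2] := (continuous_epsP _ _).1 (ci z) _ e2.
exists (Num.min d1 d2) => [|y]; first by rewrite lt_min d10.
rewrite lt_min => /andP[/h1 k1 /h2 k2].
apply: le_lt_trans (_ : normc (u z - u y) < e).
  have h (a b : R[i]) : normc a <= normc b + normc (a - b).
    by have := le_normcD b (a - b); rewrite [b + _]addrC subrK.
  have := h (u z) (u y); have := h (u y) (u z).
  by rewrite [normc (u y - _)]normc_distC ler_norml; lra.
apply: le_lt_trans (normc_le_ReIm _) _.
by rewrite ReD ImD ReN ImN [e]splitr ltrD.
Qed.

(** The kernel concentrates at the zeros of
    [\sum_j (1 - cos (theta * z ord0 j))], where [v] vanishes: [v] is dominated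
    by a small constant plus a multiple of this sum. The box has a side of two
    periods; the window used to integrate the kernel has the larger half-width
    [2 * L], which keeps it bounded below on the box. *)
Lemma fejer_vanish (v : cfun R n) theta L : 0 < theta -> 0 < L ->
  theta * L = pi *+ 2 -> cboxed L v ->
  (forall z, in_box L z -> (forall j, cos (theta * z ord0 j) = 1) -> v z = 0) ->
  forall e, 0 < e -> exists N0, forall N, (N0 <= N)%N -> (0 < N)%N ->
    normc (cint (fun z => v z * (fejer_kernel N theta z)%:C)) <= e.
Proof.
move=> t0 L0 tL bv v0 e e0; pose W := 2 * L.
have W0 : 0 < W by rewrite mulr_gt0.
have tW : theta * W = 2%:R * (pi *+ 2) by rewrite /W mulrCA tL.
have LW : L <= W by rewrite ler_peMl ?ler1n// ltW.
have n2 : (0 : R) < 2 ^+ n by rewrite exprn_gt0.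
(* [2 ^+ n] compensates the lower bound [2^-1] of the window in each
   coordinate. *)
pose a := 2 * 2 ^+ n * W ^+ n.
have a0 : 0 < a by rewrite !mulr_gt0// exprn_gt0.
have ea : 0 < e / 2 / a by rewrite !divr_gt0.
have [M M0 vM] := cboxed_bounded bv.
have v0' z : in_box L z -> (forall j, cos (theta * z ord0 j) = 1) -> normc (v z) <= 0.
  by move=> Lz hz; rewrite (v0 z Lz hz) normc0.
have [C C0 hC] := @dominated_by_cos (fun z => normc (v z)) theta L
   (continuous_normc bv.1) (ex_intro _ M vM) v0' _ ea.
pose b := 2 * (2 ^+ n * C) * (n%:R * (4 * W * W ^+ n.-1)).
have b0 : 0 <= b by rewrite !mulr_ge0 ?exprn_ge0// ltW.
have e2 : 0 < e / 2 by rewrite divr_gt0.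
have [N1 hN1] := eventually_div_le b e2.
exists N1 => N NN N0; have bN := hN1 N NN N0.
pose H (z : 'rV[R]_n) := hann_prod W z * fejer_kernel N theta z.
have bH : boxed_cont W H.
  exact: boxed_contMr (boxed_cont_hann_prod W0) (@continuous_fejer_kernel N theta).
have bHc j : boxed_cont W (fun z => H z * (1 - cos (theta * z ord0 j))).
  exact: boxed_contMr bH (@continuous_cos_coord theta j).
have sumB (r : seq 'I_n) :
    boxed_cont W (fun z => \sum_(j <- r) H z * (1 - cos (theta * z ord0 j))) /\
    iter_integral (fun z => \sum_(j <- r) H z * (1 - cos (theta * z ord0 j))) =
    \sum_(j <- r) iter_integral (fun z => H z * (1 - cos (theta * z ord0 j))).
  elim: r => [|j r [h1 h2]].
    rewrite big_nil (_ : (fun z => _) = (fun=> 0)) ?iter_integral0; last first.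
      by apply/funext => z; rewrite big_nil.
    by split=> //; split=> // z; exact: cst_continuous.
  rewrite big_cons (_ : (fun z => _) = (fun z => H z * (1 - cos (theta * z ord0 j)) +
      \sum_(j <- r) H z * (1 - cos (theta * z ord0 j)))); last first.
    by apply/funext => z; rewrite big_cons.
  by split; [exact: boxed_contD|rewrite (iter_integralD (bHc j) h1) h2].
have [bS iS] := sumB (index_enum 'I_n).
pose G (z : 'rV[R]_n) := (2 ^+ n * (e / 2 / a)) * H z +
  (2 ^+ n * C) * \sum_j H z * (1 - cos (theta * z ord0 j)).
have bG : boxed_cont W G by apply: boxed_contD; exact: boxed_contZ.
have cK : ccont (fun z => (fejer_kernel N theta z)%:C : R[i]).
  by split=> z; [exact: continuous_fejer_kernel|exact: cst_continuous].
apply: (@le_trans _ _ (2 * iter_integral G)).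
  apply: (@normc_cint_le W) => //.
    by apply: cboxedMr => //; exact: cboxedW bv.
  move=> z; rewrite normcM normcZ ger0_norm ?fejer_kernel_ge0//.
  have S0 : 0 <= \sum_j (1 - cos (theta * z ord0 j)).
    by apply: sumr_ge0 => j _; rewrite subr_ge0 cos_le1.
  have K0 := fejer_kernel_ge0 N theta z.
  have GE : G z = (2 ^+ n * hann_prod W z) *
     (e / 2 / a + C * \sum_j (1 - cos (theta * z ord0 j))) * fejer_kernel N theta z.
    by rewrite /G -mulr_sumr /H; ring.
  have [Lz|nLz] := pselect (in_box L z); last first.
    rewrite bv.2// normc0 mul0r GE; apply: mulr_ge0 => //; apply: mulr_ge0.
      by apply: mulr_ge0; [exact: ltW|exact: hann_prod_ge0].
    by apply: addr_ge0; [exact: ltW|exact: mulr_ge0].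
  rewrite GE ler_wpM2r//; apply: le_trans (hC z Lz) _.
  apply: ler_peMl; first by apply: addr_ge0; [exact: ltW|exact: mulr_ge0].
  have -> : 2 ^+ n = \prod_(j < n) (2 : R) by rewrite prodr_const card_ord.
  rewrite /hann_prod -big_split /=.
  apply: (@le_trans _ _ (\prod_(j < n) (1 : R))); first by rewrite big1_eq.
  apply: ler_prod => j _; rewrite ler01/=.
  have : 2^-1 <= hann W (z ord0 j).
    apply: hann_half => //; have -> : W / 2 = L by rewrite /W; field.
    exact: Lz.
  by move=> h; rewrite -ler_pdivrMl// mulr1.
rewrite /G (@iter_integralD _ _ W); [|exact: boxed_contZ|exact: boxed_contZ].
rewrite !(@iter_integralZ _ _ W)// iS (int_hann_prod_fejer N0 t0 W0 tW).
have hS : \sum_j iter_integral (fun z => H z * (1 - cos (theta * z ord0 j))) <=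
    n%:R * (4 * W * W ^+ n.-1) / N%:R.
  apply: (@le_trans _ _ (\sum_(j < n) (4 * W * W ^+ n.-1) / N%:R)).
    by apply: ler_sum => j _; exact: int_hann_prod_fejer_cos N0 t0 W0 tW.
  by rewrite sumr_const card_ord -[_ *+ n]mulr_natl mulrA.
rewrite mulrDr [e]splitr; apply: lerD.
  rewrite le_eqVlt; apply/orP; left; apply/eqP; rewrite /a; field.
  by rewrite !gt_eqF ?exprn_gt0.
apply: le_trans bN; rewrite mulrA /b -[_ * _ / N%:R]mulrA ler_wpM2l//.
by rewrite !mulr_ge0// ltW.
Qed.

(** The Cesaro mean of the Fourier series is the integral of [u (z + x)]
    against the Fejer kernel. On the box of half-width one period [L], this
    kernel sees the lattice points with coordinates in [{- L, 0, L}]; the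
    hypothesis on [B] makes [u (z + x)] vanish at those other than 0.
    Subtracting [u x] times a window which is 1 at 0, vanishes at the other
    points, and against which the kernel has the integral [L ^+ n], reduces the
    claim to [fejer_vanish]. *)
Lemma fejer_inversion (u : cfun R n) theta B x : 0 < theta -> 0 <= B ->
  theta * (2 * B) < pi *+ 2 -> cboxed B u -> in_box B x ->
  forall e, 0 < e -> exists N0, forall N, (N0 <= N)%N -> (0 < N)%N ->
    normc ((N%:R^-1 ^+ n)%:C * (\sum_p \sum_q fourier u (freq theta (@index_diff N p q)) *
        expi (dotp x (freq theta (index_diff p q)))) -
      (((pi *+ 2) / theta) ^+ n)%:C * u x) <= e.
Proof.
move=> t0 B0 tB bu xB e e0; pose L : R := (pi *+ 2) / theta.
have L0 : 0 < L by rewrite divr_gt0// mulrn_wgt0// pi_gt0.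
have tL : theta * L = pi *+ 2 by rewrite /L mulrC divfK// gt_eqF.
have BL : 2 * B < L by rewrite /L ltr_pdivlMr// mulrC.
have tv : cboxed L (fun z => u (z + x)).
  have [[cr ci] u0] := bu.
  have nx : B + `|x| <= L.
    apply: le_trans (ltW BL); rewrite mulr2n mulrDl !mul1r lerD2l.
    exact: row_norm_le.
  have h1 := boxed_contW nx (boxed_cont_translate x (cboxed_Re bu)).
  have h2 := boxed_contW nx (boxed_cont_translate x (cboxed_Im bu)).
  split; first by split; [exact: h1.1|exact: h2.1].
  by move=> z nz; apply: complex_ext; [exact: h1.2|exact: h2.2].
have hv : cboxed L (fun z => (hann_prod L z)%:C : R[i]).
  have [h1 h2] := boxed_cont_hann_prod L0.
  split; last by move=> z /h2 ->.
  by split=> //= z; exact: cst_continuous.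
(* The second term makes the function vanish at 0, and contributes exactly
   [L ^+ n * u x]. *)
pose v (z : 'rV[R]_n) := u (z + x) + (- u x) * (hann_prod L z)%:C.
have bv : cboxed L v by apply: cboxedD => //; exact: cboxedZ.
have v0 z : in_box L z -> (forall j, cos (theta * z ord0 j) = 1) -> v z = 0.
  move=> Lz hz.
  have hj j : z ord0 j = 0 \/ `|z ord0 j| = L.
    have := @cos_eq1_2pi R (theta * z ord0 j) (hz j).
    rewrite normrM (gtr0_norm t0) -tL ler_pM2l// => /(_ (Lz j))[/eqP|/eqP].
      by rewrite mulf_eq0 (gt_eqF t0) => /eqP; left.
    by rewrite (inj_eq (mulfI (lt0r_neq0 t0))) => /eqP; right.
  have [/forallP h|] := boolP [forall j, z ord0 j == 0].
    have -> : z = 0 by apply/rowP => j; rewrite mxE; exact/eqP/h.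
    rewrite /v add0r /hann_prod big1 ?mulr1 ?subrr//.
    by move=> j _; rewrite mxE hann0.
  rewrite negb_forall => /existsP[j zj].
  have [/eqP|zL] := hj j; first by rewrite (negbTE zj).
  rewrite /v bu.2; last first.
    move=> /(_ j); rewrite mxE => h.
    have := ler_normB (z ord0 j + x ord0 j) (x ord0 j); rewrite addrK zL.
    by have := xB j; move: BL; lra.
  by rewrite /hann_prod (bigD1 j)//= hann_out ?zL// mul0r mulr0 addr0.
have [N0 hN] := fejer_vanish t0 L0 tL bv v0 e0.
exists N0 => N NN Np; have {hN} := hN N NN Np.
congr (normc _ <= e).
have cK : ccont (fun z => (fejer_kernel N theta z)%:C : R[i]).
  by split=> z; [exact: continuous_fejer_kernel|exact: cst_continuous].
have -> : (fun z => v z * (fejer_kernel N theta z)%:C) =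
  (fun z => u (z + x) * (fejer_kernel N theta z)%:C +
     (- u x) * ((hann_prod L z)%:C * (fejer_kernel N theta z)%:C)).
  by apply/funext => z; rewrite /v mulrDl mulrA.
rewrite (@cintD _ _ L); [|exact: cboxedMr|by apply: cboxedZ; exact: cboxedMr].
rewrite (@cintZ _ _ L); last exact: cboxedMr.
congr (_ + _); last first.
  rewrite mulNr mulrC; congr (- (_ * _)); rewrite /cint.
  under eq_fun do rewrite -rmorphM /=.
  under [X in _ +i* iter_integral X]eq_fun do rewrite -rmorphM /=.
  by rewrite iter_integral0 (@int_hann_prod_fejer _ _ _ 1)// ?mul1r.
pose F (pq : {ffun 'I_n -> 'I_N} * {ffun 'I_n -> 'I_N}) :=
  freq theta (index_diff pq.1 pq.2).
have -> : (fun z => u (z + x) * (fejer_kernel N theta z)%:C) =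
  (fun z => (N%:R^-1 ^+ n)%:C *
     \sum_(pq : {ffun 'I_n -> 'I_N} * {ffun 'I_n -> 'I_N})
         expi (dotp x (F pq)) * (u (z + x) * expi (- dotp (z + x) (F pq)))).
  apply/funext => z; rewrite fejer_kernelE pair_big /= mulrCA; congr (_ * _).
  rewrite mulr_sumr; apply: eq_bigr => pq _; rewrite mulrCA -expiD; congr (_ * expi _).
  by rewrite dotpDl opprD addrCA subrr addr0.
have bF pq : cboxed L (fun z => u (z + x) * expi (- dotp (z + x) (F pq))).
  apply: cboxedMr => //.
  have -> : (fun z => expi (- dotp (z + x) (F pq))) =
     (fun z => expi (- dotp z (F pq)) * expi (- dotp x (F pq))).
    by apply/funext => z; rewrite dotpDl opprD expiD.
  by apply: ccontM; [exact: ccont_kernel|exact: ccont_cst].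
have bF' pq : cboxed L (fun z => expi (dotp x (F pq)) *
   (u (z + x) * expi (- dotp (z + x) (F pq)))) by exact: cboxedZ.
rewrite (@cintZ _ _ L); last exact: cboxed_sum.
rewrite (@cint_sum _ _ L)// pair_big /=; congr (_ * _).
apply: eq_bigr => pq _; rewrite (@cintZ _ _ L)// mulrC; congr (_ * _).
have bk := cboxed_kernel (F pq) bu.
by rewrite (cint_translate x bk) -fourierE.
Qed.

End Fejer.

(** * Unordered sums and weights on a lattice *)

Section UnorderedSum.
Local Open Scope complex_scope.
Context {R : realType} {T : choiceType}.
Implicit Types (c : T -> R[i]) (f : T -> R) (s S : seq T).

Lemma ler_sum_uniq f s S : (forall k, 0 <= f k) -> uniq s -> uniq S ->
  {subset s <= S} -> \sum_(k <- s) f k <= \sum_(k <- S) f k.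
Proof.
move=> f0 us uS sS.
have pe : perm_eq [seq k <- S | k \in s] s.
  apply: uniq_perm => //; first exact: filter_uniq.
  by move=> k; rewrite mem_filter; apply/andP/idP => [[]|ks]//; split=> //; exact: sS.
rewrite [leRHS](bigID (mem s)) /= -[X in _ <= X + _]big_filter (perm_big _ pe) /=.
by rewrite lerDl sumr_ge0.
Qed.

Definition summable_by (W : R) f := forall s, uniq s -> \sum_(k <- s) f k <= W.

Definition finite_sums f : set R := [set x | exists2 s, uniq s & x = \sum_(k <- s) f k].

Lemma finite_sums_sup W f : summable_by W f -> has_sup (finite_sums f).
Proof.
move=> fW; split; first by exists 0, [::] => //; rewrite big_nil.
by exists W => x [s us ->]; exact: fW.
Qed.

Lemma summable_tail W f : (forall k, 0 <= f k) -> summable_by W f ->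
  forall e, 0 < e -> exists2 S, uniq S &
    forall s, uniq s -> (forall k, k \in s -> k \notin S) -> \sum_(k <- s) f k <= e.
Proof.
move=> f0 fW e e0.
have [x [S uS ->] hS] := sup_adherent e0 (finite_sums_sup fW).
exists S => // s us sS.
have : \sum_(k <- S ++ s) f k <= sup (finite_sums f).
  apply: ub_le_sup; first exact: (finite_sums_sup fW).2.
  exists (S ++ s) => //; rewrite cat_uniq uS us andbT /=.
  by apply/hasPn => k /sS.
by rewrite big_cat /=; lra.
Qed.

Definition is_usum c (l : R[i]) := forall e, 0 < e -> exists2 S, uniq S &
  forall s, uniq s -> {subset S <= s} -> normc (l - \sum_(k <- s) c k) <= e.

Definition pos_part (x : R) := Num.max x 0.

(** Built from suprema, the sum is a total function of the family; it is the
    expected one as soon as the family is absolutely summable. *)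
Definition usum c : R[i] :=
  (sup (finite_sums (fun k => pos_part (complex.Re (c k)))) -
   sup (finite_sums (fun k => pos_part (- complex.Re (c k))))) +i*
  (sup (finite_sums (fun k => pos_part (complex.Im (c k)))) -
   sup (finite_sums (fun k => pos_part (- complex.Im (c k))))).

Lemma pos_part_ge0 x : 0 <= pos_part x.
Proof. by rewrite le_max lexx orbT. Qed.

Lemma pos_partB x : x = pos_part x - pos_part (- x).
Proof.
rewrite /pos_part; have [x0|x0] := leP 0 x.
  by rewrite max_r ?subr0// oppr_le0.
by rewrite max_l ?sub0r ?opprK// oppr_ge0 ltW.
Qed.

Lemma pos_part_le x : pos_part x <= `|x|.
Proof. by rewrite ge_max ler_norm normr_ge0. Qed.

Lemma sup_finite_sums W f : (forall k, 0 <= f k) -> summable_by W f ->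
  forall e, 0 < e -> exists2 S, uniq S & forall s, uniq s -> {subset S <= s} ->
    `|sup (finite_sums f) - \sum_(k <- s) f k| <= e.
Proof.
move=> f0 fW e e0.
have [x [S uS ->] hS] := sup_adherent e0 (finite_sums_sup fW).
exists S => // s us Ss.
have h1 : \sum_(k <- s) f k <= sup (finite_sums f).
  apply: ub_le_sup; first exact: (finite_sums_sup fW).2.
  by exists s.
have := ler_sum_uniq f0 uS us Ss.
by rewrite ger0_norm ?subr_ge0//; lra.
Qed.

Lemma summable_byW W f g : (forall k, f k <= g k) -> summable_by W g -> summable_by W f.
Proof. by move=> fg gW s us; apply: le_trans (gW s us); apply: ler_sum. Qed.

Lemma usumP W c : summable_by W (fun k => normc (c k)) -> is_usum c (usum c).
Proof.
move=> cW e e0; have e4 : 0 < e / 2 / 2 by rewrite !divr_gt0.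
have part (g : R[i] -> R) : (forall z, `|g z| <= normc z) ->
    exists2 S, uniq S & forall s, uniq s -> {subset S <= s} ->
    `|sup (finite_sums (fun k => pos_part (g (c k)))) -
      sup (finite_sums (fun k => pos_part (- g (c k)))) -
      \sum_(k <- s) g (c k)| <= e / 2.
  move=> gn.
  have [S1 u1 h1] : exists2 S, uniq S & forall s, uniq s -> {subset S <= s} ->
      `|sup (finite_sums (fun k => pos_part (g (c k)))) -
        \sum_(k <- s) pos_part (g (c k))| <= e / 2 / 2.
    apply: (@sup_finite_sums W) => //; first by move=> k; exact: pos_part_ge0.
    by apply: summable_byW cW => k; exact: le_trans (pos_part_le _) (gn (c k)).
  have [S2 u2 h2] : exists2 S, uniq S & forall s, uniq s -> {subset S <= s} ->
      `|sup (finite_sums (fun k => pos_part (- g (c k)))) -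
        \sum_(k <- s) pos_part (- g (c k))| <= e / 2 / 2.
    apply: (@sup_finite_sums W) => //; first by move=> k; exact: pos_part_ge0.
    apply: summable_byW cW => k; apply: le_trans (pos_part_le _) _.
    by rewrite normrN; exact: gn.
  exists (undup (S1 ++ S2)); first exact: undup_uniq.
  move=> s us Ss.
  have s1 : {subset S1 <= s} by move=> k hk; apply: Ss; rewrite mem_undup mem_cat hk.
  have s2 : {subset S2 <= s}.
    by move=> k hk; apply: Ss; rewrite mem_undup mem_cat hk orbT.
  have {}h1 := h1 s us s1; have {}h2 := h2 s us s2.
  under eq_bigr do rewrite [g _]pos_partB.
  have e2 (a b p q : R) : a - b - (p - q) = (a - p) - (b - q) by ring.
  by rewrite sumrB e2 [e / 2]splitr; apply: le_trans (ler_normB _ _) (lerD h1 h2).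
have [S1 u1 h1] := part (@complex.Re R) (@Re_le_normc R).
have [S2 u2 h2] := part (@complex.Im R) (@Im_le_normc R).
exists (undup (S1 ++ S2)); first exact: undup_uniq.
move=> s us Ss.
have s1 : {subset S1 <= s} by move=> k hk; apply: Ss; rewrite mem_undup mem_cat hk.
have s2 : {subset S2 <= s}.
  by move=> k hk; apply: Ss; rewrite mem_undup mem_cat hk orbT.
apply: le_trans (normc_le_ReIm _) _.
rewrite ReD ImD ReN ImN Re_sum Im_sum [leRHS]splitr.
by apply: lerD; [exact: h1|exact: h2].
Qed.

Lemma is_usum_bound c l W : is_usum c l ->
  (forall s, uniq s -> normc (\sum_(k <- s) c k) <= W) -> normc l <= W.
Proof.
move=> cl cW; apply/ler_addgt0Pl => e /cl[S uS /(_ S uS) h].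
have {}h := h (fun k => id).
by have := le_normcD (l - \sum_(k <- S) c k) (\sum_(k <- S) c k); rewrite subrK; have := cW S uS; lra.
Qed.

Lemma is_usumD c1 c2 l1 l2 : is_usum c1 l1 -> is_usum c2 l2 ->
  is_usum (fun k => c1 k + c2 k) (l1 + l2).
Proof.
move=> h1 h2 e e0; have e2 : 0 < e / 2 by rewrite divr_gt0.
have [S1 u1 {}h1] := h1 _ e2; have [S2 u2 {}h2] := h2 _ e2.
exists (undup (S1 ++ S2)); first exact: undup_uniq.
move=> s us Ss; rewrite big_split /= opprD addrACA [e]splitr.
apply: le_trans (le_normcD _ _) (lerD _ _).
  by apply: h1 => // k hk; apply: Ss; rewrite mem_undup mem_cat hk.
by apply: h2 => // k hk; apply: Ss; rewrite mem_undup mem_cat hk orbT.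
Qed.

Lemma is_usumZ a c l : is_usum c l -> is_usum (fun k => a * c k) (a * l).
Proof.
move=> h e e0; have a1 : 0 < normc a + 1 by rewrite ltr_wpDl// normc_ge0.
have e2 : 0 < e / (normc a + 1) by rewrite divr_gt0.
have [S uS {}h] := h _ e2; exists S => // s us Ss.
rewrite -mulr_sumr -mulrBr normcM.
apply: (@le_trans _ _ ((normc a + 1) * normc (l - \sum_(k <- s) c k))).
  by rewrite ler_wpM2r ?normc_ge0// lerDl.
by rewrite -ler_pdivlMl// mulrC; exact: h.
Qed.

(** The finite set [S] depends on the dominating family [f] only: it
    approximates uniformly all the families dominated by [f]. *)
Lemma is_usum_tail c l (f : T -> R) S e : is_usum c l -> uniq S ->
  (forall s, uniq s -> (forall k, k \in s -> k \notin S) -> \sum_(k <- s) f k <= e) ->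
  (forall k, normc (c k) <= f k) ->
  normc (l - \sum_(k <- S) c k) <= e.
Proof.
move=> cl uS hS cf; apply/ler_addgt0Pl => d /cl[S' uS' h].
pose s := undup (S' ++ S).
have us : uniq s := undup_uniq _.
have {}h : normc (l - \sum_(k <- s) c k) <= d.
  by apply: h => // k hk; rewrite mem_undup mem_cat hk.
have pe : perm_eq [seq k <- s | k \in S] S.
  apply: uniq_perm => //; first exact: filter_uniq.
  by move=> k; rewrite mem_filter mem_undup mem_cat; case: (k \in S); rewrite ?orbT.
have e1 : \sum_(k <- s) c k - \sum_(k <- S) c k = \sum_(k <- [seq k <- s | k \notin S]) c k.
  rewrite [in LHS](bigID (mem S)) /= -[X in X + _ - _]big_filter (perm_big _ pe) /=.
  by rewrite addrC addKr big_filter.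
have h2 : normc (\sum_(k <- s) c k - \sum_(k <- S) c k) <= e.
  rewrite e1; apply: le_trans (normc_sum _ _ _) _.
  apply: (@le_trans _ _ (\sum_(k <- [seq k <- s | k \notin S]) f k)); first exact: ler_sum.
  apply: hS; first exact: filter_uniq.
  by move=> k; rewrite mem_filter => /andP[].
have -> : l - \sum_(k <- S) c k =
   (l - \sum_(k <- s) c k) + (\sum_(k <- s) c k - \sum_(k <- S) c k) by ring.
exact: le_trans (le_normcD _ _) (lerD h h2).
Qed.

End UnorderedSum.

Section LatticeSum.
Local Open Scope complex_scope.
Context {R : realType} {n : nat}.
Local Notation index := {ffun 'I_n -> int}.

Lemma sum_inv_sqr (m : nat) :
  \sum_(i < m) (1 + (i%:R : R) ^+ 2)^-1 <= 3.
Proof.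
suff h : forall m, \sum_(i < m.+1) (1 + (i%:R : R) ^+ 2)^-1 <= 3 - 2 / m.+1%:R.
  case: m => [|m]; first by rewrite big_ord0.
  by apply: le_trans (h m) _; rewrite gerBl divr_ge0.
elim=> [|k IH]; first by rewrite big_ord1 expr0n addr0 invr1; lra.
rewrite big_ord_recr /=; apply: le_trans (lerD IH (lexx _)) _.
have k0 : (0 : R) < k.+1%:R by rewrite ltr0n.
have k2 : (k.+2%:R : R) = k.+1%:R + 1 by rewrite natr1.
have -> : 3 - 2 / k.+2%:R = 3 - 2 / k.+1%:R + (k.+1%:R * k.+2%:R / 2)^-1 :> R.
  rewrite k2; field; rewrite !gt_eqF//; lra.
rewrite lerD2l lef_pV2 ?posrE; [|nra|]; last by rewrite !mulr_gt0 ?ltr0n ?invr_gt0.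
have : (1 : R) <= k.+1%:R by rewrite ler1n.
rewrite k2; nra.
Qed.

Definition inv_sqr (x : R) := (1 + x ^+ 2)^-1.

Lemma inv_sqr_gt0 x : 0 < inv_sqr x.
Proof. by rewrite invr_gt0 ltr_wpDr ?sqr_ge0. Qed.

Lemma inv_sqr_ge0 x : 0 <= inv_sqr x. Proof. exact/ltW/inv_sqr_gt0. Qed.

Definition weight (xi : 'rV[R]_n) := \prod_j inv_sqr (xi ord0 j).

Lemma weight_gt0 xi : 0 < weight xi.
Proof. by apply: prodr_gt0 => j _; exact: inv_sqr_gt0. Qed.

Lemma weightN xi : weight (- xi) = weight xi.
Proof. by apply: eq_bigr => j _; rewrite mxE /inv_sqr sqrrN. Qed.

(** A finite type which covers the integers of absolute value less than [D], so
    that sums over cubes of the lattice factorise over the coordinates. *)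
Definition int_of_sum D (a : 'I_D + 'I_D) : int :=
  match a with inl i => Posz i | inr i => Negz i end.

Lemma int_of_sumP D (m : int) : (`|m| < D)%N -> exists a : 'I_D + 'I_D, m = int_of_sum a.
Proof.
case: m => k /= h; first by exists (inl (Ordinal h)).
by exists (inr (Ordinal (ltnW h))).
Qed.

Lemma int_of_sum_inj D : injective (@int_of_sum D).
Proof. by move=> [i|i] [j|j] //= [/val_inj ->]. Qed.

Lemma seq_index_bound (s : seq index) :
  exists D, forall k j, k \in s -> (`|k j| < D)%N.
Proof.
elim: s => [|k s [D hD]]; first by exists 0%N.
exists (maxn D (\max_j `|k j|%N).+1) => k' j; rewrite inE => /predU1P[->|/hD h].
  by rewrite leq_max ltnS (leq_bigmax j) orbT.
by rewrite leq_max h.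
Qed.

Lemma summable_inv_sqr :
  summable_by (6 ^+ n) (fun k : index => \prod_j inv_sqr (k j)%:~R).
Proof.
move=> s us; have [D hD] := seq_index_bound s.
(* The finitely many indices of [s] lie in a cube, over which the sum is a
   product of sums. *)
pose emb (f : {ffun 'I_n -> 'I_D + 'I_D}) : index := [ffun j => int_of_sum (f j)].
have emb_inj : injective emb.
  move=> f g /ffunP h; apply/ffunP => j; have := h j; rewrite !ffunE.
  exact: int_of_sum_inj.
have k0 (k : index) : 0 <= \prod_j inv_sqr ((k j)%:~R : R).
  by apply: prodr_ge0 => j _; exact: inv_sqr_ge0.
apply: le_trans (ler_sum_uniq (S := [seq emb f | f <- index_enum _]) k0 us _ _) _.
- by rewrite map_inj_uniq// index_enum_uniq.
- move=> k ks; apply/mapP.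
  have h j : {a : 'I_D + 'I_D | k j = int_of_sum a}.
    exact/cid/int_of_sumP/hD.
  exists [ffun j => projT1 (h j)]; first exact: mem_index_enum.
  by apply/ffunP => j; rewrite !ffunE; exact: projT2 (h j).
rewrite big_map.
under eq_bigr do under eq_bigr do rewrite ffunE.
rewrite -(bigA_distr_bigA (fun (j : 'I_n) (a : 'I_D + 'I_D) => inv_sqr (int_of_sum a)%:~R)) /=.
rewrite prodr_const card_ord lerXn2r ?nnegrE//.
  by apply: sumr_ge0 => a _; exact: inv_sqr_ge0.
rewrite big_sumType /= (_ : 6 = 3 + 3 :> R); last by ring.
apply: lerD; first exact: sum_inv_sqr.
apply: le_trans (sum_inv_sqr D); apply: ler_sum => i _.
rewrite /inv_sqr NegzE rmorphN sqrrN /= lef_pV2 ?posrE ?ltr_wpDr ?sqr_ge0// lerD2l.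
by rewrite -pmulrn lerXn2r ?nnegrE// ler_nat.
Qed.

(** Subtracting the integer part of [xi / theta] from the index compares the
    family with the one centred at 0, up to a factor that does not depend on
    [xi]. *)
Lemma summable_weight (theta : R) : 0 < theta -> theta <= 1 ->
  exists2 W, 0 < W & forall xi, summable_by W (fun k : index => weight (xi - freq theta k)).
Proof.
move=> t0 t1; pose C := (3 / theta ^+ 2) ^+ n; pose W := C * 6 ^+ n.
have C0 : 0 < C by rewrite exprn_gt0// divr_gt0// exprn_gt0.
exists W => [|xi s us]; first by rewrite mulr_gt0// exprn_gt0.
(* Shifting the index by [m] brings the centre of the weight within distance 1
   of the origin. *)
pose m : index := [ffun j => Num.floor (xi ord0 j / theta)].
pose sh (k : index) : index := [ffun j => k j - m j].
have sh_inj : injective sh.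
  move=> k k' /ffunP h; apply/ffunP => j; have := h j; rewrite !ffunE.
  exact: addIr.
have hs := @summable_inv_sqr [seq sh k | k <- s].
rewrite map_inj_uniq// in hs; have {hs} := hs us; rewrite big_map => hs.
apply: le_trans (ler_wpM2l (ltW C0) hs).
rewrite mulr_sumr; apply: ler_sum => k _.
rewrite /weight /C.
have -> : (3 / theta ^+ 2) ^+ n = \prod_(j < n) (3 / theta ^+ 2).
  by rewrite prodr_const card_ord.
rewrite -big_split /=; apply: ler_prod => j _; rewrite inv_sqr_ge0 /=.
rewrite !mxE !ffunE /inv_sqr.
set x := xi ord0 j; set y := x / theta.
have -> : x = theta * y by rewrite /y mulrC divfK// gt_eqF.
rewrite -mulrBr exprMn rmorphB /=.
set a : R := (k j)%:~R; set b : R := (Num.floor y)%:~R.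
have yb0 : 0 <= y - b by rewrite subr_ge0 ge_floor.
have yb1 : y - b <= 1.
  by rewrite lerBlDr addrC -[1]/(1%:~R) -intrD ltW// floorD1_gt.
have tt : 0 < theta ^+ 2 by rewrite exprn_gt0.
have tt1 : theta ^+ 2 <= 1 by rewrite exprn_ile1// ltW.
have p1 : 0 < 1 + (a - b) ^+ 2 by rewrite ltr_wpDr ?sqr_ge0.
have p2 : 0 < 1 + theta ^+ 2 * (y - a) ^+ 2.
  by rewrite ltr_wpDr// mulr_ge0 ?sqr_ge0// ltW.
have -> : 3 / theta ^+ 2 * (1 + (a - b) ^+ 2)^-1 =
   (theta ^+ 2 * (1 + (a - b) ^+ 2) / 3)^-1 by field; rewrite !gt_eqF.
rewrite lef_pV2 ?posrE//; last by rewrite divr_gt0// mulr_gt0.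
rewrite ler_pdivrMr//.
have h : 1 + (a - b) ^+ 2 <= 3 * (1 + (y - a) ^+ 2).
  have -> : a - b = (y - b) - (y - a) by ring.
  have : 0 <= ((y - b) + (y - a)) ^+ 2 by rewrite sqr_ge0.
  have : (y - b) ^+ 2 <= 1 by rewrite exprn_ile1.
  have := sqr_ge0 (y - a).
  nra.
apply: le_trans (ler_wpM2l (ltW tt) h) _.
by rewrite mulrCA [leRHS]mulrC ler_wpM2l// mulrDr mulr1 lerD2r.
Qed.

End LatticeSum.

(** * Fourier series *)

Section FourierSeries.
Local Open Scope complex_scope.
Context {R : realType} {n : nat}.
Local Notation index := {ffun 'I_n -> int}.

Definition leaves (N : nat) (m : int) (a : nat) : bool :=
  ~~ ((0 <= a%:Z + m) && (a%:Z + m < N%:Z))%R.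

Lemma count_leaves N m : (\sum_(a < N) leaves N m a <= 2 * `|m|)%N.
Proof.
have -> : (\sum_(a < N) leaves N m a = count (leaves N m) (iota 0 N))%N.
  have -> : iota 0 N = index_iota 0 N by rewrite /index_iota subn0.
  rewrite -sum1_count [RHS]big_mkcond big_mkord.
  by apply: eq_bigr => a _; case: (leaves _ _ _).
rewrite -size_filter.
apply: leq_trans (uniq_leq_size (s2 := iota 0 `|m| ++ iota (N - `|m|) `|m|) _ _) _.
- by rewrite filter_uniq// iota_uniq.
- move=> a; rewrite mem_filter mem_cat !mem_iota /leaves /= add0n => /andP[h aN].
  apply/orP; move: h aN; lia.
- by rewrite size_cat !size_iota mul2n addnn.
Qed.

Lemma index_diff_inj N (p : {ffun 'I_n -> 'I_N}) : injective (index_diff p).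
Proof.
move=> q q' /ffunP h; apply/ffunP => j; apply: val_inj.
by have := h j; rewrite !ffunE => /addIr[].
Qed.

Lemma index_diff_onto N (p : {ffun 'I_n -> 'I_N}) (k : index) :
  (forall j, ~~ leaves N (k j) (p j)) -> exists q, k = index_diff p q.
Proof.
move=> h.
have hq j : (`|((p j : nat)%:Z + k j)%R| < N)%N.
  by have := h j; rewrite /leaves negbK => /andP[]; lia.
exists [ffun j => Ordinal (hq j)]; apply/ffunP => j; rewrite !ffunE /=.
by have := h j; rewrite /leaves negbK => /andP[]; lia.
Qed.

Lemma mean_leaves N (m : int) (j : 'I_n) : (0 < N)%N ->
  N%:R^-1 ^+ n * \sum_(p : {ffun 'I_n -> 'I_N}) (leaves N m (p j))%:R <=
  (2 * `|m|)%N%:R / N%:R :> R.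
Proof.
move=> N0; have N0' : (0 : R) < N%:R by rewrite ltr0n.
pose F (i : 'I_n) (a : 'I_N) : R := if i == j then (leaves N m a)%:R else 1.
have -> : \sum_(p : {ffun 'I_n -> 'I_N}) (leaves N m (p j))%:R =
    \sum_(p : {ffun 'I_n -> 'I_N}) \prod_i F i (p i).
  apply: eq_bigr => p _; rewrite (bigD1 j)//= /F eqxx big1 ?mulr1//.
  by move=> i /negbTE ->.
rewrite -(bigA_distr_bigA F) (bigD1 j)//= /F eqxx.
have -> : \prod_(i < n | i != j) \sum_(a < N) (if i == j then (leaves N m a)%:R else 1) =
    \prod_(i < n | i != j) (N%:R : R).
  by apply: eq_bigr => i /negbTE ->; rewrite sumr_const card_ord.
have -> : N%:R^-1 ^+ n = N%:R^-1 * \prod_(i < n | i != j) (N%:R^-1 : R).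
  transitivity (\prod_(i < n) (N%:R^-1 : R)); first by rewrite prodr_const card_ord.
  by rewrite (bigD1 j).
rewrite mulrACA -big_split /= [X in _ * X]big1 ?mulr1; last first.
  by move=> i _; rewrite mulVf// gt_eqF.
rewrite mulrC ler_pM2r ?invr_gt0// -natr_sum ler_nat.
exact: count_leaves.
Qed.

(** For a given index [k], the inner sum misses [k] only when [p + k] leaves
    the cube, and the proportion of such [p] tends to 0; absolute summability
    controls all but finitely many indices. *)
Lemma cesaro_usum (c : index -> R[i]) W l :
  summable_by W (fun k => normc (c k)) -> is_usum c l ->
  forall e, 0 < e -> exists N0, forall N, (N0 <= N)%N -> (0 < N)%N ->
    normc ((N%:R^-1 ^+ n)%:C * (\sum_p \sum_q c (@index_diff n N p q)) - l) <= e.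
Proof.
move=> cW cl e e0; have e4 : 0 < e / 4 by rewrite divr_gt0.
have c0 k : 0 <= normc (c k) by exact: normc_ge0.
have [S uS hS] := summable_tail c0 cW e4.
pose A := \sum_(k <- S) normc (c k) * \sum_j (2 * `|k j|)%N%:R.
have A0 : 0 <= A.
  by apply: sumr_ge0 => k _; rewrite mulr_ge0// sumr_ge0.
have [N1 hN1] := eventually_div_le A e4.
exists N1 => N NN N0; have AN := hN1 N NN N0.
have N0' : (0 : R) < N%:R by rewrite ltr0n.
pose D p := \sum_q c (@index_diff n N p q) - l.
pose miss (p : {ffun 'I_n -> 'I_N}) (k : index) : R := \sum_j (leaves N (k j) (p j))%:R.
have hD p : normc (D p) <= e / 2 + \sum_(k <- S) normc (c k) * miss p k.
  pose L := [seq index_diff p q | q <- index_enum {ffun 'I_n -> 'I_N}].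
  have uL : uniq L by rewrite map_inj_uniq ?index_enum_uniq//; exact: index_diff_inj.
  (* The inner sum ranges over [L], the approximate total over [S]. *)
  have -> : D p = (\sum_(k <- [seq k <- L | k \notin S]) c k -
      \sum_(k <- [seq k <- S | k \notin L]) c k) + (\sum_(k <- S) c k - l).
    rewrite /D; have -> : \sum_q c (index_diff p q) = \sum_(k <- L) c k by rewrite big_map.
    rewrite [\sum_(k <- L) _](bigID (mem S)) /= [\sum_(k <- S) _ - l]addrC.
    rewrite [\sum_(k <- S) c k](bigID (mem L)) /= !big_filter.
    have -> : \sum_(k <- L | k \in S) c k = \sum_(k <- S | k \in L) c k.
      rewrite -[LHS]big_filter -[RHS]big_filter; apply: perm_big.
      apply: uniq_perm; rewrite ?filter_uniq// => k.
      by rewrite !mem_filter andbC.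
    by ring.
  apply: le_trans (le_normcD _ _) _.
  have h3 : normc (\sum_(k <- S) c k - l) <= e / 4.
    by rewrite normc_distC; apply: is_usum_tail cl uS hS _.
  have h1 : normc (\sum_(k <- [seq k <- L | k \notin S]) c k) <= e / 4.
    apply: le_trans (normc_sum _ _ _) _; apply: hS; first exact: filter_uniq.
    by move=> k; rewrite mem_filter => /andP[].
  have h2 : normc (\sum_(k <- [seq k <- S | k \notin L]) c k) <=
      \sum_(k <- S) normc (c k) * miss p k.
    apply: le_trans (normc_sum _ _ _) _; rewrite big_filter big_mkcond /=.
    apply: ler_sum => k _; case: ifPn => kL; last first.
      by rewrite mulr_ge0// sumr_ge0.
    rewrite ler_peMr//.
    have [/forallP h|] := boolP [forall j, ~~ leaves N (k j) (p j)].
      have [q kq] := index_diff_onto h; case/negP: kL.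
      by rewrite kq; apply: map_f; exact: mem_index_enum.
    rewrite negb_forall => /existsP[j]; rewrite negbK => hj.
    by rewrite /miss (bigD1 j)//= hj lerDl sumr_ge0.
  apply: le_trans (lerD (le_normcD _ _) h3) _; rewrite normcN.
  have -> : e / 2 = e / 4 + e / 4 by field.
  by move: h1 h2; lra.
have cN : (#|{: {ffun 'I_n -> 'I_N}}|%:R : R) = N%:R ^+ n.
  by rewrite card_ffun !card_ord natrX.
have rN : (N%:R : R) ^+ n != 0 by rewrite expf_neq0// gt_eqF.
have -> : (N%:R^-1 ^+ n)%:C * (\sum_p \sum_q c (@index_diff n N p q)) - l =
    (N%:R^-1 ^+ n)%:C * \sum_p D p.
  rewrite /D sumrB mulrBr; congr (_ - _).
  rewrite sumr_const -[l *+ _]mulr_natl mulrA.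
  have -> : (#|{: {ffun 'I_n -> 'I_N}}|%:R : R[i]) = (N%:R ^+ n : R)%:C.
    by rewrite -cN rmorph_nat.
  by rewrite -rmorphM /= -exprMn mulVf ?expr1n ?mul1r// gt_eqF.
have iN0 : (0 : R) <= N%:R^-1 ^+ n by rewrite exprn_ge0// invr_ge0 ltW.
rewrite normcM normcZ ger0_norm//.
apply: le_trans (ler_wpM2l iN0 (normc_sum _ _ _)) _.
apply: le_trans (ler_wpM2l iN0 (ler_sum _ (fun p _ => hD p))) _.
rewrite big_split /= sumr_const -[(e / 2) *+ _]mulr_natl cN mulrDr.
have -> : N%:R^-1 ^+ n * (N%:R ^+ n * (e / 2)) = e / 2.
  by rewrite exprVn mulKf.
rewrite exchange_big /=.
apply: (@le_trans _ _ (e / 2 + e / 4)); last by lra.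
rewrite lerD2l.
apply: le_trans AN; rewrite /A mulr_sumr mulr_suml; apply: ler_sum => k _.
rewrite -mulr_sumr mulrCA -[_ * _ / _]mulrA ler_wpM2l//.
rewrite exchange_big /= mulr_sumr mulr_suml; apply: ler_sum => j _.
exact: mean_leaves.
Qed.

(** The Cesaro means of the series tend to its sum, since it is absolutely
    summable, and to the multiple of [u x] by Fejer's theorem. *)
Lemma fourier_series_inversion (u : cfun R n) theta B x W : 0 < theta -> 0 <= B ->
  theta * (2 * B) < pi *+ 2 -> cboxed B u -> in_box B x ->
  summable_by W (fun k => normc (fourier u (freq theta k))) ->
  is_usum (fun k => fourier u (freq theta k) * expi (dotp x (freq theta k)))
    ((((pi *+ 2) / theta) ^+ n)%:C * u x).
Proof.
move=> t0 B0 tB bu xB uW.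
set c := fun k => _.
have cW : summable_by W (fun k => normc (c k)).
  by apply: summable_byW uW => k; rewrite normcM normc_expi mulr1.
have cl := usumP cW.
suff <- : usum c = (((pi *+ 2) / theta) ^+ n)%:C * u x by [].
apply/eqP; rewrite -subr_eq0 -normc_eq0 eq_le normc_ge0 andbT.
apply/ler_addgt0Pl => e e0; rewrite addr0; have e2 : 0 < e / 2 by rewrite divr_gt0.
have [N1 h1] := cesaro_usum cW cl e2.
have [N2 h2] := fejer_inversion t0 B0 tB bu xB e2.
pose N := (maxn N1 N2).+1.
have {}h1 := h1 N (leq_trans (leq_maxl _ _) (leqnSn _)) isT.
have {}h2 := h2 N (leq_trans (leq_maxr _ _) (leqnSn _)) isT.
set l := usum c; set v := _%:C * u x.
set m := (_ * (\sum_p \sum_q _)) in h1.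
have -> : l - v = (m - v) - (m - l) by ring.
by rewrite [e]splitr; apply: le_trans (le_normcD _ _) _; rewrite normcN lerD.
Qed.

End FourierSeries.

(** * Multi-indices and trigonometric series *)

Section MultiIndex.
Local Open Scope complex_scope.
Context {R : realType} {n : nat}.

Definition mi_seq (al : multi_index n) : seq 'I_n :=
  flatten [seq nseq (al i) i | i <- enum 'I_n].

Lemma mderivE (al : multi_index n) (u : cfun R n) :
  mderiv al u = iter_pderiv (mi_seq al) u.
Proof.
rewrite /mderiv /mi_seq; elim: (enum 'I_n) => [|i r IH] //=.
rewrite /iter_pderiv foldr_cat -/(iter_pderiv _ u) -IH.
by elim: (al i) => [|k IHk] //=; rewrite -IHk.
Qed.

Lemma count_mi_seq al j : count_mem j (mi_seq al) = al j.
Proof.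
rewrite /mi_seq count_flatten -map_comp sumnE big_map.
rewrite (eq_bigr (fun i => if i == j then al i else 0%N)); last first.
  by move=> i _; rewrite /= count_nseq /=; case: eqP => _; rewrite ?mul1n.
by rewrite -big_mkcond big_enum_cond /= big_pred1_eq.
Qed.

Lemma size_mi_seq al : size (mi_seq al) = mi_size al.
Proof.
rewrite /mi_seq size_flatten /shape -map_comp sumnE big_map big_enum /=.
by apply: eq_bigr => i _; rewrite /= size_nseq.
Qed.

Definition ord_le : rel 'I_n := fun i j => (i <= j)%N.

Lemma mi_seq_sorted al : sorted ord_le (mi_seq al).
Proof.
rewrite sorted_pairwise; last by move=> i j k; exact: leq_trans.
have : pairwise (fun i j : 'I_n => (i < j)%N) (enum 'I_n).
  have := iota_ltn_sorted 0 n; rewrite -val_enum_ord sorted_map sorted_pairwise//.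
  by move=> i j k; exact: ltn_trans.
rewrite /mi_seq; elim: (enum 'I_n) => [|i r IH] //= /andP[ir /IH pr].
rewrite pairwise_cat pr andbT; apply/andP; split.
  apply/allrelP => x y /nseqP[-> _] /flattenP[z /mapP[j jr ->] /nseqP[-> _]].
  by apply: ltnW; move/allP: ir => /(_ j jr).
elim: (al i) => [|k IHk] //=; rewrite IHk andbT; apply/allP => y /nseqP[-> _].
exact: leqnn.
Qed.

(** A sorted sequence is determined by its multiplicities, so a subsequence of
    [mi_seq al] is the sequence of a multi-index; this translates the Leibniz
    formula into derivatives of the form [mderiv]. *)
Lemma subseq_mi_seq s al : subseq s (mi_seq al) ->
  s = mi_seq [ffun j => count_mem j s].
Proof.
move=> sal; apply: (@sorted_eq _ ord_le).
- by move=> i j k; exact: leq_trans.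
- by move=> i j h; apply: val_inj; apply/eqP; rewrite eqn_leq.
- by apply: subseq_sorted sal (mi_seq_sorted al) => i j k; exact: leq_trans.
- exact: mi_seq_sorted.
- by apply/allP => j _ /=; rewrite count_mi_seq ffunE.
Qed.

Lemma prod_mi_seq (a : 'I_n -> R) al : \prod_(i <- mi_seq al) a i = \prod_i a i ^+ al i.
Proof.
rewrite /mi_seq big_flatten big_map big_enum /=; apply: eq_bigr => i _.
by rewrite big_nseq iter_mulr_1.
Qed.

(** These are the multi-indices that appear when the monomial of [s] is
    multiplied by [\prod_j (1 + xi ord0 j ^+ 2)], the inverse of [weight xi]. *)
Definition double_index (s : seq 'I_n) (al : {ffun 'I_n -> bool}) : multi_index n :=
  [ffun j => (count_mem j s + 2 * al j)%N].

Lemma prod_seq_count (a : 'I_n -> R) s : \prod_(i <- s) a i = \prod_j a j ^+ count_mem j s.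
Proof.
elim: s => [|i s IH]; first by rewrite big_nil big1// => j _; rewrite expr0.
rewrite big_cons IH [RHS](bigD1 i)//= [X in _ * X = _](bigD1 i)//= eqxx add1n exprS mulrA.
by congr (_ * _); apply: eq_bigr => j ji; rewrite eq_sym (negbTE ji).
Qed.

Lemma weight_expand (xi : 'rV[R]_n) s :
  \prod_(i <- s) `|xi ord0 i| = weight xi *
  \sum_(al : {ffun 'I_n -> bool}) \prod_(i <- mi_seq (double_index s al)) `|xi ord0 i|.
Proof.
rewrite prod_seq_count.
have -> : \sum_(al : {ffun 'I_n -> bool})
      \prod_(i <- mi_seq (double_index s al)) `|xi ord0 i| =
    \sum_(al : {ffun 'I_n -> bool}) \prod_j
      (`|xi ord0 j| ^+ count_mem j s * (if al j then xi ord0 j ^+ 2 else 1)).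
  apply: eq_bigr => al _; rewrite prod_mi_seq; apply: eq_bigr => j _.
  rewrite ffunE exprD; congr (_ * _); case: (al j) => //.
  by rewrite real_normK ?num_real.
rewrite -(bigA_distr_bigA (fun j (b : bool) => `|xi ord0 j| ^+ count_mem j s *
  (if b then xi ord0 j ^+ 2 else 1))) /weight -big_split /=.
apply: eq_bigr => j _; rewrite big_bool /= mulr1 /inv_sqr.
have : 1 + xi ord0 j ^+ 2 != 0 by rewrite gt_eqF// ltr_wpDr// sqr_ge0.
by move: (xi ord0 j) => x x0; field.
Qed.

Lemma normc_fourier_iter_pderiv B (u : cfun R n) s (xi : 'rV[R]_n) : 0 <= B ->
  smooth_on setT u -> boxed B u ->
  normc (fourier (iter_pderiv s u) xi) = \prod_(i <- s) `|xi ord0 i| * normc (fourier u xi).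
Proof.
move=> B0 su bu; rewrite (@fourier_iter_pderiv _ _ B)// normcM normc_prod.
by congr (_ * _); apply: eq_bigr => i _; rewrite normcM normc_i mul1r normcZ.
Qed.

(** Multiplication by a monomial corresponds to a derivative: expanding the
    inverse of [weight xi] into monomials bounds the transform by the weight
    times finitely many derivatives. *)
Lemma fourier_weight_bound B (u : cfun R n) s (C : {ffun 'I_n -> bool} -> R)
    (xi : 'rV[R]_n) :
  0 <= B -> smooth_on setT u -> boxed B u ->
  (forall al x, normc (mderiv (double_index s al) u x) <= C al) ->
  \prod_(i <- s) `|xi ord0 i| * normc (fourier u xi) <=
  weight xi * ((\sum_al C al) * (2 * (2 * B) ^+ n)).
Proof.
move=> B0 su bu uC; rewrite weight_expand -mulrA ler_wpM2l ?(ltW (weight_gt0 _))//.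
rewrite !mulr_suml; apply: ler_sum => al _.
rewrite -(@normc_fourier_iter_pderiv B)// -mderivE.
have cu : cboxed B (mderiv (double_index s al) u).
  by rewrite mderivE; exact: cboxed_iter_pderiv.
exact: fourier_bound B0 cu (uC al).
Qed.

Lemma fourier_weight_ex B (u : cfun R n) s : 0 <= B -> smooth_on setT u -> boxed B u ->
  exists2 C, 0 <= C & forall xi : 'rV[R]_n,
  \prod_(i <- s) `|xi ord0 i| * normc (fourier u xi) <= C * weight xi.
Proof.
move=> B0 su bu.
have h al : {C : R | 0 <= C /\ forall x, normc (mderiv (double_index s al) u x) <= C}.
  apply/cid; rewrite mderivE.
  have [C C0 hC] := cboxed_bounded (cboxed_iter_pderiv (mi_seq (double_index s al)) su bu).
  by exists C.
exists ((\sum_al projT1 (h al)) * (2 * (2 * B) ^+ n)).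
  apply: mulr_ge0; first by apply: sumr_ge0 => al _; exact: (projT2 (h al)).1.
  by rewrite mulr_ge0// exprn_ge0// mulr_ge0.
move=> xi; rewrite mulrC mulrC [leRHS]mulrC.
by apply: fourier_weight_bound => // al x; exact: (projT2 (h al)).2.
Qed.

End MultiIndex.

Section TrigSeries.
Local Open Scope complex_scope.
Context {R : realType} {n : nat} (theta : R).
Local Notation index := {ffun 'I_n -> int}.
Local Notation fq := (@freq R n theta).

Definition trig_series (c : index -> R[i]) : cfun R n :=
  fun x => usum (fun k => c k * expi (dotp x (fq k))).

Definition rapid (c : index -> R[i]) := forall s : seq 'I_n, exists W,
  summable_by W (fun k => \prod_(i <- s) `|fq k ord0 i| * normc (c k)).

Lemma is_usum_trig c W x : summable_by W (fun k => normc (c k)) ->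
  is_usum (fun k => c k * expi (dotp x (fq k))) (trig_series c x).
Proof.
move=> cW; apply: (@usumP _ _ W); apply: summable_byW cW => k.
by rewrite normcM normc_expi mulr1.
Qed.

Lemma rapid_summable c : rapid c -> exists W, summable_by W (fun k => normc (c k)).
Proof.
move=> /(_ [::])[W hW]; exists W; apply: summable_byW hW => k.
by rewrite big_nil mul1r.
Qed.

Lemma trig_series_bound c W x : summable_by W (fun k => normc (c k)) ->
  normc (trig_series c x) <= W.
Proof.
move=> cW; apply: is_usum_bound (is_usum_trig x cW) _ => s us.
apply: le_trans (normc_sum _ _ _) _; apply: le_trans (cW s us).
by apply: ler_sum => k _; rewrite normcM normc_expi mulr1.
Qed.

Definition dcoef i (c : index -> R[i]) : index -> R[i] :=
  fun k => 'i * (fq k ord0 i)%:C * c k.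

Lemma rapid_dcoef i c : rapid c -> rapid (dcoef i c).
Proof.
move=> rc s; have [W hW] := rc (i :: s); exists W.
apply: summable_byW hW => k; rewrite big_cons /dcoef !normcM normc_i mul1r normcZ.
by rewrite mulrCA mulrA.
Qed.

(** Suited to series of functions: a quadratic remainder, uniform in the terms,
    passes to the sum and gives its derivative. *)
Lemma is_derive_of_quadratic (f : 'rV[R]_n -> R) x v d C :
  (forall h : R, `|f (h *: v + x) - f x - h * d| <= C * h ^+ 2) -> is_derive x v f d.
Proof.
move=> hf.
have c : h^-1 *: (f (h *: v + x) - f x) @[h --> (0:R)^'] --> d.
  apply/cvgrPdist_le => e e0.
  have C1 : 0 < `|C| + 1 by rewrite ltr_wpDl.
  near=> h.
  have h0 : h != 0 by near: h; exact: nbhs_dnbhs_neq.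
  have hs : `|h| <= e / (`|C| + 1).
    near: h; apply: dnbhs0_le; by rewrite divr_gt0.
  have -> : d - h^-1 *: (f (h *: v + x) - f x) =
      - (h^-1 * (f (h *: v + x) - f x - h * d)).
    by rewrite /GRing.scale /=; field.
  rewrite normrN normrM normfV.
  have nh : 0 < `|h| by rewrite normr_gt0.
  rewrite mulrC ler_pdivrMr//; apply: le_trans (hf h) _.
  rewrite -[h ^+ 2]real_normK ?num_real// expr2 mulrA ler_wpM2r//.
  apply: (@le_trans _ _ ((`|C| + 1) * `|h|)).
    by rewrite ler_wpM2r//; have := ler_norm C; lra.
  by rewrite -ler_pdivlMl// mulrC.
split; [apply/cvg_ex; exists d; exact: c|exact: cvg_lim c].
Unshelve. all: by end_near. Qed.

Lemma trig_series_diff c x y : rapid c ->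
  is_usum (fun k => c k * (expi (dotp y (fq k)) - expi (dotp x (fq k))))
    (trig_series c y - trig_series c x).
Proof.
move=> /rapid_summable[W hW].
have := is_usumD (is_usum_trig y hW) (is_usumZ (-1) (is_usum_trig x hW)).
rewrite mulN1r; congr is_usum; apply/funext => k; rewrite mulN1r mulrBr; ring.
Qed.

(** The second order Taylor remainder of the term of index [k] is of the order
    of [(h * fq k ord0 i) ^+ 2], and these bounds are summable against the
    coefficients. *)
Lemma is_pderiv_trig c x i : rapid c ->
  is_pderiv (trig_series c) x i (trig_series (dcoef i c) x).
Proof.
move=> rc; have [W2 hW2] := rc [:: i; i].
have [W1 hW1] := rapid_summable (rapid_dcoef i rc).
have key (h : R) : normc (trig_series c (h *: delta_mx ord0 i + x) - trig_series c x -
    h%:C * trig_series (dcoef i c) x) <= (2 * W2) * h ^+ 2.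
  have := is_usumD (trig_series_diff x (h *: delta_mx ord0 i + x) rc)
     (is_usumZ (- h%:C) (is_usum_trig x hW1)).
  rewrite mulNr => /is_usum_bound; apply=> s us.
  apply: le_trans (normc_sum _ _ _) _.
  apply: (@le_trans _ _ (\sum_(k <- s) 2 * h ^+ 2 *
     (\prod_(j <- [:: i; i]) `|fq k ord0 j| * normc (c k)))); last first.
    rewrite -mulr_sumr [leRHS]mulrAC ler_wpM2l//; first by rewrite mulr_ge0// sqr_ge0.
    exact: hW2.
  apply: ler_sum => k _; rewrite !big_cons big_nil mulr1.
  rewrite dotpDl dotpZl dotp_delta; set z := fq k ord0 i.
  have -> : c k * (expi (h * z + dotp x (fq k)) - expi (dotp x (fq k))) +
      - h%:C * (dcoef i c k * expi (dotp x (fq k))) =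
      c k * expi (dotp x (fq k)) * (expi (h * z) - 1 - 'i * (h * z)%:C).
    by rewrite /dcoef -/z expiD rmorphM /=; ring.
  rewrite !normcM normc_expi mulr1.
  apply: le_trans (ler_wpM2l (normc_ge0 _) (expi_taylor _)) _.
  rewrite exprMn -[z ^+ 2]real_normK ?num_real// le_eqVlt; apply/orP; left.
  by apply/eqP; rewrite /=; ring.
have key2 h : trig_series c (h *: delta_mx ord0 i + x) - trig_series c x -
    h%:C * trig_series (dcoef i c) x =
    (complex.Re (trig_series c (h *: delta_mx ord0 i + x)) - complex.Re (trig_series c x)
      - h * complex.Re (trig_series (dcoef i c) x)) +i*
    (complex.Im (trig_series c (h *: delta_mx ord0 i + x)) - complex.Im (trig_series c x)
      - h * complex.Im (trig_series (dcoef i c) x)).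
  by apply: complex_ext; rewrite /= ?(ReD, ImD, ReN, ImN, ReM, ImM) /= ?mul0r ?subr0 ?addr0.
split; apply: (@is_derive_of_quadratic _ _ _ _ (2 * W2)) => h.
  by apply: le_trans (key h); rewrite key2; exact: le_trans (Re_le_normc _).
by apply: le_trans (key h); rewrite key2; exact: le_trans (Im_le_normc _).
Qed.

Lemma trig_series_lip c : rapid c -> exists2 C, 0 < C & forall x y,
  normc (trig_series c y - trig_series c x) <= C * `|y - x|.
Proof.
move=> rc.
have h i : {W : R | summable_by W (fun k => \prod_(j <- [:: i]) `|fq k ord0 j| * normc (c k))}.
  exact/cid/rc.
pose C0 := 2 * \sum_i `|projT1 (h i)|.
have C00 : 0 <= C0 by rewrite mulr_ge0// sumr_ge0.
exists (C0 + 1) => [|x y]; first by rewrite ltr_wpDl.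
apply: is_usum_bound (trig_series_diff x y rc) _ => s us.
apply: le_trans (normc_sum _ _ _) _.
apply: (@le_trans _ _ (C0 * `|y - x|)); last by rewrite ler_wpM2r// lerDl.
apply: (@le_trans _ _ (\sum_(k <- s) 2 * `|y - x| * \sum_i (`|fq k ord0 i| * normc (c k)))).
  apply: ler_sum => k _; rewrite normcM.
  apply: le_trans (ler_wpM2l (normc_ge0 _) (expi_lip _ _)) _.
  have -> : dotp y (fq k) - dotp x (fq k) = dotp (y - x) (fq k).
    by rewrite dotpDl dotpNl.
  rewrite -mulr_suml mulrC -!mulrA ler_wpM2l// mulrA ler_wpM2r ?normc_ge0//.
  rewrite mulr_sumr; apply: le_trans (ler_norm_sum _ _ _) _.
  apply: ler_sum => i _; rewrite normrM ler_wpM2r//; exact: row_entry_le_norm.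
rewrite -mulr_sumr exchange_big /= /C0 -!mulrA ler_wpM2l// mulrC ler_wpM2r//.
apply: ler_sum => i _; apply: le_trans (ler_norm _).
have := projT2 (h i) s us; apply: le_trans; apply: ler_sum => k _.
by rewrite big_seq1.
Qed.

Lemma partials_trig c x : rapid c -> partials_at (trig_series c) x.
Proof.
move=> rc; have [C C0 hC] := trig_series_lip rc.
apply: (@partials_of _ _ _ _ (fun i => trig_series (dcoef i c) x)).
- apply/continuous_epsP => e e0; exists (e / C) => [|y xy]; first by rewrite divr_gt0.
  have := Re_le_normc (trig_series c x - trig_series c y); rewrite ReD ReN.
  move=> /le_lt_trans; apply; apply: le_lt_trans (hC y x) _.
  by rewrite -ltr_pdivlMl// mulrC.
- apply/continuous_epsP => e e0; exists (e / C) => [|y xy]; first by rewrite divr_gt0.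
  have := Im_le_normc (trig_series c x - trig_series c y); rewrite ImD ImN.
  move=> /le_lt_trans; apply; apply: le_lt_trans (hC y x) _.
  by rewrite -ltr_pdivlMl// mulrC.
- by move=> i; exact: is_pderiv_trig.
Qed.

Lemma pderiv_trig c i : rapid c -> pderiv i (trig_series c) = trig_series (dcoef i c).
Proof. by move=> rc; apply/funext => x; apply: is_pderiv_val; exact: is_pderiv_trig. Qed.

Lemma smooth_trig c : rapid c -> smooth_on setT (trig_series c).
Proof.
move=> rc; apply: (@smooth_of_stable _ _ [set v | exists2 c, rapid c & v = trig_series c]).
- by move=> v x [d rd ->]; exact: partials_trig.
- move=> v i [d rd ->]; exists (dcoef i d); first exact: rapid_dcoef.
  exact: pderiv_trig.
- by exists c.
Qed.

Lemma iter_pderiv_trig c s : rapid c ->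
  iter_pderiv s (trig_series c) = trig_series (foldr dcoef c s) /\ rapid (foldr dcoef c s).
Proof.
move=> rc; elim: s => [|i s [IH rs]] //=.
by rewrite IH pderiv_trig//; split=> //; exact: rapid_dcoef.
Qed.

Lemma iter_pderiv_trig_bound c s W x : rapid c ->
  summable_by W (fun k => \prod_(i <- s) `|fq k ord0 i| * normc (c k)) ->
  normc (iter_pderiv s (trig_series c) x) <= W.
Proof.
move=> rc hW; rewrite (iter_pderiv_trig s rc).1; apply: trig_series_bound.
apply: summable_byW hW => k; elim: s => [|i s IH] /=; first by rewrite big_nil mul1r.
rewrite big_cons {1}/dcoef !normcM normc_i mul1r normcZ -mulrA.
exact: ler_wpM2l.
Qed.

(** The series converges uniformly on the box, so it can be integrated term by
    term; multiplication by a character translates the Fourier transform. *)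
Lemma usum_fourierM (c : index -> R[i]) W B (g v : cfun R n) xi : 0 <= B ->
  summable_by W (fun k => normc (c k)) -> ccont g -> cboxed B v ->
  (forall x, in_box B x -> is_usum (fun k => c k * expi (dotp x (fq k))) (g x)) ->
  is_usum (fun k => c k * fourier v (xi - fq k)) (fourier (fun x => g x * v x) xi).
Proof.
move=> B0 cW cg bv hg e e0.
have [M M0 vM] := cboxed_bounded bv.
pose V := M * (2 * (2 * B) ^+ n) + 1.
have V0 : 0 < V by rewrite ltr_wpDl// !mulr_ge0// exprn_ge0// mulr_ge0.
have eV : 0 < e / V by rewrite divr_gt0.
have [S uS hS] := summable_tail (fun k => normc_ge0 (c k)) cW eV.
(* The set [S] approximates the sum of the moduli, hence the series uniformly
   on the box. *)
exists S => // s us Ss.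
have hs s' : uniq s' -> (forall k, k \in s' -> k \notin s) ->
    \sum_(k <- s') normc (c k) <= e / V.
  by move=> us' h; apply: hS => // k /h; apply: contra => /Ss.
pose P x := \sum_(k <- s) c k * expi (dotp x (fq k)).
have cP : ccont P.
  apply: ccont_sum => k; apply: ccontM; first exact: ccont_cst.
  by apply: ccont_expi; exact: continuous_dotp.
have bgv : cboxed B (fun x => g x * v x * expi (- dotp x xi)).
  apply: cboxedMr; last exact: ccont_kernel.
  by have := cboxedMr bv cg; congr cboxed; apply/funext => x; rewrite mulrC.
have bk k : cboxed B (fun x => v x * expi (- dotp x (xi - fq k))).
  exact: cboxed_kernel.
have bs : cboxed B (fun x => \sum_(k <- s) (- c k) * (v x * expi (- dotp x (xi - fq k)))).
  by apply: cboxed_sum => k; exact: cboxedZ.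
have -> : fourier (fun x => g x * v x) xi - \sum_(k <- s) c k * fourier v (xi - fq k) =
    cint (fun x => (g x - P x) * (v x * expi (- dotp x xi))).
  have -> : (fun x => (g x - P x) * (v x * expi (- dotp x xi))) =
    (fun x => g x * v x * expi (- dotp x xi) +
      \sum_(k <- s) (- c k) * (v x * expi (- dotp x (xi - fq k)))).
    apply/funext => x; rewrite mulrBl mulrA; congr (_ + _).
    rewrite /P mulr_suml -sumrN; apply: eq_bigr => k _.
    have -> : expi (- dotp x (xi - fq k)) = expi (- dotp x xi) * expi (dotp x (fq k)).
      by rewrite -expiD dotpDr dotpNr opprB addrC.
    by ring.
  rewrite (cintD bgv bs) -fourierE (@cint_sum _ _ B); last by move=> k; exact: cboxedZ.
  rewrite -sumrN; congr (_ + _); apply: eq_bigr => k _.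
  by rewrite (cintZ _ (bk k)) -fourierE mulNr.
apply: (@le_trans _ _ ((e / V * M) * (2 * (2 * B) ^+ n))).
  apply: cint_bound => //.
    have cgP : ccont (fun x => g x - P x).
      have := ccontD cg (ccontM (ccont_cst n (-1)) cP).
      by congr ccont; apply/funext => x; rewrite mulN1r.
    have := cboxedMr (cboxed_kernel xi bv) cgP.
    by congr cboxed; apply/funext => x; rewrite mulrC.
  move=> x; have [Bx|nBx] := pselect (in_box B x); last first.
    by rewrite bv.2// mul0r mulr0 normc0 mulr_ge0// ltW.
  rewrite normcM normcM normc_expi mulr1; apply: ler_pM; rewrite ?normc_ge0//.
  by apply: is_usum_tail (hg x Bx) us hs _ => k; rewrite normcM normc_expi mulr1.
rewrite -mulrA mulrAC ler_pdivrMr// ler_wpM2l ?(ltW e0)//.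
by rewrite /V lerDl.
Qed.

End TrigSeries.

(** * Weight sequences and decaying symbols *)

Section Weights.
Local Open Scope complex_scope.
Context {R : realType}.

Lemma ln_le (x y : R) : 0 < x -> x <= y -> ln x <= ln y.
Proof. by move=> x0 xy; rewrite ler_ln ?posrE// (lt_le_trans x0). Qed.

Context (M : nat -> R) (wM : weight_sequence M).

Let M_gt0 p : 0 < M p. Proof. by have [[h _] _ _ _] := wM. Qed.
Let M0 : M 0%N = 1. Proof. by have [[_ h] _ _ _] := wM. Qed.

(** By logarithmic convexity the ratios [M p.+1 / M p] are nondecreasing. *)
Lemma weight_sequence_mul q r : M q * M r <= M (q + r)%N.
Proof.
have [_ lc _ _] := wM.
have ratio q' : M q'.+1 / M q' <= M q'.+2 / M q'.+1.
  by rewrite ler_pdivrMr// mulrAC ler_pdivlMr// -expr2 [leRHS]mulrC; exact: lc q'.+1 isT.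
have ratioS r' q' : M q'.+1 / M q' <= M (q' + r').+1 / M (q' + r')%N.
  elim: r' => [|r' IH]; first by rewrite addn0.
  by rewrite addnS; exact: le_trans IH (ratio _).
elim: q => [|q IH]; first by rewrite M0 mul1r add0n.
have := ratioS r q; rewrite ler_pdivrMr// mulrAC ler_pdivlMr// => h.
have : M q.+1 * (M q * M r) <= M q.+1 * M (q + r)%N by rewrite ler_wpM2l// ltW.
move=> /le_trans /(_ h); rewrite mulrCA [leRHS]mulrC ler_pM2l//.
Qed.

(** The ratios [M p / M p.+1] are summable, hence tend to 0, so that
    [t ^+ p / M p] eventually decreases in [p]. *)
Lemma assoc_fun_bounded (t : R) : 0 < t ->
  exists B, forall p, ln (t ^+ p / M p) <= B.
Proof.
move=> t0; have [_ _ _ cv] := wM.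
have r0 : (fun p => M p / M p.+1) @ \oo --> (0 : R) by exact: cvg_series_cvg_0.
have ti : 0 < t^-1 by rewrite invr_gt0.
have [N _ hN] : \forall p \near \oo, M p / M p.+1 < t^-1.
  exact: (cvgr_lt _ r0).
pose a p := t ^+ p / M p.
have a0 p : 0 < a p by rewrite divr_gt0// exprn_gt0.
have dec p : (N <= p)%N -> a p.+1 <= a p.
  move=> /hN /= /ltW h.
  have -> : a p.+1 = a p * (t * (M p / M p.+1)).
    by rewrite /a exprS; field; rewrite !gt_eqF.
  by rewrite ler_piMr ?(ltW (a0 p))// mulrC -ler_pdivlMr// mul1r.
have dN p : (N <= p)%N -> a p <= a N.
  elim: p => [|p IH]; first by rewrite leqn0 => /eqP ->.
  rewrite leq_eqVlt => /predU1P[->//|Np].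
  exact: le_trans (dec p Np) (IH Np).
(* All the terms are at most the largest of the first [N.+1], hence at most
   their sum. *)
exists (ln (\sum_(i < N.+1) a i)) => p.
have le_sum i : (i < N.+1)%N -> a i <= \sum_(i < N.+1) a i.
  move=> iN; rewrite (bigD1 (Ordinal iN))//= lerDl sumr_ge0// => j _; exact: ltW.
apply: ln_le; first exact: a0.
have [pN|/ltnW Np] := leqP p N; first exact: le_sum.
by apply: le_trans (dN p Np) _; exact: le_sum.
Qed.

Lemma assoc_fun_has_sup (t : R) : 0 < t ->
  has_sup (range (fun p : nat => ln (t ^+ p / M p))).
Proof.
move=> t0; split; first by exists (ln (t ^+ 0 / M 0%N)), 0%N.
by have [B hB] := assoc_fun_bounded t0; exists B => x [p _ <-].
Qed.

Lemma assoc_fun_ge0 t : 0 <= assoc_fun M t.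
Proof.
rewrite /assoc_fun; case: ifP => // t0.
apply: ub_le_sup; first exact: (assoc_fun_has_sup t0).2.
by exists 0%N => //; rewrite expr0 M0 divr1 ln1.
Qed.

Lemma le_assoc_fun s t : s <= t -> assoc_fun M s <= assoc_fun M t.
Proof.
move=> st; have [s0|s0] := ltP 0 s; last by rewrite {1}/assoc_fun ltNge s0 assoc_fun_ge0.
have t0 := lt_le_trans s0 st; rewrite /assoc_fun s0 t0.
apply: sup_le_ub; first by exists (ln (s ^+ 0 / M 0%N)), 0%N.
move=> _ [p _ <-]; apply: le_trans (_ : ln (t ^+ p / M p) <= _); last first.
  by apply: ub_le_sup; [exact: (assoc_fun_has_sup t0).2|exists p].
apply: ln_le; rewrite ?divr_gt0 ?exprn_gt0// ler_pM2r ?invr_gt0//.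
by rewrite lerXn2r// nnegrE ltW.
Qed.

(** [exp (- assoc_fun M t)] is the infimum of [M p / t ^+ p], which turns a
    bound for each order of differentiation into one exponential bound. *)
Lemma assoc_fun_inf (y t V : R) : 0 <= t -> 0 < V ->
  (forall p, y * t ^+ p <= V * M p) -> y <= V * expR (- assoc_fun M t).
Proof.
move=> t0 V0 h.
have [y0|y0] := leP y 0; first by apply: le_trans y0 _; rewrite mulr_ge0 ?expR_ge0 ?ltW.
rewrite -ler_pdivrMl// -[leLHS]lnK ?posrE ?mulr_gt0 ?invr_gt0// ler_expR lerNr.
rewrite -lnV ?posrE ?mulr_gt0 ?invr_gt0//.
have y1 : 1 <= (V^-1 * y)^-1.
  rewrite invf_ge1 ?mulr_gt0 ?invr_gt0// ler_pdivrMl// mulr1.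
  by have := h 0%N; rewrite expr0 M0 !mulr1.
rewrite /assoc_fun; case: ltP => [tp|_]; last by rewrite ln_ge0.
apply: sup_le_ub; first by exists (ln (t ^+ 0 / M 0%N)), 0%N.
move=> _ [p _ <-]; apply: ln_le; rewrite ?divr_gt0 ?exprn_gt0 ?invr_gt0 ?mulr_gt0 ?invr_gt0//.
rewrite ler_pdivrMr// invfM invrK mulrAC ler_pdivlMr// mulrC.
exact: h.
Qed.

(** The decay rates of the wave front set, with a single constant in the roles
    of [C], [b], [a] and [1 / k]. The rates get weaker as the constant grows
    ([le_decay]), so that finitely many of them are merged by taking the
    largest constant. *)
Definition decay (c e t : R) : R :=
  c * e `^ (- c) * expR (- assoc_fun M (c^-1 * e `^ c * t)).

Lemma decay_ge0 c e t : 0 <= c -> 0 <= decay c e t.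
Proof. by move=> c0; rewrite !mulr_ge0// ?powR_ge0 ?expR_ge0. Qed.

Lemma le_decay c c' e t t' : 1 <= c -> c <= c' -> 0 < e <= 1 ->
  0 <= t -> c'^-1 * t' <= c^-1 * t -> decay c e t <= decay c' e t'.
Proof.
move=> c1 cc' e01 t0 tt'; have /andP[e0 e1] := e01.
have c0 : 0 < c := lt_le_trans ltr01 c1.
have c'0 : 0 < c' := lt_le_trans c0 cc'.
rewrite /decay; apply: ler_pM.
- by rewrite mulr_ge0 ?powR_ge0// ltW.
- exact: expR_ge0.
- apply: ler_pM => //; rewrite ?powR_ge0 ?(ltW c0)//.
  by apply: ger_powR => //; rewrite lerN2.
rewrite ler_expR lerN2; apply: le_assoc_fun.
rewrite mulrAC [leRHS]mulrAC; apply: (@le_trans _ _ (c^-1 * t * e `^ c')).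
  by rewrite ler_wpM2r ?powR_ge0.
by rewrite ler_wpM2l ?mulr_ge0 ?invr_ge0 ?(ltW c0)//; exact: ger_powR.
Qed.

End Weights.

Section Symbols.
Local Open Scope complex_scope.
Context {R : realType} {n : nat} (M : nat -> R) (wM : weight_sequence M).
Local Notation vec := 'rV[R]_n.
Local Notation symbol := (R -> vec -> R).

Lemma dotp_ge0 (x : vec) : 0 <= dotp x x.
Proof. by apply: sumr_ge0 => i _; rewrite -expr2 sqr_ge0. Qed.

Lemma enorm_ge0 (x : vec) : 0 <= enorm x. Proof. exact: sqrtr_ge0. Qed.

Lemma enorm_sqr (x : vec) : enorm x ^+ 2 = dotp x x.
Proof. by rewrite sqr_sqrtr// dotp_ge0. Qed.

Lemma enormZ (s : R) (x : vec) : 0 <= s -> enorm (s *: x) = s * enorm x.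
Proof.
move=> s0; rewrite /enorm dotpZl dotpZr mulrA -expr2 sqrtrM ?sqr_ge0//.
by rewrite sqrtr_sqr ger0_norm.
Qed.

Lemma dotp_eq0 (x : vec) : dotp x x = 0 -> x = 0.
Proof.
move=> h; apply/rowP => i; rewrite mxE.
have nn j : true -> 0 <= x ord0 j * x ord0 j by rewrite -expr2 sqr_ge0.
have /eqP := psumr_eq0P nn h (i := i) isT.
by rewrite mulf_eq0 orbb => /eqP.
Qed.

Lemma enorm_gt0 (x : vec) : x != 0 -> 0 < enorm x.
Proof.
move=> x0; rewrite /enorm sqrtr_gt0 lt_neqAle dotp_ge0 andbT eq_sym.
by apply: contraNneq x0 => /dotp_eq0 ->.
Qed.

Lemma enorm_le_norm (x : vec) : enorm x <= n.+1%:R * `|x|.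
Proof.
rewrite -[leRHS]ger0_norm ?mulr_ge0// -sqrtr_sqr ler_wsqrtr// exprMn.
apply: (@le_trans _ _ (\sum_(i < n) `|x| ^+ 2)).
  apply: ler_sum => i _; rewrite -expr2 -[leLHS]real_normK ?num_real//.
  by rewrite lerXn2r ?nnegrE// row_entry_le_norm.
rewrite sumr_const card_ord -[_ *+ n]mulr_natl ler_wpM2r ?sqr_ge0//.
by rewrite -natrX ler_nat expnS mulnC (leq_trans (leqnSn n))// leq_pmull.
Qed.

Lemma continuous_dotp_self : continuous (fun x : vec => dotp x x).
Proof.
apply: continuous_sum_seq => i x.
have c := @coord_continuous R 1 n ord0 i x.
exact: (continuousM c c).
Qed.

Lemma continuous_enorm : continuous (@enorm R n).
Proof.
move=> x; exact: (continuous_comp (@continuous_dotp_self x) (@sqrt_continuous R _)).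
Qed.

(** This identity yields both the Cauchy-Schwarz inequality and its equality
    case. *)
Lemma dotp_sqr_sub (v w : vec) :
  dotp (dotp w w *: v - dotp v w *: w) (dotp w w *: v - dotp v w *: w) =
  dotp w w * (dotp v v * dotp w w - dotp v w ^+ 2).
Proof.
rewrite !(dotpDl, dotpDr, dotpNl, dotpNr, dotpZl, dotpZr) (dotpC w v); ring.
Qed.

Lemma dotp_le_enorm (v w : vec) : dotp v w <= enorm v * enorm w.
Proof.
have [->|w0] := eqVneq w 0.
  have -> : dotp v 0 = 0 by rewrite /dotp big1// => i _; rewrite mxE mulr0.
  by rewrite mulr_ge0// enorm_ge0.
have ww : 0 < dotp w w by rewrite -enorm_sqr exprn_gt0// enorm_gt0.
have := dotp_ge0 (dotp w w *: v - dotp v w *: w).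
rewrite dotp_sqr_sub pmulr_rge0// subr_ge0 -!enorm_sqr -exprMn => h.
apply: le_trans (ler_norm _) _.
by rewrite -[leRHS]ger0_norm ?mulr_ge0 ?enorm_ge0// -!sqrtr_sqr ler_wsqrtr.
Qed.

Lemma dotp_eq_enorm (v w : vec) : w != 0 -> dotp v w = enorm v * enorm w ->
  exists2 t, 0 <= t & v = t *: w.
Proof.
move=> w0 h; have ww : 0 < dotp w w by rewrite -enorm_sqr exprn_gt0// enorm_gt0.
have := dotp_sqr_sub v w.
rewrite {3}h exprMn !enorm_sqr subrr mulr0 => /dotp_eq0 /eqP.
rewrite subr_eq0 => /eqP hv; exists (dotp v w / dotp w w).
  by rewrite divr_ge0 ?dotp_ge0// h mulr_ge0// enorm_ge0.
by rewrite mulrC -scalerA -hv scalerA mulVf ?scale1r// gt_eqF.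
Qed.

(** These cones shrink to the half-line of [w] as [c] grows. *)
Definition in_cone (c : R) (w v : vec) := (1 - c^-1) * (enorm v * enorm w) < dotp v w.

Lemma open_cone_in_cone c w : 1 <= c -> open_cone (in_cone c w).
Proof.
move=> c1; split.
- have cf : continuous (fun v : vec => dotp v w - (1 - c^-1) * (enorm v * enorm w)).
    move=> v; apply: (continuousB (@continuous_dotp R n w v)).
    apply: (continuousM (@cst_continuous _ _ (1 - c^-1) v)).
    exact: (continuousM (@continuous_enorm v) (@cst_continuous _ _ (enorm w) v)).
  rewrite openE => v; rewrite /in_cone -subr_gt0 => h.
  apply: (@filterS _ _ _ _ _ _ (cvgr_gt _ (cf v) _ h)) => z.
  by rewrite /= subr_gt0.
- rewrite /in_cone; have -> : dotp 0 w = 0.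
    by rewrite /dotp big1// => i _; rewrite mxE mul0r.
  have -> : enorm (0 : vec) = 0.
    by rewrite -(scale0r (0 : vec)) enormZ// mul0r.
  by rewrite mul0r mulr0 ltxx.
- move=> t xi t0; rewrite /in_cone dotpZl (enormZ _ (ltW t0)) => h.
  have -> : (1 - c^-1) * (t * enorm xi * enorm w) =
    t * ((1 - c^-1) * (enorm xi * enorm w)) by ring.
  by rewrite ltr_pM2l.
Qed.

Lemma in_cone_self c w : 1 <= c -> w != 0 -> in_cone c w w.
Proof.
move=> c1 w0; rewrite /in_cone -enorm_sqr -expr2.
have h : 0 < enorm w ^+ 2 by rewrite exprn_gt0// enorm_gt0.
by rewrite gtr_pMl// gtrBl invr_gt0 (lt_le_trans _ c1).
Qed.

Lemma in_coneW c c' w v : 1 <= c -> c <= c' -> in_cone c' w v -> in_cone c w v.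
Proof.
move=> c1 cc'; apply: le_lt_trans; rewrite ler_wpM2r ?mulr_ge0 ?enorm_ge0//.
have c0 := lt_le_trans ltr01 c1.
by rewrite lerD2l lerN2 lef_pV2 ?posrE// (lt_le_trans c0).
Qed.

Definition decays_at (a : symbol) (xi0 : vec) := exists G c,
  [/\ open_cone G, G xi0, 1 <= c &
   forall e xi, 0 < e <= c^-1 -> G xi -> a e xi <= decay M c e (enorm xi)].

Definition symbol_bound (a : symbol) := exists2 c, 1 <= c &
  forall e xi, 0 < e <= c^-1 -> a e xi <= c * e `^ (- c) * weight xi.

Lemma le_invr1 (c : R) : 1 <= c -> c^-1 <= 1.
Proof. by move=> c1; rewrite invf_le1// (lt_le_trans _ c1). Qed.

Lemma le_invr_anti (c c' e : R) : 1 <= c -> c <= c' -> 0 < e <= c'^-1 -> 0 < e <= c^-1.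
Proof.
move=> c1 cc' /andP[-> h] /=; apply: le_trans h _.
have c0 := lt_le_trans ltr01 c1.
by rewrite lef_pV2 ?posrE// (lt_le_trans c0).
Qed.

Lemma small_le1 (c e : R) : 1 <= c -> 0 < e <= c^-1 -> 0 < e <= 1.
Proof. by move=> c1 /andP[-> h] /=; apply: le_trans h (le_invr1 c1). Qed.

(** The cone is invariant under dilations and [enorm] is bounded below near
    [z0], so the decay can be expressed in terms of the parameter [s] of the
    ray. *)
Lemma decays_near (a : symbol) (z0 : vec) : decays_at a z0 ->
  exists2 N, nbhs z0 N & exists2 c0, 1 <= c0 &
  forall c z s e, c0 <= c -> N z -> 0 < s -> 0 < e <= c^-1 ->
    a e (s *: z) <= decay M c e s.
Proof.
move=> [G [c1 [[oG G0 sG] Gz0 c11 hG]]].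
have z00 : z0 != 0 by apply/eqP => h; apply: G0; rewrite -h.
pose m := enorm z0 / 2.
have m0 : 0 < m by rewrite divr_gt0// enorm_gt0.
exists (G `&` [set z | m < enorm z]).
  apply: filterI; first exact: open_nbhs_nbhs.
  apply: (cvgr_gt _ (@continuous_enorm z0)).
  by rewrite /m ltr_pdivrMr// ltr_pMr ?ltr1n// enorm_gt0.
exists (Num.max c1 (c1 / m)); first by rewrite le_max c11.
move=> c z s e; rewrite ge_max => /andP[c1c cm] [Gz mz] s0 es.
have es1 := le_invr_anti c11 c1c es.
apply: le_trans (hG e (s *: z) es1 (sG s z s0 Gz)) _.
rewrite (enormZ _ (ltW s0)); apply: (le_decay wM) => //; first exact: small_le1 es1.
  by rewrite mulr_ge0 ?enorm_ge0// ltW.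
have c10 : 0 < c1 := lt_le_trans ltr01 c11.
have c0 : 0 < c := lt_le_trans c10 c1c.
have h1 : c^-1 <= c1^-1 * m.
  have -> : c1^-1 * m = (c1 / m)^-1 by rewrite invfM invrK.
  by rewrite lef_pV2 ?posrE// divr_gt0.
apply: (@le_trans _ _ (c1^-1 * m * s)); first by rewrite ler_wpM2r// ltW.
have -> : c1^-1 * m * s = c1^-1 * s * m by ring.
have -> : c1^-1 * (s * enorm z) = c1^-1 * s * enorm z by ring.
by rewrite ler_wpM2l ?ltW// mulr_gt0// invr_gt0.
Qed.

Lemma compact_pair_sphere : compact [set q : vec * vec | `|q| = 1].
Proof.
apply: (@subclosed_compact _ _ ([set x | in_box 1 x] `*` [set x | in_box 1 x])).
- apply: (@preimage_closed _ _ (fun q : vec * vec => `|q|) [set x | x = 1]).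
    by move=> q _; exact: norm_continuous.
  exact: closed_eq.
- by apply: compact_setX; exact: compact_in_box.
- move=> [z eta] /= h; split=> i; apply: le_trans (row_entry_le_norm _ i) _.
    by rewrite -h /= prod_normE le_max lexx.
  by rewrite -h /= prod_normE le_max lexx orbT.
Qed.

Lemma continuous_pairD : continuous (fun q : vec * vec => q.1 + q.2).
Proof. exact: add_continuous. Qed.

(** Off the half-line of [xi0] the Cauchy-Schwarz inequality is strict, with a
    gap that is uniform on a neighbourhood, and a thin enough cone misses this
    neighbourhood. *)
Lemma in_cone_near (xi0 : vec) (q : vec * vec) :
  dotp (q.1 + q.2) xi0 != enorm (q.1 + q.2) * enorm xi0 ->
  exists2 N, nbhs q N & exists2 c0, 1 <= c0 &
    forall c q', c0 <= c -> N q' -> ~ in_cone c xi0 (q'.1 + q'.2).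
Proof.
move=> ne; pose v0 := q.1 + q.2.
pose F (v : vec) := enorm v * enorm xi0 - dotp v xi0.
have cE : continuous (fun v : vec => enorm v * enorm xi0).
  by move=> v; exact: (continuousM (@continuous_enorm v) (@cst_continuous _ _ (enorm xi0) v)).
have cF : continuous F.
  by move=> v; exact: (continuousB (cE v) (@continuous_dotp R n xi0 v)).
have F0 : 0 < F v0.
  by rewrite subr_gt0 lt_neqAle ne dotp_le_enorm.
have cFp := continuous_comp (@continuous_pairD q) (cF _).
have cEp := continuous_comp (@continuous_pairD q) (cE _).
pose m := enorm v0 * enorm xi0 + 1.
have m0 : 0 < m by rewrite ltr_wpDl// mulr_ge0 ?enorm_ge0.
have F2 : F v0 / 2 < F v0 by rewrite ltr_pdivrMr// ltr_pMr ?ltr1n.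
have mE : enorm v0 * enorm xi0 < m by rewrite ltrDl.
exists ([set q' | F v0 / 2 < F (q'.1 + q'.2)] `&`
        [set q' | enorm (q'.1 + q'.2) * enorm xi0 < m]).
  apply: filterI; first exact: (cvgr_gt _ cFp _ F2).
  exact: (cvgr_lt _ cEp _ mE).
exists (Num.max 1 (m / (F v0 / 2))) => [|c q']; first by rewrite le_max lexx.
rewrite ge_max => /andP[c1 cm] [/= h1 h2]; rewrite /in_cone; apply/negP.
rewrite -leNgt mulrBl mul1r lerBrDr -lerBrDl -/(F _).
apply: le_trans (ltW h1).
have c0 := lt_le_trans ltr01 c1.
rewrite mulrC ler_pdivrMr//; apply: le_trans (ltW h2) _.
by rewrite mulrC -ler_pdivrMr// divr_gt0.
Qed.

(** By compactness of the unit sphere of pairs, and homogeneity, a single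
    constant serves for all pairs. Near a pair with [z + eta] on the closed
    half-line of [xi0] the decay of one of the symbols is used; near any other
    pair the sum stays out of a thin cone and there is nothing to prove. The
    decay is at the scale of the pair, hence at that of [z + eta], which is
    bounded by a multiple of it. *)
Lemma uniform_pair_decay (a b : symbol) (xi0 : vec) :
  (forall z eta, (z, eta) != 0 ->
     dotp (z + eta) xi0 = enorm (z + eta) * enorm xi0 ->
     decays_at a z \/ decays_at b eta) ->
  exists2 c, 1 <= c & forall z eta e, in_cone c xi0 (z + eta) -> 0 < e <= c^-1 ->
    a e z <= decay M c e (enorm (z + eta)) \/
    b e eta <= decay M c e (enorm (z + eta)).
Proof.
move=> hab.
pose K : set (vec * vec) := [set q | `|q| = 1].
pose P c (q : vec * vec) := 1 <= c /\ forall s e, 0 < s -> 0 < e <= c^-1 ->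
  in_cone c xi0 (q.1 + q.2) ->
  a e (s *: q.1) <= decay M c e s \/ b e (s *: q.2) <= decay M c e s.
have : \forall c \near +oo, K `<=` P c.
  have /compact_near_coveringP := compact_pair_sphere; apply => q Kq.
  have q0 : q != 0.
    by apply/eqP => h; move: Kq; rewrite /K h /= normr0 => /eqP; rewrite eq_sym oner_eq0.
  have [/eqP eqq|neq] := boolP (dotp (q.1 + q.2) xi0 == enorm (q.1 + q.2) * enorm xi0); last first.
    have [N qN [c0 c01 h]] := in_cone_near neq.
    exists (N, [set c | c0 <= c]) => /=.
      by split=> //; apply: nbhs_pinfty_ge; rewrite num_real.
    move=> [q' c] /= [Nq' c0c]; split; first exact: le_trans c0c.
    by move=> s e _ _ /(h c q' c0c Nq').
  have hq : decays_at a q.1 \/ decays_at b q.2.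
    by apply: hab => //; move: q0; case: (q).
  case: hq => /decays_near[N qN [c0 c01 h]].
    exists (fst @^-1` N, [set c | c0 <= c]) => /=.
      split; first exact: (@cvg_fst _ _ (nbhs q.1) (nbhs q.2)).
      by apply: nbhs_pinfty_ge; rewrite num_real.
    move=> [q' c] /= [Nq' c0c]; split; first exact: le_trans c0c.
    by move=> s e s0 es _; left; exact: h.
  exists (snd @^-1` N, [set c | c0 <= c]) => /=.
    split; first exact: (@cvg_snd _ _ (nbhs q.1) (nbhs q.2)).
    by apply: nbhs_pinfty_ge; rewrite num_real.
  move=> [q' c] /= [Nq' c0c]; split; first exact: le_trans c0c.
  by move=> s e s0 es _; right; exact: h.
move=> hK.
have : \forall c \near +oo, 1 <= c /\ K `<=` P c.
  apply: filterI => //; apply: nbhs_pinfty_ge; exact: num_real.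
move=> /filter_ex[c0 [c01 hc0]].
have c00 := lt_le_trans ltr01 c01.
(* [enorm (z + eta)] is at most [2 * n.+1%:R] times the norm of the pair. *)
pose c := c0 * (2 * n.+1%:R).
have n2 : (1 : R) <= 2 * n.+1%:R.
  by rewrite -natrM ler1n muln_gt0.
have c0c : c0 <= c by rewrite /c ler_peMr// ltW.
exists c => [|z eta e hv es]; first exact: le_trans c0c.
have es0 := le_invr_anti c01 c0c es.
have {}hv := in_coneW c01 c0c hv.
pose s := `|(z, eta)|.
have s0 : 0 < s.
  rewrite normr_gt0; apply/eqP => -[z0 eta0]; move: hv; rewrite z0 eta0 addr0.
  by have [_ h _] := open_cone_in_cone xi0 c01.
have sz : `|z| <= s by rewrite /s prod_normE le_max lexx.
have seta : `|eta| <= s by rewrite /s prod_normE le_max lexx orbT.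
have Kq : K (s^-1 *: z, s^-1 *: eta).
  have -> : (s^-1 *: z, s^-1 *: eta) = s^-1 *: (z, eta) by [].
  by rewrite /K /= normrZ ger0_norm ?invr_ge0 ?(ltW s0)// mulVf// gt_eqF.
have [_ h] := hc0 _ Kq; have {h} := h s e s0 es0 _.
rewrite /= -scalerDr !scalerA mulfV ?gt_eqF// !scale1r => h.
have [_ _ sc] := open_cone_in_cone xi0 c01.
have {}h : a e z <= decay M c0 e s \/ b e eta <= decay M c0 e s.
  by apply: h; apply: sc => //; rewrite invr_gt0.
have dd : decay M c0 e s <= decay M c e (enorm (z + eta)).
  apply: (le_decay wM) => //; [exact: small_le1 es0|exact: ltW|].
  rewrite /c invfM -mulrA ler_wpM2l ?invr_ge0 ?(ltW c00)//.
  rewrite ler_pdivrMl ?(lt_le_trans ltr01)//.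
  apply: le_trans (enorm_le_norm _) _.
  have -> : 2 * n.+1%:R * s = n.+1%:R * (2 * s) by ring.
  rewrite ler_wpM2l//.
  apply: le_trans (ler_normD _ _) _; move: sz seta; lra.
by case: h => h; [left|right]; exact: le_trans dd.
Qed.

(** It is not known which of the two factors is small, so the weights of both
    are kept; their sum is still summable. *)
Lemma mul_le_either (A B D E u v : R) : 0 <= A -> 0 <= B -> 0 <= D -> 0 <= E ->
  0 <= u -> 0 <= v -> A <= E * u -> B <= E * v -> A <= D \/ B <= D ->
  A * B <= D * E * (u + v).
Proof.
move=> A0 B0 D0 E0 u0 v0 hA hB; rewrite mulrDr -!mulrA => -[h|h].
  apply: (@le_trans _ _ (D * (E * v))); first exact: ler_pM.
  by rewrite lerDr !mulr_ge0.
apply: (@le_trans _ _ (D * (E * u))); first by rewrite mulrC; exact: ler_pM.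
by rewrite lerDl !mulr_ge0.
Qed.

(** In each term of the discrete convolution one factor has the required decay
    and the other is at most a negative power of [e] times a weight, summable
    uniformly in [xi]. *)
Lemma symbol_product (a b : symbol) (theta : R) (xi0 : vec) :
  (forall e xi, 0 <= a e xi) -> (forall e xi, 0 <= b e xi) ->
  symbol_bound a -> symbol_bound b -> 0 < theta <= 1 -> xi0 != 0 ->
  (forall z eta, (z, eta) != 0 ->
     dotp (z + eta) xi0 = enorm (z + eta) * enorm xi0 ->
     decays_at a z \/ decays_at b eta) ->
  exists G c, [/\ open_cone G, G xi0, 1 <= c &
   forall e xi, 0 < e <= c^-1 -> G xi -> forall s : seq {ffun 'I_n -> int}, uniq s ->
    \sum_(k <- s) a e (freq theta k) * b e (xi - freq theta k) <=
    decay M c e (enorm xi)].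
Proof.
move=> a0 b0 [ca ca1 ha] [cb cb1 hb] /andP[t0 t1] xi00 hab.
have [c1 c11 hc1] := uniform_pair_decay hab.
have [W W0 hW] := @summable_weight R n theta t0 t1.
pose c2 := Num.max ca (Num.max cb c1).
have cac : ca <= c2 by rewrite /c2 le_max lexx.
have cbc : cb <= c2 by rewrite /c2 !le_max lexx orbT.
have c1c : c1 <= c2 by rewrite /c2 !le_max lexx !orbT.
have c21 : 1 <= c2 := le_trans ca1 cac.
have c20 := lt_le_trans ltr01 c21.
(* [2 * c2] for the product of the powers of [e], the other term for that of
   the constant factors. *)
pose c := Num.max (2 * c2) (c2 * c2 * (2 * W)).
have cc : 2 * c2 <= c by rewrite /c le_max lexx.
have c2c : c2 <= c by apply: le_trans cc; rewrite mulr2n mulrDl !mul1r lerDl ltW.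
have c1' : 1 <= c := le_trans c21 c2c.
exists (in_cone c xi0), c; split => //.
- exact: open_cone_in_cone.
- exact: in_cone_self.
move=> e xi es hxi s us.
have es2 := le_invr_anti c21 c2c es.
have e01 := small_le1 c1' es.
have hxi1 := in_coneW c11 (le_trans c1c c2c) hxi.
have up d (xi' : vec) : 1 <= d -> d <= c2 ->
    d * e `^ (- d) * weight xi' <= c2 * e `^ (- c2) * weight xi'.
  move=> d1 dc; rewrite ler_wpM2r ?(ltW (weight_gt0 _))//.
  apply: ler_pM => //; rewrite ?powR_ge0 ?(le_trans ler01 d1)//.
  by apply: ger_powR => //; rewrite lerN2.
pose E := c2 * e `^ (- c2).
have E0 : 0 <= E by rewrite mulr_ge0 ?powR_ge0 ?ltW.
have haE z : a e z <= E * weight z.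
  exact: le_trans (ha e z (le_invr_anti ca1 cac es2)) (up ca z ca1 cac).
have hbE z : b e z <= E * weight z.
  exact: le_trans (hb e z (le_invr_anti cb1 cbc es2)) (up cb z cb1 cbc).
pose D := decay M c2 e (enorm xi).
have D0 : 0 <= D by apply: decay_ge0; exact: ltW.
have term k : a e (freq theta k) * b e (xi - freq theta k) <=
    D * E * (weight (0 - freq theta k) + weight (xi - freq theta k)).
  have e1 := le_invr_anti c11 c1c es2.
  have := hc1 (freq theta k) (xi - freq theta k) e.
  rewrite addrC subrK => /(_ hxi1 e1) h.
  have dd : decay M c1 e (enorm xi) <= D.
    apply: (le_decay wM) => //; first exact: enorm_ge0.
    rewrite ler_wpM2r ?enorm_ge0// lef_pV2 ?posrE// (lt_le_trans ltr01 c11)//.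
  rewrite sub0r weightN.
  have w0 z := ltW (weight_gt0 (z : vec)).
  apply: (mul_le_either (a0 _ _) (b0 _ _) D0 E0 (w0 _) (w0 _) (haE _) (hbE _)).
  by case: h => h; [left|right]; exact: le_trans h dd.
apply: (@le_trans _ _ (D * E * (W + W))).
  apply: (@le_trans _ _ (\sum_(k <- s) D * E *
      (weight (0 - freq theta k) + weight (xi - freq theta k)))).
    by apply: ler_sum => k _; exact: term.
  rewrite -mulr_sumr big_split /=; apply: ler_wpM2l; first exact: mulr_ge0.
  by apply: lerD; exact: hW.
have e0 : e != 0 by case/andP: e01 => h _; rewrite gt_eqF.
rewrite /D /E /decay.
have -> : c2 * e `^ (- c2) * expR (- assoc_fun M (c2^-1 * e `^ c2 * enorm xi)) *
    (c2 * e `^ (- c2)) * (W + W) =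
  (c2 * c2 * (2 * W)) * (e `^ (- c2) * e `^ (- c2)) *
  expR (- assoc_fun M (c2^-1 * e `^ c2 * enorm xi)) by ring.
rewrite -powRD; last by rewrite e0 implybT.
apply: ler_pM.
- by rewrite !mulr_ge0 ?powR_ge0// ltW.
- exact: expR_ge0.
- apply: ler_pM; rewrite ?powR_ge0//.
  + by rewrite !mulr_ge0// ltW.
  + by rewrite /c le_max lexx orbT.
  + by apply: ger_powR => //; rewrite -opprD lerN2; apply: le_trans cc; rewrite mulr2n mulrDl mul1r.
rewrite ler_expR lerN2; apply: (le_assoc_fun wM).
rewrite ler_wpM2r ?enorm_ge0//; apply: ler_pM; rewrite ?powR_ge0 ?invr_ge0 ?(le_trans ler01 c1')//.
  by rewrite lef_pV2 ?posrE// (lt_le_trans c20).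
exact: ger_powR.
Qed.

End Symbols.

(** * Moderate and negligible families *)

Section Growth.
Local Open Scope complex_scope.
Context {R : realType} {T : Type}.
Implicit Types (Q : R -> T -> R) (K : set T).

Definition moderate_bound Q K := exists (m : nat) (C eta : R),
  [/\ 0 < C, 0 < eta <= 1 & forall e, 0 < e <= eta -> forall x, K x -> Q e x <= C * e ^- m].

Definition negligible_bound Q K := forall m : nat, exists C eta : R,
  [/\ 0 < C, 0 < eta <= 1 & forall e, 0 < e <= eta -> forall x, K x -> Q e x <= C * e ^+ m].

Lemma moderate_boundS Q Q' K K' :
  (forall e x, 0 < e <= 1 -> K' x -> Q' e x <= Q e x) -> K' `<=` K ->
  moderate_bound Q K -> moderate_bound Q' K'.
Proof.
move=> QQ KK [m [C [eta [C0 /andP[e0 e1] h]]]]; exists m, C, eta; split=> //.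
  by rewrite e0.
move=> e /andP[e0' ee] x Kx; apply: le_trans (h e _ x (KK x Kx)); last by rewrite e0'.
by apply: QQ => //; rewrite e0' (le_trans ee).
Qed.

Lemma negligible_boundS Q Q' K K' :
  (forall e x, 0 < e <= 1 -> K' x -> Q' e x <= Q e x) -> K' `<=` K ->
  negligible_bound Q K -> negligible_bound Q' K'.
Proof.
move=> QQ KK hQ m; have [C [eta [C0 /andP[e0 e1] h]]] := hQ m.
exists C, eta; split=> //; first by rewrite e0.
move=> e /andP[e0' ee] x Kx; apply: le_trans (h e _ x (KK x Kx)); last by rewrite e0'.
by apply: QQ => //; rewrite e0' (le_trans ee).
Qed.

Lemma min_eta (a b : R) : 0 < a <= 1 -> 0 < b <= 1 -> 0 < Num.min a b <= 1.
Proof. by move=> /andP[a0 a1] /andP[b0 b1]; rewrite lt_min a0 b0 /= ge_min a1. Qed.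

Lemma le_min_eta (e a b : R) : 0 < e <= Num.min a b -> 0 < e <= a /\ 0 < e <= b.
Proof. by rewrite le_min => /andP[-> /andP[-> ->]]. Qed.

Lemma exprNn_le (e : R) m m' : 0 < e <= 1 -> (m <= m')%N -> e ^- m <= e ^- m'.
Proof.
move=> /andP[e0 e1] mm; rewrite lef_pV2 ?posrE ?exprn_gt0//.
by apply: ler_wiXn2l => //; exact: ltW.
Qed.

Lemma moderate_boundD Q Q' K : moderate_bound Q K -> moderate_bound Q' K ->
  moderate_bound (fun e x => Q e x + Q' e x) K.
Proof.
move=> [m [C [eta [C0 h0 h]]]] [m' [C' [eta' [C0' h0' h']]]].
exists (maxn m m'), (C + C'), (Num.min eta eta'); split; rewrite ?addr_gt0 ?min_eta//.
move=> e /le_min_eta[he he'] x Kx.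
have e1 : 0 < e <= 1.
  by have /andP[-> h1] := he; rewrite (le_trans h1)//; case/andP: h0.
rewrite mulrDl; apply: lerD.
  apply: le_trans (h e he x Kx) _.
  by apply: ler_wpM2l; [exact: ltW|apply: exprNn_le => //; exact: leq_maxl].
apply: le_trans (h' e he' x Kx) _.
by apply: ler_wpM2l; [exact: ltW|apply: exprNn_le => //; exact: leq_maxr].
Qed.

Lemma negligible_boundD Q Q' K : negligible_bound Q K -> negligible_bound Q' K ->
  negligible_bound (fun e x => Q e x + Q' e x) K.
Proof.
move=> hQ hQ' m; have [C [eta [C0 h0 h]]] := hQ m.
have [C' [eta' [C0' h0' h']]] := hQ' m.
exists (C + C'), (Num.min eta eta'); split; rewrite ?addr_gt0 ?min_eta//.
move=> e /le_min_eta[he he'] x Kx.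
by rewrite mulrDl; apply: lerD; [exact: h|exact: h'].
Qed.

Lemma moderate_bound0 K : moderate_bound (fun _ _ => 0) K.
Proof.
exists 0%N, 1, 1; split; rewrite ?ltr01 ?lexx// => e _ x _.
by rewrite expr0 invr1 mulr1 ler01.
Qed.

Lemma negligible_bound0 K : negligible_bound (fun _ _ => 0) K.
Proof.
move=> m; exists 1, 1; split; rewrite ?ltr01 ?lexx// => e /andP[e0 _] x _.
by rewrite mul1r exprn_ge0// ltW.
Qed.

Lemma moderate_bound_sum (I : eqType) (r : seq I) (Q : I -> R -> T -> R) K :
  (forall i, i \in r -> moderate_bound (Q i) K) ->
  moderate_bound (fun e x => \sum_(i <- r) Q i e x) K.
Proof.
elim: r => [|i r IH] h.
  have := moderate_bound0 K; apply: moderate_boundS => // e x _ _.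
  by rewrite big_nil.
have h1 : moderate_bound (Q i) K by apply: h; rewrite mem_head.
have h2 : moderate_bound (fun e x => \sum_(i <- r) Q i e x) K.
  by apply: IH => j jr; apply: h; rewrite inE jr orbT.
by apply: moderate_boundS (moderate_boundD h1 h2) => // e x _ _; rewrite big_cons.
Qed.

Lemma negligible_bound_sum (I : eqType) (r : seq I) (Q : I -> R -> T -> R) K :
  (forall i, i \in r -> negligible_bound (Q i) K) ->
  negligible_bound (fun e x => \sum_(i <- r) Q i e x) K.
Proof.
elim: r => [|i r IH] h.
  have := negligible_bound0 K; apply: negligible_boundS => // e x _ _.
  by rewrite big_nil.
have h1 : negligible_bound (Q i) K by apply: h; rewrite mem_head.
have h2 : negligible_bound (fun e x => \sum_(i <- r) Q i e x) K.
  by apply: IH => j jr; apply: h; rewrite inE jr orbT.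
by apply: negligible_boundS (negligible_boundD h1 h2) => // e x _ _; rewrite big_cons.
Qed.

Lemma moderate_boundM Q Q' K : (forall e x, 0 <= Q e x) -> (forall e x, 0 <= Q' e x) ->
  moderate_bound Q K -> moderate_bound Q' K ->
  moderate_bound (fun e x => Q e x * Q' e x) K.
Proof.
move=> Q0 Q0' [m [C [eta [C0 h0 h]]]] [m' [C' [eta' [C0' h0' h']]]].
exists (m + m')%N, (C * C'), (Num.min eta eta'); split; rewrite ?mulr_gt0 ?min_eta//.
move=> e /le_min_eta[he he'] x Kx.
rewrite exprD invfM mulrACA; apply: ler_pM => //; [exact: h|exact: h'].
Qed.

Lemma negligible_boundM Q Q' K : (forall e x, 0 <= Q e x) -> (forall e x, 0 <= Q' e x) ->
  negligible_bound Q K -> moderate_bound Q' K ->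
  negligible_bound (fun e x => Q e x * Q' e x) K.
Proof.
move=> Q0 Q0' hQ [m' [C' [eta' [C0' h0' h']]]] m.
have [C [eta [C0 h0 h]]] := hQ (m + m')%N.
exists (C * C'), (Num.min eta eta'); split; rewrite ?mulr_gt0 ?min_eta//.
move=> e /le_min_eta[he he'] x Kx.
have e0 : e != 0 by case/andP: he => e0 _; rewrite gt_eqF.
have -> : C * C' * e ^+ m = (C * e ^+ (m + m')) * (C' * e ^- m').
  by rewrite exprD; field; rewrite expf_neq0.
by apply: ler_pM => //; [exact: h|exact: h'].
Qed.

End Growth.

Section Colombeau.
Local Open Scope complex_scope.
Context {R : realType} {n : nat} (Om : set 'rV[R]_n) (oOm : open Om).
Implicit Types (u v : family_of R n) (phi psi : cfun R n) (K : set 'rV[R]_n).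

Definition dnorm u al : R -> 'rV[R]_n -> R := fun e x => normc (mderiv al (u e) x).

Definition smooth_family u := forall e : R, 0 < e <= 1 -> smooth_on Om (u e).

Definition vanishing_off u := forall e : R, 0 < e <= 1 -> forall x, ~ Om x -> u e x = 0.

Definition moderate_bounds u := forall K, compact K -> K `<=` Om ->
  forall al, moderate_bound (dnorm u al) K.

Definition negligible_bounds u := forall K, compact K -> K `<=` Om ->
  forall al, negligible_bound (dnorm u al) K.

Lemma moderateE u : moderate Om u <->
  [/\ smooth_family u, vanishing_off u & moderate_bounds u].
Proof.
split=> [[h1 h2]|[h1 h2 h3]].
  split=> //; first by move=> e e1; have [] := h1 e e1.
  by move=> e e1; have [] := h1 e e1.
by split=> // e e1; split; [exact: h2|exact: h1].
Qed.

Lemma negligible_familyE u : negligible_family Om u <-> moderate Om u /\ negligible_bounds u.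
Proof. by []. Qed.

Lemma dnorm_ge0 u al e x : 0 <= dnorm u al e x. Proof. exact: normc_ge0. Qed.

(** The two halves of a split of [mi_seq al] are turned back into multi-indices
    by counting. *)
Lemma dnorm_mul_le u v al e x : smooth_on Om (u e) -> smooth_on Om (v e) -> Om x ->
  normc (mderiv al (fun y => u e y * v e y) x) <=
  \sum_(p <- leibniz_splits (mi_seq al))
    dnorm u [ffun j => count_mem j p.1] e x * dnorm v [ffun j => count_mem j p.2] e x.
Proof.
move=> su sv Ox; rewrite mderivE (iter_pderivM _ oOm su sv Ox).
apply: le_trans (normc_sum _ _ _) _; rewrite big_seq [leRHS]big_seq.
apply: ler_sum => p /leibniz_splitsP[h1 h2 _]; rewrite normcM /dnorm !mderivE.
by rewrite -(subseq_mi_seq h1) -(subseq_mi_seq h2).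
Qed.

Lemma smooth_familyM u v : smooth_family u -> smooth_family v ->
  smooth_family (fun e x => u e x * v e x).
Proof. by move=> su sv e e1; apply: smooth_onM => //; [exact: su|exact: sv]. Qed.

Lemma smooth_familyB u v : smooth_family u -> smooth_family v ->
  smooth_family (fun e x => u e x - v e x).
Proof. by move=> su sv e e1; apply: smooth_onB => //; [exact: su|exact: sv]. Qed.

Lemma moderate_boundsM u v : smooth_family u -> smooth_family v ->
  moderate_bounds u -> moderate_bounds v -> moderate_bounds (fun e x => u e x * v e x).
Proof.
move=> su sv mu mv K cK KO al.
have h : moderate_bound (fun e x => \sum_(p <- leibniz_splits (mi_seq al))
    dnorm u [ffun j => count_mem j p.1] e x * dnorm v [ffun j => count_mem j p.2] e x) K.
  apply: (@moderate_bound_sum _ _ _ _ (fun p e x =>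
    dnorm u [ffun j => count_mem j p.1] e x * dnorm v [ffun j => count_mem j p.2] e x)).
  move=> p _; apply: moderate_boundM; [move=> *; exact: dnorm_ge0|
    move=> *; exact: dnorm_ge0|exact: mu|exact: mv].
apply: moderate_boundS h => // e x e1 Kx; apply: dnorm_mul_le; [exact: su|exact: sv|exact: KO].
Qed.

Lemma negligible_boundsM u v : smooth_family u -> smooth_family v ->
  negligible_bounds u -> moderate_bounds v -> negligible_bounds (fun e x => u e x * v e x).
Proof.
move=> su sv mu mv K cK KO al.
have h : negligible_bound (fun e x => \sum_(p <- leibniz_splits (mi_seq al))
    dnorm u [ffun j => count_mem j p.1] e x * dnorm v [ffun j => count_mem j p.2] e x) K.
  apply: (@negligible_bound_sum _ _ _ _ (fun p e x =>
    dnorm u [ffun j => count_mem j p.1] e x * dnorm v [ffun j => count_mem j p.2] e x)).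
  move=> p _; apply: negligible_boundM; [move=> *; exact: dnorm_ge0|
    move=> *; exact: dnorm_ge0|exact: mu|exact: mv].
apply: negligible_boundS h => // e x e1 Kx; apply: dnorm_mul_le; [exact: su|exact: sv|exact: KO].
Qed.

Lemma dnormB_le u v al e x : smooth_on Om (u e) -> smooth_on Om (v e) -> Om x ->
  normc (mderiv al (fun y => u e y - v e y) x) <= dnorm u al e x + dnorm v al e x.
Proof.
move=> su sv Ox; rewrite /dnorm !mderivE (iter_pderivB _ oOm su sv Ox).
by apply: le_trans (le_normcD _ _) _; rewrite normcN.
Qed.

Lemma dnormD_le u v al e x : smooth_on Om (u e) -> smooth_on Om (v e) -> Om x ->
  normc (mderiv al (fun y => u e y + v e y) x) <= dnorm u al e x + dnorm v al e x.
Proof.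
move=> su sv Ox; rewrite /dnorm !mderivE (iter_pderivD _ oOm su sv Ox).
exact: le_normcD.
Qed.

Lemma moderate_boundsB u v : smooth_family u -> smooth_family v ->
  moderate_bounds u -> moderate_bounds v -> moderate_bounds (fun e x => u e x - v e x).
Proof.
move=> su sv mu mv K cK KO al.
apply: moderate_boundS (moderate_boundD (mu K cK KO al) (mv K cK KO al)) => //.
by move=> e x e1 Kx; apply: dnormB_le; [exact: su|exact: sv|exact: KO].
Qed.

Lemma negligible_boundsB u v : smooth_family u -> smooth_family v ->
  negligible_bounds u -> negligible_bounds v -> negligible_bounds (fun e x => u e x - v e x).
Proof.
move=> su sv mu mv K cK KO al.
apply: negligible_boundS (negligible_boundD (mu K cK KO al) (mv K cK KO al)) => //.
by move=> e x e1 Kx; apply: dnormB_le; [exact: su|exact: sv|exact: KO].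
Qed.

Lemma negligible_boundsD u v : smooth_family u -> smooth_family v ->
  negligible_bounds u -> negligible_bounds v -> negligible_bounds (fun e x => u e x + v e x).
Proof.
move=> su sv mu mv K cK KO al.
apply: negligible_boundS (negligible_boundD (mu K cK KO al) (mv K cK KO al)) => //.
by move=> e x e1 Kx; apply: dnormD_le; [exact: su|exact: sv|exact: KO].
Qed.

Lemma negligible_moderate_bounds u : negligible_bounds u -> moderate_bounds u.
Proof.
move=> nu K cK KO al; have [C [eta [C0 e0 h]]] := nu K cK KO al 0%N.
by exists 0%N, C, eta; split=> // e ee x Kx; rewrite expr0 invr1; exact: h.
Qed.

Lemma moderateM u v : moderate Om u -> moderate Om v ->
  moderate Om (fun e x => u e x * v e x).
Proof.
move=> /moderateE[su zu mu] /moderateE[sv zv mv]; apply/moderateE; split.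
- exact: smooth_familyM.
- by move=> e e1 x nx; rewrite zu// mul0r.
- exact: moderate_boundsM.
Qed.

Lemma moderateB u v : moderate Om u -> moderate Om v ->
  moderate Om (fun e x => u e x - v e x).
Proof.
move=> /moderateE[su zu mu] /moderateE[sv zv mv]; apply/moderateE; split.
- exact: smooth_familyB.
- by move=> e e1 x nx; rewrite zu// zv// subr0.
- exact: moderate_boundsB.
Qed.

(** For moderate families the difference is moderate as well, so these bounds
    alone decide the equality of classes. *)
Definition equivalent u v := negligible_bounds (fun e x => u e x - v e x).

Lemma gclassE u v : moderate Om u ->
  gclass Om u v <-> moderate Om v /\ equivalent v u.
Proof.
move=> mu; split=> [[mv [_ h]]|[mv h]]; first by split.
by split=> //; apply/negligible_familyE; split=> //; exact: moderateB.
Qed.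

Lemma equivalent_refl u : moderate Om u -> equivalent u u.
Proof.
move=> mu K cK KO al.
apply: (@negligible_boundS _ _ (fun _ _ => 0) _ K) (negligible_bound0 K) => // e x _ _.
rewrite /dnorm; have -> : (fun y => u e y - u e y) = (fun=> 0) by apply/funext => y; rewrite subrr.
rewrite mderivE; suff -> : iter_pderiv (mi_seq al) (fun _ : 'rV[R]_n => 0) = (fun=> 0).
  by rewrite normc0.
elim: (mi_seq al) => [|i s IH] //=; rewrite IH; apply/funext => y.
by apply: is_pderiv_val; exact: is_pderiv_cst.
Qed.

Lemma equivalent_sym u v : moderate Om u -> moderate Om v ->
  equivalent u v -> equivalent v u.
Proof.
move=> mu mv uv; have ru := equivalent_refl mu.
have [su _ _] := (moderateE u).1 mu; have [sv _ _] := (moderateE v).1 mv.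
have := negligible_boundsB (smooth_familyB su su) (smooth_familyB su sv) ru uv.
by congr negligible_bounds; apply/funext => e; apply/funext => x; ring.
Qed.

Lemma equivalent_trans u v w : moderate Om u -> moderate Om v -> moderate Om w ->
  equivalent u v -> equivalent v w -> equivalent u w.
Proof.
move=> /moderateE[su _ _] /moderateE[sv _ _] /moderateE[sw _ _] uv vw.
have := negligible_boundsD (smooth_familyB su sv) (smooth_familyB sv sw) uv vw.
by congr negligible_bounds; apply/funext => e; apply/funext => x; ring.
Qed.

(** The negligible families form an ideal:
    [u * v - u' * v' = (u - u') * v + (v - v') * u']. *)
Lemma equivalentM u u' v v' : moderate Om u -> moderate Om u' ->
  moderate Om v -> moderate Om v' -> equivalent u u' -> equivalent v v' ->
  equivalent (fun e x => u e x * v e x) (fun e x => u' e x * v' e x).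
Proof.
move=> /moderateE[su _ _] /moderateE[su' _ mu'] /moderateE[sv _ mv] /moderateE[sv' _ _] uu vv.
have h1 := negligible_boundsM (smooth_familyB su su') sv uu mv.
have h2 := negligible_boundsM (smooth_familyB sv sv') su' vv mu'.
have := negligible_boundsD (smooth_familyM (smooth_familyB su su') sv)
  (smooth_familyM (smooth_familyB sv sv') su') h1 h2.
by congr negligible_bounds; apply/funext => e; apply/funext => x; ring.
Qed.

Lemma gmul_gclass u v w : moderate Om u -> moderate Om v ->
  gmul Om (gclass Om u) (gclass Om v) w <->
  moderate Om w /\ equivalent w (fun e x => u e x * v e x).
Proof.
move=> mu mv; split.
  move=> [u' [v' [/(gclassE _ mu)[mu' uu'] /(gclassE _ mv)[mv' vv']]]].
  move=> /(gclassE _ (moderateM mu' mv'))[mw ww]; split=> //.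
  apply: (equivalent_trans mw (moderateM mu' mv') (moderateM mu mv) ww).
  exact: equivalentM.
move=> [mw ww]; exists u, v; split.
- by apply/gclassE => //; split=> //; exact: equivalent_refl.
- by apply/gclassE => //; split=> //; exact: equivalent_refl.
- by apply/gclassE; [exact: moderateM|].
Qed.

Lemma gmul_gclassE u v : moderate Om u -> moderate Om v ->
  gmul Om (gclass Om u) (gclass Om v) = gclass Om (fun e x => u e x * v e x).
Proof.
move=> mu mv; apply/seteqP; split=> w.
  by move=> /gmul_gclass => /(_ mu mv)[mw ww]; apply/gclassE; [exact: moderateM|].
by move=> /(gclassE _ (moderateM mu mv)) h; apply/gmul_gclass.
Qed.

Lemma compact_local_bound (V : topologicalType) (K : set V) (f : V -> R) : compact K ->
  (forall x, K x -> {for x, continuous f}) -> exists2 C, 0 < C & forall x, K x -> f x <= C.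
Proof.
move=> /compact_near_coveringP cK cf.
have : \forall C \near +oo, K `<=` (fun x => f x <= C).
  apply: cK => x Kx.
  exists ([set y | f y < f x + 1], [set C | f x + 1 <= C]) => /=.
    split; last by apply: nbhs_pinfty_ge; rewrite num_real.
    by apply: (cvgr_lt _ (cf x Kx)); rewrite ltrDl.
  by move=> [y C] /= [h1 h2]; exact: le_trans (ltW h1) h2.
move=> h; have /filter_ex[C [C0 hC]] : \forall C \near +oo, 0 < C /\ K `<=` (fun x => f x <= C).
  by apply: filterI h; apply: nbhs_pinfty_gt; exact: num_real.
by exists C.
Qed.

Lemma partials_normc_bound phi K : smooth_on Om phi -> compact K -> K `<=` Om ->
  forall s, exists2 C, 0 < C & forall x, K x -> normc (iter_pderiv s phi x) <= C.
Proof.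
move=> sp cK KO s.
have h (f : R[i] -> R) (hf : forall x, K x ->
    {for x, continuous (fun y => f (iter_pderiv s phi y))}) :
    exists2 C, 0 < C & forall x, K x -> `|f (iter_pderiv s phi x)| <= C.
  apply: compact_local_bound => // x Kx.
  exact: (continuous_comp (hf x Kx) (@norm_continuous _ R^o _)).
have [C1 C10 h1] := h (@complex.Re R) (fun x Kx => let: And3 h _ _ := sp s x (KO x Kx) in h).
have [C2 C20 h2] := h (@complex.Im R) (fun x Kx => let: And3 _ h _ := sp s x (KO x Kx) in h).
exists (C1 + C2) => [|x Kx]; first exact: addr_gt0.
by apply: le_trans (normc_le_ReIm _) (lerD _ _); [exact: h1|exact: h2].
Qed.

Lemma moderate_const phi : Csmooth Om phi -> moderate Om (fun=> phi).
Proof.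
move=> [zp sp]; apply/moderateE; split=> [e _|e _ x|] //; first exact: zp.
move=> K cK KO al; rewrite /dnorm.
have [C C0 hC] := partials_normc_bound sp cK KO (mi_seq al).
exists 0%N, C, 1; split; rewrite ?ltr01 ?lexx// => e _ x Kx.
by rewrite expr0 invr1 mulr1 mderivE; exact: hC.
Qed.

End Colombeau.

(** * Fourier transforms of compactly supported families *)

Section CompactReps.
Local Open Scope complex_scope.
Context {R : realType} {n : nat} (Om : set 'rV[R]_n) (oOm : open Om).
Context (M : nat -> R) (wM : weight_sequence M).
Implicit Types (u v h : family_of R n) (phi psi chi : cfun R n) (K : set 'rV[R]_n).
Local Notation vec := 'rV[R]_n.

Let M_gt0 p : 0 < M p. Proof. by have [[h _] _ _ _] := wM. Qed.

Lemma supp_out phi x : ~ supp phi x -> phi x = 0.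
Proof.
move=> nx; apply/eqP/negPn/negP => h; apply: nx.
exact: subset_closure.
Qed.

Lemma supp_sub phi K : closed K -> (forall x, ~ K x -> phi x = 0) -> supp phi `<=` K.
Proof.
move=> cK h; rewrite [X in _ `<=` X]((closure_id K).1 cK).
apply: closure_subset => x /= px; apply: contrapT => /h p0.
by rewrite p0 eqxx in px.
Qed.

Lemma compact_supp_sub phi psi : compact (supp phi) -> (forall x, phi x = 0 -> psi x = 0) ->
  compact (supp psi) /\ supp psi `<=` supp phi.
Proof.
move=> cphi h; have s : supp psi `<=` supp phi.
  apply: supp_sub => [|x nx]; first exact: closed_closure.
  by apply: h; exact: supp_out.
by split=> //; apply: subclosed_compact cphi s; exact: closed_closure.
Qed.

Lemma compact_box K : compact K -> exists2 B, 0 <= B & forall x : vec, K x -> in_box B x.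
Proof.
move=> /compact_bounded[B [_ hB]]; exists (`|B| + 1) => [|x Kx i].
  by rewrite addr_ge0.
apply: le_trans (row_entry_le_norm x i) _; apply: (hB (`|B| + 1)) => //.
by rewrite (le_lt_trans (ler_norm B))// ltrDl.
Qed.

Lemma smooth_global phi K : smooth_on Om phi -> closed K -> K `<=` Om ->
  supp phi `<=` K -> smooth_on setT phi /\ forall s x, ~ K x -> iter_pderiv s phi x = 0.
Proof.
move=> sp cK KO pK.
apply: (smooth_zero_off oOm (closed_openC cK)) => //.
  by apply/seteqP; split=> // x _; have [/KO|] := pselect (K x); [left|right].
by move=> x nx; apply: supp_out => /pK.
Qed.

Lemma boxed_supp phi K B : supp phi `<=` K -> (forall x, K x -> in_box B x) -> boxed B phi.
Proof. by move=> pK KB x nx; apply: supp_out => /pK /KB. Qed.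

(** Each of the [2 ^ p] terms of a derivative of order [p] is bounded by
    [M q * M (p - q)], hence by [M p]; the number of terms is absorbed by the
    geometric constant. *)
Lemma test_funM phi psi : test_fun Om M phi -> test_fun Om M psi ->
  test_fun Om M (fun x => phi x * psi x).
Proof.
move=> [[z1 s1] [c1 i1] b1] [[z2 s2] [c2 i2] b2].
have [cs ss] : compact (supp (fun x => phi x * psi x)) /\
    supp (fun x => phi x * psi x) `<=` supp phi.
  by apply: compact_supp_sub => // x ->; rewrite mul0r.
split.
- split; first by move=> x nx; rewrite z1// mul0r.
  exact: smooth_onM.
- by split=> //; exact: subset_trans i1.
move=> K cK KO; have [a1 [a10 h1]] := b1 K cK KO; have [a2 [a20 h2]] := b2 K cK KO.
pose a := Num.max 1 (Num.max a1 a2).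
have a_1 : 1 <= a by rewrite le_max lexx.
have aa1 : a1 <= a by rewrite /a !le_max lexx !orbT.
have aa2 : a2 <= a by rewrite /a !le_max lexx !orbT.
have a0 : 0 < a := lt_le_trans ltr01 a_1.
(* [2 ^+ p] terms, each with the constant [a ^+ p.+2]. *)
exists (2 * a ^+ 2); split=> [|x Kx al]; first by rewrite mulr_gt0// exprn_gt0.
have Ox := KO x Kx.
have := @dnorm_mul_le R n Om oOm (fun=> phi) (fun=> psi) al 1 x s1 s2 Ox.
move=> /le_trans; apply.
apply: (@le_trans _ _ (\sum_(p <- leibniz_splits (mi_seq al))
    (a ^+ (mi_size al).+2 * M (mi_size al)))).
  rewrite big_seq [leRHS]big_seq; apply: ler_sum => p /leibniz_splitsP[q1 q2 sz].
  have e1 := subseq_mi_seq q1; have e2 := subseq_mi_seq q2.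
  set be1 := [ffun j => count_mem j p.1]; set be2 := [ffun j => count_mem j p.2].
  have sz' : (mi_size be1 + mi_size be2 = mi_size al)%N.
    by rewrite -!size_mi_seq -e1 -e2 sz.
  have ad c (b : nat) : 0 < c -> c <= a -> c ^+ b <= a ^+ b.
    by move=> c0 ca; rewrite lerXn2r// nnegrE ltW.
  apply: le_trans (ler_pM (normc_ge0 _) (normc_ge0 _) (h1 x Kx be1) (h2 x Kx be2)) _.
  rewrite mulrACA -sz'; apply: ler_pM.
  - by rewrite mulr_ge0// exprn_ge0// ltW.
  - by rewrite mulr_ge0// ltW.
  - have -> : ((mi_size be1 + mi_size be2).+2 = (mi_size be1).+1 + (mi_size be2).+1)%N.
      by rewrite addSn addnS.
    rewrite exprD; apply: ler_pM; rewrite ?exprn_ge0 ?(ltW a10) ?(ltW a20)//.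
      exact: ad.
    exact: ad.
  - exact: weight_sequence_mul.
rewrite big_const_seq count_predT size_leibniz_splits size_mi_seq iter_addr_0.
rewrite -[(_ * _) *+ _]mulr_natl mulrA ler_pM2r// natrX exprMn -exprM.
apply: ler_pM; rewrite ?exprn_ge0 ?(ltW a0)//.
  by rewrite exprS ler_peMl ?exprn_ge0// ler1n.
rewrite ler_weXn2l// mul2n -addnn addSn addnS; lia.
Qed.

Definition fsymbol h : R -> vec -> R := fun e xi => normc (fourier (h e) xi).

Lemma fsymbol_ge0 h e xi : 0 <= fsymbol h e xi. Proof. exact: normc_ge0. Qed.

Lemma affine_decays_at h G xi : open_cone G -> G xi -> affine_decay M h G ->
  decays_at M (fsymbol h) xi.
Proof.
move=> oG Gx [a [b [C [k [e0 [[a0 b0] [C0 k0] /andP[e00 e01] H]]]]]].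
pose c := Num.max 1 (Num.max (Num.max a b) (Num.max C (Num.max k^-1 e0^-1))).
have c1 : 1 <= c by rewrite le_max lexx.
have ca : a <= c by rewrite /c !le_max lexx !orbT.
have cb : b <= c by rewrite /c !le_max lexx !orbT.
have cC : C <= c by rewrite /c !le_max lexx !orbT.
have ck : k^-1 <= c by rewrite /c !le_max lexx !orbT.
have ce : e0^-1 <= c by rewrite /c !le_max lexx !orbT.
have c0 := lt_le_trans ltr01 c1.
exists G, c; split=> // e z es Gz; have /andP[ep ec] := es.
have e1 := small_le1 c1 es.
have ee0 : e <= e0.
  by apply: le_trans ec _; rewrite -[leRHS]invrK lef_pV2 ?posrE// invr_gt0.
apply: le_trans (H e z _ Gz) _; first by rewrite ep.
rewrite /decay; apply: ler_pM.
- by rewrite mulr_ge0 ?powR_ge0// ltW.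
- exact: expR_ge0.
- apply: ler_pM; rewrite ?powR_ge0 ?(ltW C0)//.
  by apply: ger_powR => //; rewrite lerN2.
rewrite ler_expR lerN2; apply: (le_assoc_fun wM).
rewrite ler_wpM2r ?enorm_ge0//; apply: ler_pM; rewrite ?powR_ge0 ?invr_ge0 ?(ltW c0)//.
  by rewrite -[leRHS]invrK lef_pV2 ?posrE// invr_gt0.
exact: ger_powR.
Qed.

Lemma decays_affine h xi : decays_at M (fsymbol h) xi ->
  exists G, [/\ open_cone G, G xi & affine_decay M h G].
Proof.
move=> [G [c [oG Gx c1 H]]]; exists G; split=> //.
have c0 := lt_le_trans ltr01 c1.
exists c, c, c, c^-1, c^-1; split.
- by split; exact: ltW.
- by rewrite invr_gt0.
- by rewrite invr_gt0 c0 le_invr1.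
- by move=> e z es Gz; exact: H.
Qed.

(** Recording that the derivatives vanish off [K] turns bounds on [K] into
    bounds on the whole space. *)
Definition compact_family h K B :=
  [/\ 0 <= B, (forall x, K x -> in_box B x),
     compact K /\ K `<=` Om &
     forall e : R, 0 < e <= 1 -> [/\ smooth_on setT (h e), boxed B (h e) &
        forall s x, ~ K x -> iter_pderiv s (h e) x = 0]].

Lemma compact_familyP h K : smooth_family Om h -> compact K -> K `<=` Om ->
  (forall e : R, 0 < e <= 1 -> supp (h e) `<=` K) ->
  exists B0, 0 <= B0 /\ forall B, B0 <= B -> compact_family h K B.
Proof.
move=> sh cK KO hK; have [B0 B00 KB] := compact_box cK.
exists B0; split=> // B BB; split=> //; first exact: le_trans BB.
  by move=> x /KB; exact: in_boxW.
move=> e e1.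
have ck : closed K by apply: compact_closed => //; exact: norm_hausdorff.
have [h1 h2] := smooth_global (sh e e1) ck KO (hK e e1).
split=> //; apply: boxed_supp (hK e e1) _ => x /KB; exact: in_boxW.
Qed.

Lemma compact_family_cboxed h K B e : compact_family h K B -> 0 < e <= 1 ->
  cboxed B (h e).
Proof.
move=> [_ _ _ H] e1; have [s b _] := H e e1.
exact: (cboxed_iter_pderiv [::] s b).
Qed.

Lemma fsymbol_weight_le h K B e s (A : R) (xi : vec) : compact_family h K B -> 0 < e <= 1 ->
  (forall al x, K x -> dnorm h (double_index s al) e x <= A) -> 0 <= A ->
  \prod_(i <- s) `|xi ord0 i| * fsymbol h e xi <=
  weight xi * (A * (2 ^+ n * (2 * (2 * B) ^+ n))).
Proof.
move=> [B0 KB [cK KO] H] e1 hA A0; have [sh bh zh] := H e e1.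
apply: le_trans (@fourier_weight_bound _ _ B (h e) s (fun=> A) xi B0 sh bh _) _.
  move=> al x; have [Kx|nKx] := pselect (K x); first exact: hA.
  by rewrite mderivE zh// normc0.
rewrite ler_wpM2l ?(ltW (weight_gt0 _))// sumr_const card_ffun card_bool card_ord.
have -> : A *+ 2 ^ n = A * 2 ^+ n by rewrite -[A *+ _]mulr_natr natrX.
by rewrite -mulrA.
Qed.

Lemma fsymbol_bound h K B : compact_family h K B -> moderate_bounds Om h ->
  symbol_bound (fsymbol h).
Proof.
move=> cf mh; have [B0 KB [cK KO] H] := cf.
pose Q := fun e (x : vec) => \sum_(al <- index_enum {ffun 'I_n -> bool})
   dnorm h (double_index [::] al) e x.
have [m [C [eta [C0 /andP[e0 e1] hC]]]] : moderate_bound Q K.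
  by apply: (@moderate_bound_sum _ _ _ _ (fun al e x => dnorm h (double_index [::] al) e x)) => al _; exact: mh.
pose V := 2 ^+ n * (2 * (2 * B) ^+ n).
have V0 : 0 <= V by rewrite !mulr_ge0 ?exprn_ge0// mulr_ge0.
pose c := Num.max 1 (Num.max eta^-1 (Num.max m%:R (C * V))).
have c1 : 1 <= c by rewrite le_max lexx.
have ce : eta^-1 <= c by rewrite /c !le_max lexx !orbT.
have cm : m%:R <= c by rewrite /c !le_max lexx !orbT.
have cC : C * V <= c by rewrite /c !le_max lexx !orbT.
have c0 := lt_le_trans ltr01 c1.
exists c => // e xi es; have /andP[ep ec] := es.
have e01 := small_le1 c1 es.
have ee : e <= eta.
  by apply: le_trans ec _; rewrite -[leRHS]invrK lef_pV2 ?posrE// invr_gt0.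
have Cm0 : 0 <= C * e ^- m by rewrite mulr_ge0 ?invr_ge0 ?exprn_ge0 ?ltW.
have := @fsymbol_weight_le h K B e [::] (C * e ^- m) xi cf e01 _ Cm0.
rewrite big_nil mul1r => /(_ _)/le_trans; apply.
  move=> al x Kx; apply: le_trans (hC e _ x Kx); last by rewrite ep.
  rewrite /Q (bigD1_seq al) ?index_enum_uniq ?mem_index_enum//= lerDl.
  by apply: sumr_ge0 => be _; exact: dnorm_ge0.
rewrite mulrC ler_wpM2r ?(ltW (weight_gt0 _))// -/V mulrAC; apply: ler_pM.
- by rewrite mulr_ge0// ltW.
- by rewrite invr_ge0 exprn_ge0// ltW.
- exact: cC.
- by rewrite -powR_mulrn ?(ltW ep)// -powRN; apply: ger_powR => //; rewrite lerN2.
Qed.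

(** Differentiating [p] times in the coordinate where [xi] is largest bounds
    the transform by [c ^+ p * M p / enorm xi ^+ p], up to a constant factor;
    the infimum over [p] is the decay. *)
Lemma test_fun_decays chi eta : test_fun Om M chi -> eta != 0 ->
  decays_at M (fsymbol (fun=> chi)) eta.
Proof.
move=> [[zc sc] [cc ic] bc] eta0.
have [B [B0 hB]] := @compact_familyP (fun=> chi) (supp chi) (fun e _ => sc) cc ic
  (fun e _ => @subset_refl _ _).
have cf : compact_family (fun=> chi) (supp chi) B by exact: hB.
have [_ KB _ H] := cf.
have [] := H 1; first by rewrite ltr01 lexx.
move=> sch bch zch.
have [a [a0 ha]] := bc _ cc ic.
pose V := 2 * (2 * B) ^+ n.
have V0 : 0 <= V by rewrite mulr_ge0// exprn_ge0// mulr_ge0.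
pose c := Num.max 1 (Num.max (a * V + 1) (n.+1%:R * a)).
have c1 : 1 <= c by rewrite le_max lexx.
have cV : a * V + 1 <= c by rewrite /c !le_max lexx !orbT.
have cn : n.+1%:R * a <= c by rewrite /c !le_max lexx !orbT.
have c0 := lt_le_trans ltr01 c1.
have na0 : 0 < n.+1%:R * a by rewrite mulr_gt0.
exists [set xi : vec | 0 < enorm xi], c; split=> //.
- split.
  + rewrite openE => v /= v0; exact: (cvgr_gt _ (@continuous_enorm R n v) _ v0).
  + by rewrite /= -(scale0r (0 : vec)) enormZ// mul0r ltxx.
  + by move=> t xi t0 /= x0; rewrite enormZ ?mulr_gt0// ltW.
- exact: enorm_gt0.
move=> e xi es xi0; have e01 := small_le1 c1 es; have /andP[ep ec] := e01.
(* The coordinate in which to differentiate. *)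
have [i hi] : exists i, `|xi| <= `|xi ord0 i|.
  have xn0 : xi != 0.
    by apply: contraTneq xi0 => ->; rewrite -(scale0r (0 : vec)) enormZ// mul0r ltxx.
  have [i0 _] : exists i, xi 0 i != 0 by exact/rV0Pn.
  have [i _ hi] := @arg_maxP _ _ _ i0 xpredT (fun i => `|xi ord0 i|) isT.
  by exists i; apply: row_norm_le => // j; exact: hi.
have key p : fsymbol (fun=> chi) e xi * (enorm xi / (n.+1%:R * a)) ^+ p <= (a * V + 1) * M p.
  pose al : multi_index n := [ffun j => if j == i then p else 0%N].
  have sal : mi_size al = p.
    rewrite /mi_size (bigD1 i)//= ffunE eqxx big1 ?addn0// => j ji.
    by rewrite ffunE (negbTE ji).
  have pal : \prod_(j <- mi_seq al) `|xi ord0 j| = `|xi ord0 i| ^+ p.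
    rewrite prod_mi_seq (bigD1 i)//= ffunE eqxx big1 ?mulr1// => j ji.
    by rewrite ffunE (negbTE ji) expr0.
  have h1 : `|xi ord0 i| ^+ p * fsymbol (fun=> chi) e xi <= a ^+ p.+1 * M p * V.
    rewrite -pal -(normc_fourier_iter_pderiv _ _ B0 sch bch).
    apply: fourier_bound B0 (cboxed_iter_pderiv _ sch bch) _ => x.
    have [Kx|nKx] := pselect (supp chi x).
      by rewrite -mderivE -sal; exact: ha.
    by rewrite zch// normc0 mulr_ge0 ?exprn_ge0// ltW.
  have h2 : (enorm xi / (n.+1%:R * a)) ^+ p <= (`|xi ord0 i| / a) ^+ p.
    rewrite lerXn2r ?nnegrE ?divr_ge0 ?enorm_ge0 ?(ltW na0) ?(ltW a0)//.
    rewrite invfM mulrA ler_pM2r ?invr_gt0// ler_pdivrMr// mulrC.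
    by apply: le_trans (enorm_le_norm _) _; rewrite ler_wpM2l.
  apply: le_trans (ler_wpM2l (fsymbol_ge0 _ _ _) h2) _.
  rewrite exprMn mulrCA mulrA exprVn ler_pdivrMr ?exprn_gt0//.
  apply: le_trans h1 _; rewrite exprS.
  have -> : a * a ^+ p * M p * V = (a * V) * (M p * a ^+ p) by ring.
  rewrite -[leRHS]mulrA ler_wpM2r ?lerDl//.
  by rewrite mulr_ge0 ?exprn_ge0 ?(ltW a0) ?(ltW (M_gt0 p)).
apply: le_trans (assoc_fun_inf wM (_ : 0 <= enorm xi / (n.+1%:R * a)) _ key) _.
- by rewrite divr_ge0 ?enorm_ge0// ltW.
- by rewrite ltr_wpDl// mulr_ge0// ltW.
rewrite /decay; apply: ler_pM.
- by rewrite addr_ge0// mulr_ge0// ltW.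
- exact: expR_ge0.
- apply: le_trans cV _; rewrite ler_peMr ?(ltW c0)//.
  by rewrite -(powRr0 e); apply: ger_powR => //; rewrite oppr_le0 ltW.
rewrite ler_expR lerN2; apply: (le_assoc_fun wM).
rewrite [leRHS]mulrC ler_wpM2r ?enorm_ge0// -[leRHS]mulr1; apply: ler_pM.
- by rewrite invr_ge0 ltW.
- exact: powR_ge0.
- by rewrite lef_pV2 ?posrE.
- by rewrite -[leRHS](powRr0 e); apply: ger_powR => //; exact: ltW.
Qed.

End CompactReps.

(** * Products of compactly supported families *)

Section Products.
Local Open Scope complex_scope.
Context {R : realType} {n : nat} (Om : set 'rV[R]_n) (oOm : open Om).
Context (M : nat -> R) (wM : weight_sequence M).
Local Notation vec := 'rV[R]_n.
Implicit Types (h k : family_of R n) (chi phi psi : cfun R n).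

Lemma fourierB B (u v : cfun R n) xi : cboxed B u -> cboxed B v ->
  fourier (fun x => u x - v x) xi = fourier u xi - fourier v xi.
Proof.
move=> bu bv; rewrite !fourierE.
have bku := cboxed_kernel xi bu; have bkv := cboxed_kernel xi bv.
rewrite -[X in _ = _ + X]mulN1r -(cintZ (-1) bkv) -(cintD bku); last exact: cboxedZ.
by congr cint; apply/funext => x; ring.
Qed.

Lemma fourierZ B c (u : cfun R n) xi : cboxed B u ->
  fourier (fun x => c * u x) xi = c * fourier u xi.
Proof.
move=> bu; rewrite !fourierE -(cintZ c (cboxed_kernel xi bu)).
by congr cint; apply/funext => x; rewrite mulrA.
Qed.

(** Small enough for the box of size [B] to fit strictly into a period, and at
    most 1, as [summable_weight] requires. *)
Definition mesh (B : R) := (B + 1)^-1.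

Lemma mesh_gt0 B : 0 <= B -> 0 < mesh B.
Proof. by move=> B0; rewrite invr_gt0 ltr_wpDl. Qed.

Lemma mesh_le1 B : 0 <= B -> mesh B <= 1.
Proof. by move=> B0; rewrite invf_le1 ?ltr_wpDl// lerDr. Qed.

Lemma mesh_period B : 0 <= B -> mesh B * (2 * B) < pi *+ 2.
Proof.
move=> B0; have p := pi_ge2 R; rewrite mulrC ltr_pdivrMr ?ltr_wpDl//.
apply: (@lt_le_trans _ _ (2 * (B + 1))); first by rewrite ltr_pM2l// ltrDl.
by rewrite ler_wpM2r ?addr_ge0// mulr2n; move: p; lra.
Qed.

(** The volume of a period of the lattice of frequencies [mesh B], the
    normalising factor of the Fourier series. It is at least 1, so that it can
    be dropped from upper bounds. *)
Definition volume (B : R) : R := ((pi *+ 2) / mesh B) ^+ n.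

Lemma volume_ge1 B : 0 <= B -> 1 <= volume B.
Proof.
move=> B0; have p := pi_ge2 R; rewrite exprn_ege1// ler_pdivlMr ?mesh_gt0// mul1r.
by apply: le_trans (mesh_le1 B0) _; rewrite mulr2n; move: p; lra.
Qed.

Lemma rapid_fourier B (u : cfun R n) theta : 0 <= B -> 0 < theta <= 1 ->
  smooth_on setT u -> boxed B u ->
  rapid theta (fun k : {ffun 'I_n -> int} => fourier u (freq theta k)).
Proof.
move=> B0 /andP[t0 t1] su bu s.
have [C C0 hC] := fourier_weight_ex s B0 su bu.
have [W W0 hW] := @summable_weight R n theta t0 t1.
exists (C * W) => r ur.
apply: (@le_trans _ _ (\sum_(k <- r) C * weight (0 - freq theta k))).
  by apply: ler_sum => k _; rewrite sub0r weightN; exact: hC.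
by rewrite -mulr_sumr ler_wpM2l//; exact: hW.
Qed.

Lemma decays_scale a (xi : vec) t : 0 < t -> decays_at M a xi -> decays_at M a (t *: xi).
Proof.
move=> t0 [G [c [oG Gx c1 H]]]; exists G, c; split=> //.
by have [_ _ h] := oG; exact: h.
Qed.

Definition compact_moderate h := moderate Om h /\
  exists K, [/\ compact K, K `<=` Om & forall e : R, 0 < e <= 1 -> supp (h e) `<=` K].

Lemma compact_moderate_family h : compact_moderate h ->
  exists K B0, 0 <= B0 /\ forall B, B0 <= B -> compact_family Om h K B.
Proof.
move=> [/moderateE[sh _ _] [K [cK KO hK]]]; exists K.
exact: (compact_familyP oOm sh cK KO hK).
Qed.

Lemma compact_moderate_bounds h : compact_moderate h -> moderate_bounds Om h.
Proof. by move=> [/moderateE[]]. Qed.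

Lemma compact_moderate_test chi : test_fun Om M chi -> compact_moderate (fun=> chi).
Proof.
move=> [cc [k1 k2] _]; split; first exact: moderate_const.
by exists (supp chi); split=> // e _; exact: subset_refl.
Qed.

Lemma compact_moderateM h k : compact_moderate h -> compact_moderate k ->
  compact_moderate (fun e x => h e x * k e x).
Proof.
move=> [mh [K [cK KO hK]]] [mk _]; split; first exact: moderateM.
exists K; split=> // e e1; apply: supp_sub.
  by apply: compact_closed => //; exact: norm_hausdorff.
by move=> x nx; rewrite (supp_out (phi := h e)) ?mul0r// => /(hK e e1).
Qed.

Lemma usum_normc_le (c : {ffun 'I_n -> int} -> R[i]) l f W : is_usum c l ->
  (forall j, normc (c j) <= f j) ->
  (forall s, uniq s -> \sum_(j <- s) f j <= W) -> normc l <= W.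
Proof.
move=> cl cf fW; apply: is_usum_bound cl _ => s us.
apply: le_trans (normc_sum _ _ _) _; apply: le_trans (fW s us).
by apply: ler_sum => j _; exact: cf.
Qed.

(** On a common box [h] is its Fourier series, so the transform of the product
    is a discrete convolution, to which [symbol_product] applies. *)
Lemma product_decays h k xi0 : compact_moderate h -> compact_moderate k -> xi0 != 0 ->
  (forall z eta : vec, (z, eta) != 0 ->
     dotp (z + eta) xi0 = enorm (z + eta) * enorm xi0 ->
     decays_at M (fsymbol h) z \/ decays_at M (fsymbol k) eta) ->
  decays_at M (fsymbol (fun e x => h e x * k e x)) xi0.
Proof.
move=> ch ck xi00 hyp.
have [K1 [B1 [B10 f1]]] := compact_moderate_family ch.
have [K2 [B2 [B20 f2]]] := compact_moderate_family ck.
pose B := Num.max B1 B2.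
have {}f1 : compact_family Om h K1 B by apply: f1; rewrite le_max lexx.
have {}f2 : compact_family Om k K2 B by apply: f2; rewrite le_max lexx orbT.
have B0 : 0 <= B by rewrite le_max B10.
have t01 : 0 < mesh B <= 1 by rewrite mesh_gt0// mesh_le1.
have [G [c [oG Gx c1 H]]] := symbol_product wM (fsymbol_ge0 h) (fsymbol_ge0 k)
  (fsymbol_bound f1 (compact_moderate_bounds ch))
  (fsymbol_bound f2 (compact_moderate_bounds ck)) t01 xi00 hyp.
exists G, c; split=> // e xi es Gxi; have e1 := small_le1 c1 es.
have b1 := compact_family_cboxed f1 e1; have b2 := compact_family_cboxed f2 e1.
have [_ _ _ /(_ e e1)[sh bh _]] := f1.
have rh := rapid_fourier B0 t01 sh bh; have [W hW] := rapid_summable rh.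
pose g : cfun R n := fun x => (volume B)%:C * h e x.
have bg : cboxed B g by exact: cboxedZ.
have ig x : in_box B x -> is_usum (fun j => fourier (h e) (freq (mesh B) j) *
    expi (dotp x (freq (mesh B) j))) (g x).
  move=> xB; exact: (fourier_series_inversion (mesh_gt0 B0) B0 (mesh_period B0) b1 xB hW).
have := usum_fourierM xi B0 hW bg.1 b2 ig.
have -> : fourier (fun x => g x * k e x) xi =
    (volume B)%:C * fourier (fun x => h e x * k e x) xi.
  rewrite -(fourierZ _ _ (cboxedMr b1 b2.1)); congr fourier.
  by apply/funext => x; rewrite mulrA.
move=> /usum_normc_le hb; apply: le_trans (hb _ _ _ (H e xi es Gxi)); last first.
  by move=> j; rewrite normcM.
have v1 := volume_ge1 B0.
by rewrite normcM normcZ ger0_norm ?(le_trans ler01 v1)// ler_peMl ?normc_ge0.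
Qed.

(** If [eta != 0] then [b] decays at [eta]; if [eta = 0] then [z] is a positive
    multiple of [xi0], where [a] decays. *)
Lemma decays_pair_left (a b : R -> vec -> R) xi0 : xi0 != 0 -> decays_at M a xi0 ->
  (forall eta, eta != 0 -> decays_at M b eta) ->
  forall z eta : vec, (z, eta) != 0 ->
     dotp (z + eta) xi0 = enorm (z + eta) * enorm xi0 ->
     decays_at M a z \/ decays_at M b eta.
Proof.
move=> xi00 hd hb z eta; have [->|eta0 _ _] := eqVneq eta 0; last by right; exact: hb.
rewrite addr0 => z0 /(dotp_eq_enorm xi00)[t t0 zt]; left; rewrite zt.
apply: decays_scale => //; rewrite lt_neqAle t0 andbT eq_sym.
by apply: contraNneq z0 => t0'; rewrite zt t0' scale0r.
Qed.

Lemma decays_cutoff h chi xi0 : compact_moderate h -> test_fun Om M chi -> xi0 != 0 ->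
  decays_at M (fsymbol h) xi0 ->
  decays_at M (fsymbol (fun e x => h e x * chi x)) xi0.
Proof.
move=> ch tc xi00 hd; apply: (product_decays ch (compact_moderate_test tc) xi00).
by apply: decays_pair_left => // eta; exact: (test_fun_decays oOm wM tc).
Qed.

(** Two representatives of the same class may decay in different directions.
    Their difference has negligible Fourier coefficients, so one may switch
    from one representative to the other frequency by frequency, keeping on the
    lattice the smaller of the two coefficients. The series obtained is
    periodic, whence the cutoff [chi]. *)
Lemma combine_decays h1 h2 chi : compact_moderate h1 -> compact_moderate h2 ->
  equivalent Om h1 h2 -> test_fun Om M chi ->
  exists h, [/\ compact_moderate h, equivalent Om h (fun e x => chi x * h1 e x) &
    forall xi0, xi0 != 0 ->
      decays_at M (fsymbol h1) xi0 \/ decays_at M (fsymbol h2) xi0 ->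
      decays_at M (fsymbol h) xi0].
Proof.
move=> ch1 ch2 eqh tc.
have cc := compact_moderate_test tc.
have [K1 [B1 [B10 f1]]] := compact_moderate_family ch1.
have [K2 [B2 [B20 f2]]] := compact_moderate_family ch2.
have [K3 [B3 [B30 f3]]] := compact_moderate_family cc.
have [/moderateE[s1 _ m1] _] := ch1; have [/moderateE[s2 _ m2] _] := ch2.
have [/moderateE[sc _ mc] _] := cc.
pose B := Num.max B1 (Num.max B2 B3).
have {}f1 : compact_family Om h1 K1 B by apply: f1; rewrite le_max lexx.
have {}f2 : compact_family Om h2 K2 B by apply: f2; rewrite !le_max lexx orbT.
have {}f3 : compact_family Om (fun=> chi) K3 B by apply: f3; rewrite !le_max lexx !orbT.
have B0 : 0 <= B by rewrite le_max B10.
have t01 : 0 < mesh B <= 1 by rewrite mesh_gt0// mesh_le1.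
have v1 := volume_ge1 B0; have v0 : 0 < volume B := lt_le_trans ltr01 v1.
have vc : (volume B)%:C * ((volume B)^-1)%:C = 1.
  by rewrite -rmorphM /= mulfV// gt_eqF.
pose fq := @freq R n (mesh B).
pose nn : family_of R n := fun e x => h1 e x - h2 e x.
have snn e : 0 < e <= 1 -> smooth_on setT (nn e) /\ boxed B (nn e).
  move=> e1; have [_ _ _ /(_ e e1)[q1 b1 _]] := f1; have [_ _ _ /(_ e e1)[q2 b2 _]] := f2.
  split; first by apply: smooth_onB => //; exact: openT.
  by move=> x nx; rewrite /nn b1// b2// subr0.
(* Subtracting the series of coefficients [c e] exchanges the coefficient of
   [h1] for that of [h2] where the latter is smaller. *)
pose c e (j : {ffun 'I_n -> int}) : R[i] :=
  if fsymbol h2 e (fq j) < fsymbol h1 e (fq j)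
  then ((volume B)^-1)%:C * fourier (nn e) (fq j) else 0.
have cn e j : normc (c e j) <= fsymbol nn e (fq j).
  rewrite /c; case: ifP => _; last by rewrite normc0 normc_ge0.
  rewrite normcM normcZ ger0_norm ?invr_ge0 ?(ltW v0)// ler_piMl ?normc_ge0//.
  by rewrite invf_le1.
have rc e : 0 < e <= 1 -> rapid (mesh B) (c e).
  move=> e1 s; have [sn bn] := snn e e1.
  have [W hW] := rapid_fourier B0 t01 sn bn s; exists W.
  apply: summable_byW hW => j; apply: ler_wpM2l; last exact: cn.
  exact: prodr_ge0.
pose T : family_of R n := fun e => trig_series (mesh B) (c e).
have sT e : 0 < e <= 1 -> smooth_on setT (T e).
  by move=> e1; apply: smooth_trig; exact: rc.
have sTO : smooth_family Om T by move=> e e1; apply: smooth_onS (sT e e1).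
have nT : negligible_bounds Om T.
  move=> K cK KO al m; pose s := mi_seq al.
  have cnn : compact_family Om nn (K1 `|` K2) B.
    have [_ KB1 [cK1 KO1] g1] := f1; have [_ KB2 [cK2 KO2] g2] := f2.
    split=> //; first by move=> x [/KB1|/KB2].
      split; first exact: compactU.
      by move=> x [/KO1|/KO2].
    move=> e e1; have [sn bn] := snn e e1; split=> // s' x /not_orP[x1 x2].
    have [q1 _ z1] := g1 e e1; have [q2 _ z2] := g2 e e1.
    by rewrite (iter_pderivB _ openT q1 q2)// z1// z2// subr0.
  have [_ _ [cKK KKO] _] := cnn.
  (* The derivatives of [nn] that control the derivative [al] of the series. *)
  pose Q := fun e (x : vec) => \sum_(be <- index_enum {ffun 'I_n -> bool})
     dnorm nn (double_index s be) e x.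
  have nQ : negligible_bound Q (K1 `|` K2).
    apply: (@negligible_bound_sum _ _ _ _ (fun be e x => dnorm nn (double_index s be) e x)).
    by move=> be _; exact: eqh.
  have [C [eta [C0 eta01 hC]]] := nQ m.
  have [W W0 hW] := @summable_weight R n (mesh B) (mesh_gt0 B0) (mesh_le1 B0).
  pose V := 2 ^+ n * (2 * (2 * B) ^+ n).
  have V0 : 0 <= V by rewrite !mulr_ge0 ?exprn_ge0// mulr_ge0.
  have CV : 0 <= C * V * W.
    by apply: mulr_ge0; [apply: mulr_ge0 => //; exact: ltW|exact: ltW].
  exists (C * V * W + 1), eta; split=> //; first by rewrite ltr_wpDl.
  move=> e es x _; have e1 : 0 < e <= 1.
    by case/andP: es => -> /le_trans; apply; case/andP: eta01.
  have em : 0 <= e ^+ m by rewrite exprn_ge0//; case/andP: e1 => /ltW.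
  apply: (@le_trans _ _ ((C * e ^+ m * V) * W)); last first.
    have -> : C * e ^+ m * V * W = C * V * W * e ^+ m by ring.
    by rewrite ler_wpM2r// lerDl.
  rewrite /dnorm mderivE; apply: iter_pderiv_trig_bound; first exact: rc.
  move=> r ur; apply: (@le_trans _ _ (\sum_(j <- r) (C * e ^+ m * V) * weight (0 - fq j))); last first.
    rewrite -mulr_sumr; apply: ler_wpM2l; last exact: hW.
    by apply: mulr_ge0 => //; apply: mulr_ge0 => //; exact: ltW.
  apply: ler_sum => j _; rewrite sub0r weightN [leRHS]mulrC.
  apply: (@le_trans _ _ (\prod_(i <- s) `|fq j ord0 i| * fsymbol nn e (fq j))).
    by apply: ler_wpM2l; [exact: prodr_ge0|exact: cn].
  have Cm0 : 0 <= C * e ^+ m by rewrite mulr_ge0// ltW.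
  apply: (@fsymbol_weight_le _ _ Om nn (K1 `|` K2) B e s (C * e ^+ m) (fq j) cnn e1 _ Cm0).
  move=> be y Ky; apply: le_trans (hC e es y Ky).
  rewrite /Q (bigD1_seq be) ?index_enum_uniq ?mem_index_enum//= lerDl.
  by apply: sumr_ge0 => ? _; exact: dnorm_ge0.
pose h : family_of R n := fun e x => chi x * (h1 e x - T e x).
have mh : moderate Om h.
  apply/moderateE; split.
  - exact: (smooth_familyM oOm sc (smooth_familyB oOm s1 sTO)).
  - move=> e e1 x nx; rewrite /h; have [[z _] _ _] := tc.
    by rewrite z// mul0r.
  - exact: (moderate_boundsM oOm sc (smooth_familyB oOm s1 sTO) mc
      (moderate_boundsB oOm s1 sTO m1 (negligible_moderate_bounds nT))).
exists h; split.
- split=> //; have [_ [K [cK KO hK]]] := cc.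
  exists K; split=> // e e1; apply: supp_sub.
    by apply: compact_closed => //; exact: norm_hausdorff.
  by move=> x nx; rewrite /h (supp_out (phi := chi)) ?mul0r// => /(hK e e1).
- have nchi : Csmooth Om (fun x => (-1) * chi x).
    have [[z sm] _ _] := tc; split; first by move=> x nx; rewrite z// mulr0.
    exact: smooth_onZ.
  have /moderateE[sn _ mn] := moderate_const nchi.
  have := negligible_boundsM oOm sTO sn nT mn.
  by congr negligible_bounds; apply/funext => e; apply/funext => x; rewrite /h; ring.
move=> xi0 xi00 hd.
pose a e z := Num.min (fsymbol h1 e z) (fsymbol h2 e z).
have a0 e z : 0 <= a e z by rewrite le_min !fsymbol_ge0.
have ba : symbol_bound a.
  have [c0 c01 H] := fsymbol_bound f1 m1; exists c0 => // e xi es.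
  by apply: le_trans (H e xi es); rewrite ge_min lexx.
have da : decays_at M a xi0.
  case: hd => -[G [c0 [oG Gx c01 H]]]; exists G, c0; split=> // e xi es Gxi.
    by apply: le_trans (H e xi es Gxi); rewrite ge_min lexx.
  by apply: le_trans (H e xi es Gxi); rewrite ge_min lexx orbT.
have hyp := decays_pair_left xi00 da (fun eta => test_fun_decays oOm wM tc).
have [G [c0 [oG Gx c01 H]]] := symbol_product wM a0 (fsymbol_ge0 (fun=> chi)) ba
  (fsymbol_bound f3 mc) t01 xi00 hyp.
exists G, c0; split=> // e xi es Gxi; have e1 := small_le1 c01 es.
have b1 := compact_family_cboxed f1 e1; have b2 := compact_family_cboxed f2 e1.
have b3 := compact_family_cboxed f3 e1.
have [_ _ _ /(_ e e1)[sh1 bh1 _]] := f1.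
have rh := rapid_fourier B0 t01 sh1 bh1; have [W1 hW1] := rapid_summable rh.
have [W2 hW2] := rapid_summable (rc e e1).
(* Up to the factor [volume B], the coefficients of the series that represents
   [h1 - T] on the box. *)
pose d j := fourier (h1 e) (fq j) + (- (volume B)%:C) * c e j.
have da' j : normc (d j) = a e (fq j).
  rewrite /d /c /a; case: ltP => hlt; last by rewrite mulr0 addr0.
  rewrite mulNr mulrA vc mul1r (fourierB _ b1 b2).
  by congr normc; ring.
have dW : summable_by W1 (fun j => normc (d j)).
  by apply: summable_byW hW1 => j; rewrite da' ge_min lexx.
have cT : ccont (T e) := smooth_ccont [::] (sT e e1).
pose g : cfun R n := fun x => (volume B)%:C * h1 e x + (- (volume B)%:C) * T e x.
have cg : ccont g.
  apply: ccontD; apply: ccontM => //; try exact: ccont_cst.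
  exact: b1.1.
have ig x : in_box B x -> is_usum (fun j => d j * expi (dotp x (fq j))) (g x).
  move=> xB.
  have := is_usumD
    (fourier_series_inversion (mesh_gt0 B0) B0 (mesh_period B0) b1 xB hW1)
    (is_usumZ (- (volume B)%:C) (is_usum_trig (mesh B) x hW2)).
  by congr is_usum; apply/funext => j; rewrite /d mulrDl !mulrA.
have := usum_fourierM xi B0 dW cg b3 ig.
have bh : cboxed B (h e).
  have cm : ccont (fun x => h1 e x - T e x).
    have := ccontD b1.1 (ccontM (ccont_cst n (-1)) cT).
    by congr ccont; apply/funext => x; rewrite mulN1r.
  exact: cboxedMr b3 cm.
have -> : fourier (fun x => g x * chi x) xi = (volume B)%:C * fourier (h e) xi.
  rewrite -(fourierZ _ _ bh); congr fourier.
  by apply/funext => x; rewrite /g /h; ring.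
move=> /usum_normc_le hb; apply: le_trans (hb _ _ _ (H e xi es Gxi)); last first.
  by move=> j; rewrite normcM da'.
by rewrite normcM normcZ (ger0_norm (ltW v0)) ler_peMl ?normc_ge0.
Qed.

End Products.

(** * The wave front set of a product *)

Section WaveFront.
Context {R : realType} {n : nat} (Om : set 'rV[R]_n) (oOm : open Om).
Context (M : nat -> R) (wM : weight_sequence M).
Local Notation vec := 'rV[R]_n.
Implicit Types (f g h k : family_of R n) (phi psi : cfun R n) (xi : vec).

(** The cutoff is kept as a parameter because merging and multiplying local
    representatives multiplies their cutoffs. *)
Definition local_repr f (x0 : vec) phi h := [/\ test_fun Om M phi, \forall y \near x0, phi y = 1,
  compact_moderate Om h & equivalent Om h (fun e x => phi x * f e x)].

Lemma moderate_test phi : test_fun Om M phi -> moderate Om (fun=> phi).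
Proof. by move=> tp; have [] := compact_moderate_test tp. Qed.

(** The product of the class of [f] by a test function is the class of the
    product, so that regularity is a statement about families only. *)
Lemma notin_WF f (x0 xi : vec) : moderate Om f -> Om x0 -> xi != 0 ->
  ~ WF_A Om M (gclass Om f) (x0, xi) <->
  exists phi h, local_repr f x0 phi h /\ decays_at M (fsymbol h) xi.
Proof.
move=> mf Ox xi0; split=> [nWF|[phi [h [[tp p1 ch eqh] dh]]]].
  have [phi [tp p1 nS]] : exists phi, [/\ test_fun Om M phi, \forall y \near x0, phi y = 1 &
      ~ Sigma_A Om M (gmul Om (gconst Om phi) (gclass Om f)) xi].
    by apply: contrapT => h; apply: nWF.
  have [G [h [oG Gx [gh [K [cK KO hK]]] ad]]] : exists G h, [/\ open_cone G, G xi,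
      compact_repr Om (gmul Om (gconst Om phi) (gclass Om f)) h & affine_decay M h G].
    by apply: contrapT => h; apply: nS.
  have [mh eqh] := (gmul_gclass oOm h (moderate_test tp) mf).1 gh.
  exists phi, h; split; last exact: (affine_decays_at wM oG Gx ad).
  by split=> //; split=> //; exists K.
move=> [_ _]; apply; exists phi; split=> // -[_]; apply.
have [G [oG Gx ad]] := decays_affine dh; exists G, h; split=> //.
have [mh hK] := ch; split=> //.
exact/(gmul_gclass oOm h (moderate_test tp) mf).
Qed.

Lemma WF_scale f (x0 xi : vec) t : moderate Om f -> 0 < t ->
  WF_A Om M (gclass Om f) (x0, xi) -> WF_A Om M (gclass Om f) (x0, t *: xi).
Proof.
move=> mf t0 wf; apply: contrapT => nwf; have [/= Ox xi0 _] := wf.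
have txi0 : t *: xi != 0 by rewrite scaler_eq0 negb_or gt_eqF.
move: nwf => /(notin_WF mf Ox txi0)[phi [h [lr dh]]].
apply: ((notin_WF mf Ox xi0).2 _ wf); exists phi, h; split=> //.
have -> : xi = t^-1 *: (t *: xi) by rewrite scalerA mulVf ?scale1r// gt_eqF.
by apply: decays_scale => //; rewrite invr_gt0.
Qed.

Lemma near_mul1 phi psi (x0 : vec) : (\forall y \near x0, phi y = 1) ->
  (\forall y \near x0, psi y = 1) -> \forall y \near x0, phi y * psi y = 1.
Proof.
move=> h1 h2; apply: filterS2 h1 h2 => y -> ->.
by rewrite mulr1.
Qed.

(** Multiplied by each other's cutoffs, [h1] and [h2] represent the same class
    and still decay where they did, so [combine_decays] applies to them; it
    brings in one more cutoff, for which [phi1] does. *)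
Lemma local_repr_combine f (x0 : vec) phi1 h1 phi2 h2 : moderate Om f ->
  local_repr f x0 phi1 h1 -> local_repr f x0 phi2 h2 ->
  exists phi h, local_repr f x0 phi h /\ forall xi, xi != 0 ->
    decays_at M (fsymbol h1) xi \/ decays_at M (fsymbol h2) xi ->
    decays_at M (fsymbol h) xi.
Proof.
move=> mf [t1 n1 c1 e1] [t2 n2 c2 e2].
have mt1 := moderate_test t1; have mt2 := moderate_test t2.
have [mh1 _] := c1; have [mh2 _] := c2.
pose k1 : family_of R n := fun e x => h1 e x * phi2 x.
pose k2 : family_of R n := fun e x => h2 e x * phi1 x.
have ck1 : compact_moderate Om k1.
  exact: (compact_moderateM oOm c1 (compact_moderate_test t2)).
have ck2 : compact_moderate Om k2.
  exact: (compact_moderateM oOm c2 (compact_moderate_test t1)).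
have [mk1 _] := ck1; have [mk2 _] := ck2.
pose F : family_of R n := fun e x => (phi1 x * phi2 x) * f e x.
have mF : moderate Om F by exact: (moderateM oOm (moderateM oOm mt1 mt2) mf).
have eF1 : equivalent Om k1 F.
  have := equivalentM oOm mh1 (moderateM oOm mt1 mf) mt2 mt2 e1 (equivalent_refl mt2).
  by congr equivalent; apply/funext => e; apply/funext => x; rewrite /F; ring.
have eF2 : equivalent Om k2 F.
  have := equivalentM oOm mh2 (moderateM oOm mt2 mf) mt1 mt1 e2 (equivalent_refl mt1).
  by congr equivalent; apply/funext => e; apply/funext => x; rewrite /F; ring.
have ek : equivalent Om k1 k2.
  exact: (equivalent_trans oOm mk1 mF mk2 eF1 (equivalent_sym oOm mk2 mF eF2)).
have [h [ch eh dh]] := combine_decays oOm wM ck1 ck2 ek t1.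
have [mh _] := ch.
exists (fun x => phi1 x * (phi1 x * phi2 x)), h; split.
  split=> //.
  - by apply: (test_funM oOm wM) => //; exact: (test_funM oOm wM).
  - by apply: near_mul1 => //; exact: near_mul1.
  have := equivalentM oOm mt1 mt1 mk1 mF (equivalent_refl mt1) eF1.
  move=> /(equivalent_trans oOm mh (moderateM oOm mt1 mk1) (moderateM oOm mt1 mF) eh).
  by congr equivalent; apply/funext => e; apply/funext => x; rewrite /F mulrA.
move=> xi xi0 hd; apply: dh => //; case: hd => hd; [left|right].
  exact: (decays_cutoff oOm wM c1 t2 xi0 hd).
exact: (decays_cutoff oOm wM c2 t1 xi0 hd).
Qed.

Lemma local_repr_mul f g (x0 : vec) phi h psi k : moderate Om f -> moderate Om g ->
  local_repr f x0 phi h -> local_repr g x0 psi k ->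
  local_repr (fun e x => f e x * g e x) x0 (fun x => phi x * psi x)
    (fun e x => h e x * k e x).
Proof.
move=> mf mg [tp np ch eh] [tq nq ck ek]; have [mh _] := ch; have [mk _] := ck.
split; [exact: (test_funM oOm wM)|exact: near_mul1|exact: compact_moderateM|].
have mp := moderateM oOm (moderate_test tp) mf; have mq := moderateM oOm (moderate_test tq) mg.
have := equivalentM oOm mh mp mk mq eh ek.
by congr equivalent; apply/funext => e; apply/funext => x; ring.
Qed.

(** The sets of sets that contain all the large enough sets satisfying [P] form
    a filter; the covering form of compactness, applied to this filter,
    replaces the extraction of a finite subcovering. *)
Lemma compact_induction (T : topologicalType) (K : set T) (P : set T -> Prop) :
  compact K -> P set0 -> (forall A B, A `<=` B -> P B -> P A) ->
  (forall A B, P A -> P B -> P (A `|` B)) ->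
  (forall x, K x -> exists2 N, nbhs x N & P N) -> P K.
Proof.
move=> /compact_near_coveringP cK P0 PS PU PN.
pose F : set_system (set T) := [set S | exists2 A, P A & forall B, P B -> A `<=` B -> S B].
have FF : Filter F.
  split.
  - by exists set0.
  - move=> S1 S2 [A1 P1 h1] [A2 P2 h2]; exists (A1 `|` A2); first exact: PU.
    move=> B PB AB; split.
      by apply: h1 => //; apply: subset_trans AB => z; left.
    by apply: h2 => //; apply: subset_trans AB => z; right.
  - by move=> S1 S2 S12 [A PA h]; exists A => // B PB AB; apply: S12; exact: h.
have [A PA h] : \forall B \near F, K `<=` B.
  apply: (cK _ F (fun B x => B x)) => x Kx; have [N xN PNN] := PN x Kx.
  exists (N, [set B | N `<=` B]) => /=; first by split=> //; exists N.
  by move=> [y B] /= [Ny NB]; exact: NB.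
exact: (PS _ _ (h A PA (@subset_refl _ _)) PA).
Qed.

(** Each pair of the unit sphere with sum on the closed half-line of [xi0] has
    a regular component, and regularity is an open condition; by compactness
    finitely many local representatives of each factor cover all these pairs,
    and they are merged into one for each factor. *)
Lemma notin_WF_mul f g (x0 xi0 : vec) : moderate Om f -> moderate Om g -> Om x0 -> xi0 != 0 ->
  ~ fiber_sum (WF_A Om M (gclass Om f)) (WF_A Om M (gclass Om g)) (x0, 0) ->
  ~ fiber_sum (WF_A Om M (gclass Om f)) (WF_A Om M (gclass Om g)) (x0, xi0) ->
  ~ WF_A Om M (gclass Om f) (x0, xi0) -> ~ WF_A Om M (gclass Om g) (x0, xi0) ->
  ~ WF_A Om M (gclass Om (fun e x => f e x * g e x)) (x0, xi0).
Proof.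
move=> mf mg Ox xi00 n0 nxi nf ng.
have [phi0 [h0 [lf0 df0]]] := (notin_WF mf Ox xi00).1 nf.
have [psi0 [k0 [lg0 dg0]]] := (notin_WF mg Ox xi00).1 ng.
(* The condition on the sum is the equality case of the Cauchy-Schwarz
   inequality: [q.1 + q.2] is on the closed half-line of [xi0]. *)
pose K : set (vec * vec) := [set q | `|q| = 1] `&`
  [set q | dotp (q.1 + q.2) xi0 - enorm (q.1 + q.2) * enorm xi0 = 0].
have cK : compact K.
  apply: compact_closedI compact_pair_sphere _.
  apply: (@preimage_closed _ _ (fun q : vec * vec =>
    dotp (q.1 + q.2) xi0 - enorm (q.1 + q.2) * enorm xi0) [set x | x = 0]).
    move=> q _.
    have cE : continuous (fun v : vec => dotp v xi0 - enorm v * enorm xi0).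
      move=> v; apply: (continuousB (@continuous_dotp R n xi0 v)).
      exact: (continuousM (@continuous_enorm R n v) (@cst_continuous _ _ (enorm xi0) v)).
    exact: (continuous_comp (@continuous_pairD R n q) (cE _)).
  exact: closed_eq.
pose P (A : set (vec * vec)) := exists phi h psi k,
  [/\ local_repr f x0 phi h, local_repr g x0 psi k &
   forall q, A q -> decays_at M (fsymbol h) q.1 \/ decays_at M (fsymbol k) q.2].
have nz a (z : vec) : decays_at M a z -> z != 0.
  by move=> [G [c [[_ G0 _] Gz _ _]]]; apply/eqP => z0; apply: G0; rewrite -z0.
have near_decay a (z : vec) : decays_at M a z -> nbhs z [set z | decays_at M a z].
  move=> [G [c [[oG G0 sG] Gz c1 H]]].
  have : nbhs z G by exact: open_nbhs_nbhs.
  by apply: filterS => y Gy; exists G, c.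
have [phi [h [psi [k [lh lk hd]]]]] : P K.
  apply: compact_induction => //.
  - by exists phi0, h0, psi0, k0; split.
  - move=> A B AB [phi [h [psi [k [lh lk hd]]]]]; exists phi, h, psi, k; split=> //.
    by move=> q /AB; exact: hd.
  - move=> A B [phi1 [h1 [psi1 [k1 [l1 m1 d1]]]]] [phi2 [h2 [psi2 [k2 [l2 m2 d2]]]]].
    have [phi [h [lh dh]]] := local_repr_combine mf l1 l2.
    have [psi [k [lk dk]]] := local_repr_combine mg m1 m2.
    exists phi, h, psi, k; split=> // q [/d1|/d2] [d|d].
    + by left; apply: dh (nz _ _ d) _; left.
    + by right; apply: dk (nz _ _ d) _; left.
    + by left; apply: dh (nz _ _ d) _; right.
    + by right; apply: dk (nz _ _ d) _; right.
  move=> [z eta] [/= q1 /eqP]; rewrite subr_eq0 => /eqP /(dotp_eq_enorm xi00)[t t0 zt].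
  have good_z : z != 0 -> ~ WF_A Om M (gclass Om f) (x0, z) -> exists2 N, nbhs (z, eta) N & P N.
    move=> z0 /(notin_WF mf Ox z0)[phi [h [lh dh]]].
    exists (fst @^-1` [set z | decays_at M (fsymbol h) z]).
      exact: (@cvg_fst _ _ (nbhs z) (nbhs eta) _ _ (near_decay _ _ dh)).
    by exists phi, h, psi0, k0; split=> // -[y1 y2] /= d; left.
  have good_eta : eta != 0 -> ~ WF_A Om M (gclass Om g) (x0, eta) ->
      exists2 N, nbhs (z, eta) N & P N.
    move=> eta0 /(notin_WF mg Ox eta0)[psi [k [lk dk]]].
    exists (snd @^-1` [set z | decays_at M (fsymbol k) z]).
      exact: (@cvg_snd _ _ (nbhs z) (nbhs eta) _ _ (near_decay _ _ dk)).
    by exists phi0, h0, psi, k; split=> // -[y1 y2] /= d; right.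
  have tpos : z + eta != 0 -> 0 < t.
    move=> ze; rewrite lt_neqAle t0 andbT eq_sym; apply: contraNneq ze => t0'.
    by rewrite zt t0' scale0r.
  (* A vanishing component leaves [xi0] itself as the direction of the other
     one. *)
  have [z0|z0] := eqVneq z 0.
    have eta0 : eta != 0.
      by apply/eqP => e0; move: q1; rewrite z0 e0 normr0 => /eqP; rewrite eq_sym oner_eq0.
    apply: good_eta => // wg; apply: ng; rewrite z0 add0r in zt tpos.
    have tp := tpos eta0; have -> : xi0 = t^-1 *: eta.
      by rewrite zt scalerA mulVf ?scale1r// gt_eqF.
    by apply: WF_scale => //; rewrite invr_gt0.
  have [eta0|eta0] := eqVneq eta 0.
    apply: good_z => // wf; apply: nf; rewrite eta0 addr0 in zt tpos.
    have tp := tpos z0; have -> : xi0 = t^-1 *: z.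
      by rewrite zt scalerA mulVf ?scale1r// gt_eqF.
    by apply: WF_scale => //; rewrite invr_gt0.
  have [wf|nwf] := pselect (WF_A Om M (gclass Om f) (x0, z)); last exact: good_z.
  have [wg|nwg] := pselect (WF_A Om M (gclass Om g) (x0, eta)); last exact: good_eta.
  (* Both directions are singular: their sum is 0, or a positive multiple of
     [xi0]. *)
  exfalso; have [ze0|ze0] := eqVneq (z + eta) 0.
    by apply: n0; exists z, eta; split.
  have tp := tpos ze0; apply: nxi; exists (t^-1 *: z), (t^-1 *: eta); split=> /=.
  - by apply: WF_scale => //; rewrite invr_gt0.
  - by apply: WF_scale => //; rewrite invr_gt0.
  - by rewrite -scalerDr zt scalerA mulVf ?scale1r// gt_eqF.
have mfg := moderateM oOm mf mg.
apply/(notin_WF mfg Ox xi00).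
exists (fun x => phi x * psi x), (fun e x => h e x * k e x); split.
  exact: local_repr_mul.
have [_ _ ch _] := lh; have [_ _ ck _] := lk.
apply: (product_decays oOm wM ch ck xi00) => z eta zeta hray.
pose s := `|(z, eta)|; have s0 : 0 < s by rewrite normr_gt0.
have Kq : K (s^-1 *: z, s^-1 *: eta).
  split=> /=.
    have -> : (s^-1 *: z, s^-1 *: eta) = s^-1 *: (z, eta) by [].
    by rewrite normrZ ger0_norm ?invr_ge0 ?(ltW s0)// mulVf// gt_eqF.
  rewrite -scalerDr dotpZl enormZ ?invr_ge0 ?(ltW s0)// hray -mulrA subrr//.
have back (v : vec) : v = s *: (s^-1 *: v) by rewrite scalerA mulfV ?scale1r// gt_eqF.
by case: (hd _ Kq) => /= d; [left|right]; rewrite [X in decays_at _ _ X]back;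
  exact: decays_scale.
Qed.

End WaveFront.

Theorem theorem20 (R : realType) (n : nat) (Om : set 'rV[R]_n) (M : nat -> R)
    (f g : set (family_of R n)) :
  open Om -> Om !=set0 -> weight_sequence M ->
  colombeau Om f -> colombeau Om g ->
  (forall x, Om x ->
     ~ fiber_sum (WF_A Om M f) (WF_A Om M g) (x, 0)) ->
  WF_A Om M (gmul Om f g) `<=`
    fiber_sum (WF_A Om M f) (WF_A Om M g) `|` WF_A Om M f `|` WF_A Om M g.
Proof.
move=> oOm _ wM [F mF <-] [G mG <-] n0 [x0 xi0] wfg.
have [/= Ox xi00 _] := wfg.
rewrite (gmul_gclassE oOm mF mG) in wfg.
apply: contrapT => /= /not_orP[/not_orP[ns nf] ng].
exact: (notin_WF_mul oOm wM mF mG Ox xi00 (n0 x0 Ox) ns nf ng).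
Qed.
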